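(* Let $V$ be a totally umbilical lightlike hypersurface of an $n$-dimensional pseudo-Riemannian manifold $(M,g)$ of Lorentzian signature, $n\ge4$. Suppose that the isotropic sectional curvature of $V$ does not vanish. Then the singular point $F$ of the isotropic geodesic $xe_1$ of $V$ describes an isotropic line $\gamma$ (its differential $dF$ is a nonzero 1-form times $e_1$). On $V$ one can define an invariant screen distribution $S$ intrinsically connected with the geometry of $V$: it is the distribution of directions of displacement of $x$ in $V$ under which $F$ is fixed, $dF=0$. This distribution $S$ is integrable if and only if $R^1_{1ab}=0$ on $V$ for all $a,b=2,\dots,n-1$, where the components are taken in isotropic frames adapted to $S$ (i.e. with $e_2,\dots,e_{n-1}$ spanning $S_x$).
   Context: $(M,g)$ has signature $(n-1,1)$, with Levi-Civita connection $D$. A lightlike hypersurface $V$ is a hypersurface ($\dim V=n-1$) on which $g$ has rank $n-2$. A first-order isotropic frame at $x\in V$ is a basis $(e_1,\dots,e_n)$ of $T_xM$ with $e_1$ isotropic, $T_xV=\mathrm{span}(e_1,\dots,e_{n-1})$, $e_a$ ($a=2,\dots,n-1$) spacelike and orthogonal to $e_1$, $g_{ab}=(e_a,e_b)$ positive definite, $e_n$ isotropic, $(e_1,e_n)=-1$, $(e_a,e_n)=0$. Write $dx=\omega^ie_i$, $De_i=\omega^j_ie_j$; structure equations $d\omega^i=\omega^j\wedge\omega^i_j$, $d\omega^i_j=\omega^k_j\wedge\omega^i_k+R^i_{jkl}\omega^k\wedge\omega^l$; $R_{ijkl}=g_{im}R^m_{jkl}$. On $V$: $\omega^n=0$, $\omega^1,\omega^a$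 form a coframe, $\omega^n_a=\lambda_{ab}\omega^b$ with $\lambda_{ab}=\lambda_{ba}$. $V$ is totally umbilical if $\lambda_{ab}=\lambda g_{ab}$ with $\lambda\ne0$. The integral curves of the isotropic direction field $e_1$ on $V$ are its isotropic geodesics; under the development onto the tangent space $T_xM$ the one through $x$ becomes the line $x+se_1$, whose only singular point (zero of $\det((1+s\lambda)\delta^a_b)$) is $F=x-\frac1\lambda e_1$. The differential of $F$ is formed with $dx=\omega^1e_1+\omega^ae_a$ and $De_1=\omega_1^1e_1+\omega_1^ae_a$, $\omega_1^a=\lambda\omega^a$: $$dF=\frac1{\lambda^2}\bigl(d\lambda-\lambda\omega_1^1+\lambda^2\omega^1\bigr)e_1 .$$ The isotropic sectional curvature of $V$ for an isotropic 2-plane $\sigma=e_1\wedge P$, $P=p^1e_1+p^ae_a$, $(p^a)\ne0$, is $K_N(\sigma)=\dfrac{R_{1ab1}p^ap^b}{g_{ab}p^ap^b}$ ($N=e_1$); for totally umbilical $V$ it does not depend on $P$. ''Does not vanish'' means it is nonzero at every point of $V$. A screen distribution is a smooth field of $(n-2)$-dimensional subspaces $S_x\subset T_xV$ complementary to $\mathbb{R}e_1$; it is invariant if $S_x$ does not depend on the choice of first-order isotropic frame, and intrinsically connected with the geometry of $V$ if it is determined by $(M,g)$ and $V$ alone. *)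

(* Defs.v *)
From HB Require Import structures.
From mathcomp Require Import all_boot all_order all_algebra.
From mathcomp Require Import boolp classical_sets functions cardinality reals.
From mathcomp Require Import topology normedtype derive.
Set Implicit Arguments.
Unset Strict Implicit.
Unset Printing Implicit Defensive.
Import Order.TTheory GRing.Theory Num.Theory.
Import numFieldNormedType.Exports.
Local Open Scope classical_set_scope.
Local Open Scope ring_scope.

Section Smoothness.
Variables (R : realType) (A B : normedModType R).

Fixpoint Ck_on (k : nat) (h : A -> B) (U : set A) : Prop :=
  match k with
  | 0%N => forall x, U x -> {for x, continuous h}
  | k'.+1 => (forall x, U x -> differentiable h x) /\
             forall v : A, Ck_on k' (fun x => 'd h x v) U
  end.

(* Only used for open U. *)
Definition smooth_on (h : A -> B) (U : set A) : Prop :=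
  forall k, Ck_on k h U.

End Smoothness.

Section Manifolds.
Variable R : realType.

Record chart (n : nat) (T : topologicalType) := Chart {
  cdom : set T;
  cmap : T -> 'rV[R]_n;
  cinv : 'rV[R]_n -> T;
  cdom_open : open cdom;
  cimg_open : open (cmap @` cdom);
  cmapK : forall x, cdom x -> cinv (cmap x) = x;
  cmap_continuous : {within cdom, continuous cmap};
  cinv_continuous : {within cmap @` cdom, continuous cinv} }.

(* A smooth atlas indexed by the points: chart_at p is a chart around p.
   "The chart p" below means chart_at p. *)
Record manifold (n : nat) := Manifold {
  carrier :> topologicalType;
  carrier_hausdorff : hausdorff_space carrier;
  carrier_second_countable : @second_countable carrier;
  chart_at : carrier -> chart n carrier;
  chart_at_dom : forall p, cdom (chart_at p) p;
  chart_compat : forall p q,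
    smooth_on (cmap (chart_at q) \o cinv (chart_at p))
      (cmap (chart_at p) @` (cdom (chart_at p) `&` cdom (chart_at q))) }.

Section Charts.
Variables (n : nat) (M : manifold n).

Definition dom (p : M) : set M := cdom (chart_at p).
Definition coord (p : M) : M -> 'rV[R]_n := cmap (chart_at p).
Definition point (p : M) : 'rV[R]_n -> M := cinv (chart_at p).
Definition transition (p q : M) : 'rV[R]_n -> 'rV[R]_n := coord q \o point p.
Definition overlap (p q : M) : set 'rV[R]_n := coord p @` (dom p `&` dom q).

(* T_xM is identified with 'rV_n through the chart x; tcoord p x v are the
   components in the chart p of the vector v of T_xM. *)
Definition tcoord (p x : M) (v : 'rV[R]_n) : 'rV[R]_n :=
  'd (transition x p) (coord x x) v.

End Charts.

Section Maps.
Variables (d n : nat) (V : manifold d) (M : manifold n) (f : V -> M).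

Definition smooth_map : Prop :=
  continuous f /\
  forall p q, smooth_on (coord q \o f \o point p)
                        (coord p @` (dom p `&` f @^-1` dom q)).

(* The differential T_xV -> T_{f x}M. *)
Definition tmap (x : V) (v : 'rV[R]_d) : 'rV[R]_n :=
  'd (coord (f x) \o f \o point x) (coord x x) v.

Definition immersion : Prop := smooth_map /\ forall x, injective (tmap x).

Definition tangent_image (x : V) : {vspace 'rV[R]_n} := limg (linfun (tmap x)).

(* A vector field along f assigns to x an element of T_{f x}M; field_rep p q xi
   is its expression in the chart p of V and the chart q of M. *)
Definition field_rep (p : V) (q : M) (xi : V -> 'rV[R]_n) :
    'rV[R]_d -> 'rV[R]_n :=
  fun u => tcoord q (f (point p u)) (xi (point p u)).

Definition smooth_field (W : set V) (xi : V -> 'rV[R]_n) : Prop :=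
  forall p q, smooth_on (field_rep p q xi)
                (coord p @` (dom p `&` W `&` f @^-1` dom q)).

End Maps.

(* Covectors of T_xV are column vectors. *)
Definition smooth_form (d : nat) (V : manifold d) (W : set V)
    (phi : V -> 'cV[R]_d) : Prop :=
  forall p : V,
    smooth_on (fun u => jacobian (transition p (point p u)) u *m phi (point p u))
              (coord p @` (dom p `&` W)).

Section Metric.
Variables (n : nat) (M : manifold n).

(* gcoef p u is the Gram matrix of g in the chart p, at coordinates u. *)
Record lorentz_metric := LorentzMetric {
  gcoef : M -> 'rV[R]_n -> 'M[R]_n;
  gcoef_smooth : forall p, smooth_on (gcoef p) (coord p @` dom p);
  gcoef_sym : forall p u, (coord p @` dom p) u -> (gcoef p u)^T = gcoef p u;
  gcoef_signature : forall p u, (coord p @` dom p) u ->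
    exists2 P : 'M[R]_n, P \in unitmx &
      P *m gcoef p u *m P^T =
        diag_mx (\row_(i < n) (if i.+1 == n then -1 else 1));
  gcoef_transition : forall p q u, overlap p q u ->
    gcoef p u = jacobian (transition p q) u *m gcoef q (transition p q u)
                *m (jacobian (transition p q) u)^T }.

Definition gprod (g : lorentz_metric) (x : M) (v w : 'rV[R]_n) : R :=
  (v *m gcoef g x (coord x x) *m w^T) 0 0.

Definition christoffel_apply (G : M -> 'I_n -> 'rV[R]_n -> 'M[R]_n) (p : M)
    (u v w : 'rV[R]_n) : 'rV[R]_n :=
  \row_k (v *m G p k u *m w^T) 0 0.

(* An affine connection given by its symbols: (Gam p k u) i j is Gamma^k_ij in
   the chart p, so that D_v w = dw(v) + Gamma(v, w). *)
Record connection := Connection {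
  Gam : M -> 'I_n -> 'rV[R]_n -> 'M[R]_n;
  Gam_smooth : forall p k, smooth_on (Gam p k) (coord p @` dom p);
  Gam_transition : forall p q u v w, overlap p q u ->
    let psi := transition p q in
    'd psi u (christoffel_apply Gam p u v w) =
    'd (fun y => 'd psi y w) u v
      + christoffel_apply Gam q (psi u) ('d psi u v) ('d psi u w) }.

Definition Gamma (D : connection) := christoffel_apply (Gam D).

Definition levi_civita (g : lorentz_metric) (D : connection) : Prop :=
  forall p u, (coord p @` dom p) u ->
    (forall v w, Gamma D p u v w = Gamma D p u w v) /\
    (forall v w z : 'rV[R]_n,
       'd (fun y => (w *m gcoef g p y *m z^T) 0 0) u v =
       (Gamma D p u v w *m gcoef g p u *m z^T) 0 0 +
       (w *m gcoef g p u *m (Gamma D p u v z)^T) 0 0 :> R).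

(* R(u, v) w = D_u D_v w - D_v D_u w - D_[u, v] w at x. *)
Definition riemann (D : connection) (x : M) (u v w : 'rV[R]_n) : 'rV[R]_n :=
  let c := coord x x in
  'd (fun y => Gamma D x y v w) c u - 'd (fun y => Gamma D x y u w) c v
  + Gamma D x c u (Gamma D x c v w) - Gamma D x c v (Gamma D x c u w).

End Metric.

(* D_v xi in T_{f x}M, for v in T_xV and a vector field xi along f. *)
Definition covd (d n : nat) (V : manifold d) (M : manifold n) (D : connection M)
    (f : V -> M) (x : V) (v : 'rV[R]_d) (xi : V -> 'rV[R]_n) : 'rV[R]_n :=
  'd (field_rep f x (f x) xi) (coord x x) v
  + Gamma D (f x) (coord (f x) (f x)) (tmap f x v) (xi x).

End Manifolds.

Section Frames.
Variables (R : realType) (m : nat).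
Variables (M : manifold R m.+2) (g : lorentz_metric M) (D : connection M).
Variables (V : manifold R m.+1) (f : V -> M).

(* With n = m + 2, the frame indices 1, a (2 <= a <= n - 1) and n. *)
Definition i1 : 'I_m.+2 := ord0.
Definition ia (a : 'I_m) : 'I_m.+2 := lift ord0 (lift ord_max a).
Definition inn : 'I_m.+2 := ord_max.

(* g has rank n - 2 = m on T_xV. *)
Definition lightlike : Prop :=
  forall x : V,
    let J := lin1_mx (tmap f x) in
    \rank (J *m gcoef g (f x) (coord (f x) (f x)) *m J^T) = m.

(* A frame at x is the matrix E whose rows are e_1, ..., e_n. *)
Definition screen_gram (x : V) (E : 'M[R]_m.+2) : 'M[R]_m :=
  \matrix_(a, b) gprod g (f x) (row (ia a) E) (row (ia b) E).

Record isotropic_frame (x : V) (E : 'M[R]_m.+2) : Prop := IsotropicFrame {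
  frame_basis : E \in unitmx;
  frame_tangent : tangent_image f x =
    <<[seq row (lift ord_max i) E | i <- enum 'I_m.+1]>>%VS;
  frame_e1_isotropic : gprod g (f x) (row i1 E) (row i1 E) = 0;
  frame_en_isotropic : gprod g (f x) (row inn E) (row inn E) = 0;
  frame_e1_en : gprod g (f x) (row i1 E) (row inn E) = -1;
  frame_ea_e1 : forall a, gprod g (f x) (row (ia a) E) (row i1 E) = 0;
  frame_ea_en : forall a, gprod g (f x) (row (ia a) E) (row inn E) = 0;
  frame_posdef : forall p : 'rV[R]_m, p != 0 ->
    0 < (p *m screen_gram x E *m p^T) 0 0 }.

Definition isotropic_frame_field (W : set V) (E : V -> 'M[R]_m.+2) : Prop :=
  [/\ open W, (forall i, smooth_field f W (fun y => row i (E y)))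
    & forall x, W x -> isotropic_frame x (E x)].

(* coframe E i x = omega^i and conn_form E i j x = omega^i_j, on T_xV. *)
Definition coframe (E : V -> 'M[R]_m.+2) (i : 'I_m.+2) (x : V)
    (v : 'rV[R]_m.+1) : R :=
  (tmap f x v *m invmx (E x)) 0 i.

Definition conn_form (E : V -> 'M[R]_m.+2) (i j : 'I_m.+2) (x : V)
    (v : 'rV[R]_m.+1) : R :=
  (covd D f x v (fun y => row j (E y)) *m invmx (E x)) 0 i.

(* L = (lambda_ab), characterized by omega^n_a = lambda_ab omega^b. *)
Definition second_form (E : V -> 'M[R]_m.+2) (x : V) (L : 'M[R]_m) : Prop :=
  forall a v, conn_form E inn (ia a) x v = \sum_b L a b * coframe E (ia b) x v.

Definition umbilical_at (E : V -> 'M[R]_m.+2) (x : V) (l : R) : Prop :=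
  l != 0 /\ second_form E x (l *: screen_gram x (E x)).

Definition totally_umbilical : Prop :=
  forall W E, isotropic_frame_field W E ->
    forall x, W x -> exists l, umbilical_at E x l.

Definition umbilical_frame_field (W : set V) (E : V -> 'M[R]_m.+2)
    (l : V -> R) : Prop :=
  isotropic_frame_field W E /\ forall x, W x -> umbilical_at E x (l x).

(* Zeros of s |-> det ((1 + s lambda) delta^a_b) are the parameters of the
   singular points of the line x + s e_1. *)
Definition singular_parameter (l s : R) : Prop :=
  \det ((1 + s * l)%:M : 'M[R]_m) = 0.

(* dF(v) for the point F = x - lambda^-1 e_1 of the affine space T_xM: dx(v) is
   the image of v, and the vector part is differentiated with D. *)
Definition dF (E : V -> 'M[R]_m.+2) (l : V -> R) (x : V)
    (v : 'rV[R]_m.+1) : 'rV[R]_m.+2 :=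
  tmap f x v + covd D f x v (fun y => - (l y)^-1 *: row i1 (E y)).

(* R^i_jkl in the frame E at x. In d omega^i_j = omega^k_j /\ omega^i_k +
   R^i_jkl omega^k /\ omega^l the sum runs over all pairs (k, l), whence
   R(e_k, e_l) e_j = 2 R^i_jkl e_i. *)
Definition Rup (x : V) (E : 'M[R]_m.+2) (i j k l : 'I_m.+2) : R :=
  2^-1 * (riemann D (f x) (row k E) (row l E) (row j E) *m invmx E) 0 i.

Definition Rlow (x : V) (E : 'M[R]_m.+2) (i j k l : 'I_m.+2) : R :=
  \sum_h gprod g (f x) (row i E) (row h E) * Rup x E h j k l.

(* K_N(sigma), N = e_1, sigma = e_1 /\ (p^1 e_1 + p^a e_a). *)
Definition isotropic_curvature (x : V) (E : 'M[R]_m.+2) (p : 'rV[R]_m) : R :=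
  (\sum_a \sum_b Rlow x E i1 (ia a) (ia b) i1 * p 0 a * p 0 b) /
  (\sum_a \sum_b screen_gram x E a b * p 0 a * p 0 b).

Definition isotropic_curvature_nonvanishing : Prop :=
  forall x E, isotropic_frame x E ->
    forall p, p != 0 -> isotropic_curvature x E p != 0.

Definition smooth_distribution (S : V -> {vspace 'rV[R]_m.+1}) : Prop :=
  forall x, exists W (X : 'I_m -> V -> 'rV[R]_m.+1),
    [/\ open W, W x, (forall i, smooth_field idfun W (X i))
      & forall y, W y -> S y = <<[seq X i y | i <- enum 'I_m]>>%VS].

Definition screen_distribution (S : V -> {vspace 'rV[R]_m.+1}) : Prop :=
  [/\ smooth_distribution S,
      (forall x, \dim (S x) = m)
    & forall x E v, isotropic_frame x E -> tmap f x v = row i1 E ->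
        (S x :&: <[v]>)%VS = 0%VS /\ (S x + <[v]>)%VS = fullv].

(* S_x = ker dF, whichever frame field around x is used: S is invariant, and
   determined by g and f. *)
Definition fixes_F (S : V -> {vspace 'rV[R]_m.+1}) : Prop :=
  forall W E l, umbilical_frame_field W E l ->
    forall x, W x -> forall v, v \in S x <-> dF E l x v = 0.

Definition adapted (S : V -> {vspace 'rV[R]_m.+1}) (x : V)
    (E : 'M[R]_m.+2) : Prop :=
  (linfun (tmap f x) @: S x)%VS = <<[seq row (ia a) E | a <- enum 'I_m]>>%VS.

(* An integral manifold through every point, parametrized by h : U -> V; its
   rank is the dimension m of S. *)
Definition integrable_distribution (S : V -> {vspace 'rV[R]_m.+1}) : Prop :=
  forall x, exists (U : set 'rV[R]_m) (h : 'rV[R]_m -> V),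
    [/\ open U, U 0, h 0 = x,
        (forall u, U u -> {for u, continuous h}) /\
        (forall q, smooth_on (coord q \o h) (U `&` h @^-1` dom q))
      & forall u, U u -> limg (linfun ('d (coord (h u) \o h) u)) = S (h u)].

End Frames.

(* Main.v *)
Require Import Defs.
From HB Require Import structures.
From mathcomp Require Import all_boot all_order all_algebra.
From mathcomp Require Import boolp classical_sets functions reals.
From mathcomp Require Import topology normedtype landau derive.
From mathcomp Require Import ereal measure lebesgue_measure lebesgue_integral ftc.
From mathcomp Require Import ring lra zify.
Import Defs.
Set Implicit Arguments.
Unset Strict Implicit.
Unset Printing Implicit Defensive.
Import Order.TTheory GRing.Theory Num.Theory.
Import numFieldNormedType.Exports.
Local Open Scope classical_set_scope.
Local Open Scope ring_scope.

(** Write F = x + xi with xi = - lambda^-1 e_1, a vector field along the immersion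
of V, so that dF(v) = dx(v) + D_v xi.

Umbilicity amounts to (D_v e_1, w) = lambda (v, w) for all v, w tangent to V
[umbilical_eq].  The tangential parts of dx(v) and D_v xi therefore cancel: dF(v)
is orthogonal to T_xV, and the orthogonal complement of T_xV is spanned by e_1.
Thus dF = phi e_1 for a 1-form phi [dF_pole_form], smooth because lambda is a
quotient of metric products of smooth fields [l_smooth].  Replacing e_1 by c e_1
replaces lambda by c lambda, so that xi, hence F and the kernel of phi, do not
depend on the frame [pole_invariant].  Smooth isotropic frame fields exist around
every point [frame_field_exists], so S = ker phi is defined on all of V.

Differentiating dF = phi e_1 once more and skew-symmetrizing gives
  R(v, w) xi = dphi(v, w) e_1 + phi(w) D_v e_1 - phi(v) D_w e_1
[riemann_pole], and this identity is used twice.  For v = e_a and w = e_1, paired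
with e_a, it says that the isotropic sectional curvature is lambda^2 phi(e_1) / 2
[isotropic_curvature_pole].  If it does not vanish then phi(e_1) is nonzero: phi
has no zeros, and S is a hyperplane field complementary to e_1.  For v and w in S
it says R(v, w) e_1 = - lambda dphi(v, w) e_1, so that R^1_1ab = 0 in the frames
adapted to S exactly when dphi vanishes on S [Rup_ext].

It remains to see that S = ker phi is integrable if and only if dphi vanishes on
S.  If there are integral manifolds, phi, hence dphi, pulls back to zero on them
[closed_of_integrable].  Conversely let the rows of a matrix L(y) span S in a
chart.  An integral manifold is a solution y(s) of dy = ds L(y)
[integrable_of_closed], and such a total differential equation is solvable when
the derivative of L satisfies a symmetry condition [total_differential], which
here is the vanishing of dphi on S [frame_rows_symmetric].  It is solved along
the rays from the origin by Picard iteration; comparing neighbouring rays by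
Gronwall's inequality shows that the solutions fit together differentiably. *)

(** * Smooth maps between normed spaces *)

Section Differential.
Variables (R : realType) (A B : normedModType R).
Implicit Types (f g : A -> B) (x v : A).

Lemma diff_epsilon f x : differentiable f x -> forall e : R, 0 < e ->
  \forall h \near (0 : A), `|f (h + x) - f x - 'd f x h| <= e * `|h|.
Proof.
move=> /diff_locallyP[_ /eqaddoP df] e e0.
have := df _ e0; apply: filterS => h; rewrite /= !fctE /=.
by rewrite opprD addrA.
Qed.

(** For use where the differential is known in advance. *)
Lemma diff_of_epsilon f x (L : {linear A -> B}) : continuous L ->
  (forall e : R, 0 < e ->
     \forall h \near (0 : A), `|f (h + x) - f x - L h| <= e * `|h|) ->
  differentiable f x /\ 'd f x = L :> (A -> B).
Proof.
move=> cL H.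
have E : f \o shift x = cst (f x) + L +o_ (0 : A) id.
  apply/eqaddoP => e e0; have := H _ e0; apply: filterS => h.
  by rewrite /= !fctE /= opprD addrA.
have D := diff_unique cL E; split => //.
by apply/diff_locallyP; rewrite D.
Qed.

Lemma near_eq_differentiable f g x : (\forall y \near x, f y = g y) ->
  differentiable f x -> differentiable g x /\ 'd g x = 'd f x :> (A -> B).
Proof.
move=> fg df; apply: diff_of_epsilon; first exact: diff_continuous.
move=> e e0; have fgx := nbhs_singleton fg.
have := diff_epsilon df e0; apply: filter_app.
have : \forall h \near (0 : A), f (h + x) = g (h + x).
  move: fg; rewrite (near_shift 0) => fg; apply: filterS fg => h.
  by rewrite /= subr0.
by apply: filterS => h <-; rewrite -fgx.
Qed.

Lemma near_eq_diff f g x v : differentiable f x ->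
  (\forall y \near x, f y = g y) -> 'd g x v = 'd f x v.
Proof. by move=> df fg; have [_ ->] := near_eq_differentiable fg df. Qed.

Lemma diff_near_cst f (c : B) x v : (\forall y \near x, f y = c) ->
  'd f x v = 0.
Proof.
move=> fc; rewrite (@near_eq_diff (cst c) f x v) //; first by rewrite diff_cst.
by apply: filterS fc => y ->.
Qed.

End Differential.

Section SmoothAt.
Variable R : realType.
Implicit Types A B C D : normedModType R.

(** Smoothness on some neighbourhood of x. The open domain is existentially
quantified, which frees the closure properties from side conditions on domains.
*)
Definition smooth_at A B (x : A) (h : A -> B) : Prop :=
  exists2 W : set A, open W /\ W x & smooth_on h W.

Lemma Ck_onS A B k (h : A -> B) U : Ck_on k.+1 h U -> Ck_on k h U.
Proof.
elim: k h => [|k IH] h [dh ch] /=.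
  by move=> x /dh; exact: differentiable_continuous.
by split => // v; exact: IH.
Qed.

Lemma Ck_on_sub A B k (h : A -> B) U U' : U' `<=` U ->
  Ck_on k h U -> Ck_on k h U'.
Proof.
move=> sU; elim: k h => [|k IH] h /=; first by move=> ch x /sU; exact: ch.
by move=> [dh ch]; split => [x /sU|v]; [exact: dh|exact: IH].
Qed.

(** Continuity and differentiability at x do not refer to the set U, so a
property of order k may be checked one point at a time. *)
Lemma Ck_onP A B k (h : A -> B) U :
  (forall x, U x -> Ck_on k h [set x]) -> Ck_on k h U.
Proof.
elim: k h => [|k IH] h /=; first by move=> ch x /ch; exact.
move=> ch; split => [x /ch[dh _]|v]; first exact: dh.
by apply: IH => x /ch[].
Qed.

Lemma Ck_on_ext A B k (h h' : A -> B) U : open U ->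
  (forall x, U x -> h x = h' x) -> Ck_on k h U -> Ck_on k h' U.
Proof.
move=> oU; elim: k h h' => [|k IH] h h' e /=.
  move=> ch x Ux; move: (ch x Ux); rewrite /prop_for /continuous_at -(e x Ux).
  apply: cvg_trans; apply: near_eq_cvg; apply: filterS (open_nbhs_nbhs (conj oU Ux)).
  by move=> y Uy; rewrite e.
have near x : U x -> \forall y \near x, h y = h' y.
  move=> Ux; apply: filterS (open_nbhs_nbhs (conj oU Ux)).
  by move=> y Uy; rewrite e.
move=> [dh ch]; split => [x Ux|v].
  by have [] := near_eq_differentiable (near x Ux) (dh x Ux).
apply: IH (ch v) => x Ux.
by rewrite (near_eq_diff _ (dh x Ux) (near x Ux)).
Qed.

Lemma smooth_onP A B (h : A -> B) U : open U ->
  smooth_on h U <-> forall x, U x -> smooth_at x h.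
Proof.
move=> oU; split=> [sh x Ux|sh k]; first by exists U.
by apply: Ck_onP => x /sh[W [_ Wx] /(_ k)]; apply: Ck_on_sub => y ->.
Qed.

Lemma smooth_at_near A B x (h : A -> B) :
  smooth_at x h -> \forall y \near x, smooth_at y h.
Proof.
move=> [W [oW Wx] sW]; apply: filterS (open_nbhs_nbhs (conj oW Wx)) => y Wy.
by exists W.
Qed.

Lemma smooth_at_ext A B x (h h' : A -> B) :
  (\forall y \near x, h y = h' y) -> smooth_at x h -> smooth_at x h'.
Proof.
move=> e [W [oW Wx] sW].
exists (W `&` [set y | h y = h' y]°).
  split; first by apply: openI => //; exact: open_interior.
  by split => //; exact: nbhs_interior e.
move=> k; apply: Ck_on_ext (Ck_on_sub _ (sW k)).
- by apply: openI => //; exact: open_interior.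
- by move=> y [_ /interior_subset].
- by move=> y [].
Qed.

Lemma smooth_at_differentiable A B x (h : A -> B) :
  smooth_at x h -> differentiable h x.
Proof. by move=> [W [_ Wx] /(_ 1%N)[dh _]]; exact: dh. Qed.

Lemma smooth_at_continuous A B x (h : A -> B) :
  smooth_at x h -> {for x, continuous h}.
Proof. by move/smooth_at_differentiable/differentiable_continuous. Qed.

Lemma smooth_at_diff A B x (h : A -> B) v :
  smooth_at x h -> smooth_at x (fun y => 'd h y v).
Proof.
by move=> [W oW sW]; exists W => // k; have [_] := sW k.+1; exact.
Qed.

Lemma Ck_on_cst A B k (c : B) (U : set A) : Ck_on k (fun _ : A => c) U.
Proof.
elim: k c => [|k IH] c /=; first by move=> x _; exact: cst_continuous.
split=> [x _|v]; first exact: differentiable_cst.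
rewrite (_ : (fun _ => _) = fun=> 0); first exact: IH.
by apply: funext => y; rewrite diff_cst.
Qed.

Lemma Ck_on_linear A B k (L : {linear A -> B}) (U : set A) :
  continuous L -> Ck_on k L U.
Proof.
move=> cL; case: k => [|k] /=; first by move=> y _; exact: cL.
split=> [y _|v]; first exact: linear_differentiable.
rewrite (_ : (fun _ => _) = fun=> L v); first exact: Ck_on_cst.
by apply: funext => y; rewrite diff_lin.
Qed.

Lemma Ck_onD A B k (f g : A -> B) U : open U ->
  Ck_on k f U -> Ck_on k g U -> Ck_on k (fun y => f y + g y) U.
Proof.
move=> oU; elim: k f g => [|k IH] f g /=.
  by move=> cf cg x Ux; exact: (continuousD (cf x Ux) (cg x Ux)).
move=> [df cf] [dg cg]; split=> [x Ux|v].
  by apply: (@differentiableD _ _ _ f g); [exact: df|exact: dg].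
apply: Ck_on_ext (IH _ _ (cf v) (cg v)) => // x Ux.
by rewrite (@diffD _ _ _ f g) //; [exact: df|exact: dg].
Qed.

Lemma scaler_is_bilinear B :
  bilinear_for
    (GRing.Scale.Law.clone _ _ *:%R _) (GRing.Scale.Law.clone _ _ *:%R _)
    (@GRing.scale R B).
Proof.
split=> [u'|u] a x y /=.
- by rewrite scalerDl scalerA.
- by rewrite scalerDr !scalerA mulrC.
Qed.

HB.instance Definition _ B := bilinear_isBilinear.Build R R B B _ _
  (@GRing.scale R B) (scaler_is_bilinear B).

Lemma is_diffZf A B (s : A -> R) (f : A -> B) x :
  differentiable s x -> differentiable f x ->
  is_diff x (fun y => s y *: f y) (fun v => s x *: 'd f x v + 'd s x v *: f x).
Proof.
move=> ds df.
have cZ : continuous (fun p : R * B => p.1 *: p.2) by move=> p; exact: scale_continuous.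
have dZ : is_diff (s x, f x) (fun p : R * B => p.1 *: p.2)
    (fun q : R * B => s x *: q.2 + q.1 *: f x).
  by apply: DiffDef; [exact: differentiable_bilin|rewrite diff_bilin].
have dsf := is_diff_pair (differentiableP ds) (differentiableP df).
exact: (is_diff_comp dsf dZ).
Qed.

Lemma Ck_onZ A B k (s : A -> R) (f : A -> B) U : open U ->
  Ck_on k s U -> Ck_on k f U -> Ck_on k (fun y => s y *: f y) U.
Proof.
move=> oU; elim: k s f => [|k IH] s f.
  by move=> /= cs cf x Ux; exact: (cvgZ (cs x Ux) (cf x Ux)).
move=> cs' cf'; have [[ds cs] [df cf]] := (cs', cf'); split=> [x Ux|v].
  by have [] := is_diffZf (ds x Ux) (df x Ux).
have cs0 := Ck_onS cs'; have cf0 := Ck_onS cf'.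
apply: Ck_on_ext (Ck_onD oU (IH _ _ cs0 (cf v)) (IH _ _ (cs v) cf0)) => // x Ux.
by have [_ ->] := is_diffZf (ds x Ux) (df x Ux).
Qed.

Lemma Ck_onM A k (s t : A -> R) U : open U ->
  Ck_on k s U -> Ck_on k t U -> Ck_on k (fun y => s y * t y) U.
Proof. exact: Ck_onZ. Qed.

Lemma Ck_onV A k (s : A -> R) U : open U -> (forall x, U x -> s x != 0) ->
  Ck_on k s U -> Ck_on k (fun y => (s y)^-1) U.
Proof.
move=> oU s0; elim: k => [|k IH] cs'.
  by move=> x Ux; apply: cvgV; [exact: s0|exact: cs'].
have [ds cs] := cs'; have cV := IH (Ck_onS cs').
split=> [x Ux|v].
  exact: (differentiableV (ds x Ux) (s0 x Ux)).
have cM := Ck_onM oU (@Ck_on_cst _ _ k (-1 : R) U) (Ck_onM oU cV (Ck_onM oU cV (cs v))).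
apply: Ck_on_ext cM => // x Ux.
have -> : 'd (fun y => (s y)^-1) x v = - (s x) ^- 2 * 'd s x v.
  exact: (congr1 (fun h : A -> R => h v) (diffV (ds x Ux) (s0 x Ux))).
by rewrite mulN1r expr2 invfM mulNr mulrA.
Qed.

Lemma smooth_at2 A B C D x (f : A -> B) (g : A -> C) (h : A -> D) :
  (forall k U, open U -> Ck_on k f U -> Ck_on k g U -> Ck_on k h U) ->
  smooth_at x f -> smooth_at x g -> smooth_at x h.
Proof.
move=> H [U [oU Ux] sU] [V [oV Vx] sV].
exists (U `&` V); first by split => //; exact: openI.
move=> k; apply: H; first exact: openI.
  by apply: Ck_on_sub (sU k) => y [].
by apply: Ck_on_sub (sV k) => y [].
Qed.

Lemma smooth_at_cst A B x (c : B) : smooth_at x (fun _ : A => c).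
Proof.
by exists setT => [|k]; [split => //; exact: openT|exact: Ck_on_cst].
Qed.

Lemma smooth_at_linear A B (L : {linear A -> B}) x :
  continuous L -> smooth_at x L.
Proof.
move=> cL.
by exists setT => [|k]; [split => //; exact: openT|exact: Ck_on_linear].
Qed.

Lemma smooth_atD A B x (f g : A -> B) : smooth_at x f -> smooth_at x g ->
  smooth_at x (fun y => f y + g y).
Proof. by apply: smooth_at2 => k U; exact: Ck_onD. Qed.

Lemma smooth_atZ A B x (s : A -> R) (f : A -> B) :
  smooth_at x s -> smooth_at x f -> smooth_at x (fun y => s y *: f y).
Proof. by apply: smooth_at2 => k U; exact: Ck_onZ. Qed.

Lemma smooth_atM A x (s t : A -> R) :
  smooth_at x s -> smooth_at x t -> smooth_at x (fun y => s y * t y).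
Proof. exact: smooth_atZ. Qed.

Lemma smooth_atN A B x (f : A -> B) :
  smooth_at x f -> smooth_at x (fun y => - f y).
Proof.
move=> sf; have := smooth_atZ (@smooth_at_cst A _ x (-1 : R)) sf.
by apply: smooth_at_ext; apply: nearW => y; rewrite scaleN1r.
Qed.

Lemma smooth_atB A B x (f g : A -> B) : smooth_at x f -> smooth_at x g ->
  smooth_at x (fun y => f y - g y).
Proof. by move=> sf sg; apply: smooth_atD => //; exact: smooth_atN. Qed.

Lemma smooth_at_sum A B x I (r : seq I) (P : pred I) (f : I -> A -> B) :
  (forall i, P i -> smooth_at x (f i)) ->
  smooth_at x (fun y => \sum_(i <- r | P i) f i y).
Proof.
move=> sf; elim: r => [|i r IH].
  apply: smooth_at_ext (@smooth_at_cst A B x 0).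
  by apply: nearW => y; rewrite big_nil.
have [Pi|nPi] := boolP (P i).
  apply: smooth_at_ext (smooth_atD (sf i Pi) IH).
  by apply: nearW => y; rewrite big_cons Pi.
apply: smooth_at_ext IH.
by apply: nearW => y; rewrite big_cons (negbTE nPi).
Qed.

Lemma smooth_at_prod A x I (r : seq I) (P : pred I) (f : I -> A -> R) :
  (forall i, P i -> smooth_at x (f i)) ->
  smooth_at x (fun y => \prod_(i <- r | P i) f i y).
Proof.
move=> sf; elim: r => [|i r IH].
  apply: smooth_at_ext (@smooth_at_cst A _ x (1 : R)).
  by apply: nearW => y; rewrite big_nil.
have [Pi|nPi] := boolP (P i).
  apply: smooth_at_ext (smooth_atM (sf i Pi) IH).
  by apply: nearW => y; rewrite big_cons Pi.
apply: smooth_at_ext IH.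
by apply: nearW => y; rewrite big_cons (negbTE nPi).
Qed.

Lemma smooth_at_neq0 A x (s : A -> R) : smooth_at x s -> s x != 0 ->
  \forall y \near x, s y != 0.
Proof.
move=> ss s0; have := smooth_at_continuous ss; move=> /cvgrPdist_lt /(_ `|s x|).
rewrite normr_gt0 => /(_ s0); apply: filterS => y; apply: contraTN => /eqP ->.
by rewrite subr0 ltxx.
Qed.

Lemma smooth_atV A x (s : A -> R) : s x != 0 ->
  smooth_at x s -> smooth_at x (fun y => (s y)^-1).
Proof.
move=> s0 ss; have [W [oW Wx] sW] := ss.
have cs := smooth_at_neq0 ss s0.
exists (W `&` [set y | s y != 0]°).
  split; first by apply: openI => //; exact: open_interior.
  by split => //; exact: nbhs_interior cs.
move=> k; apply: Ck_onV.
- by apply: openI => //; exact: open_interior.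
- by move=> y [_ /interior_subset].
- by apply: Ck_on_sub (sW k) => y [].
Qed.

Lemma mx_linear_continuous p q B (L : {linear 'M[R]_(p, q) -> B}) :
  continuous L.
Proof.
have -> : (L : _ -> _) =
    (fun M => \sum_(k : 'I_p * 'I_q) M k.1 k.2 *: L (delta_mx k.1 k.2)).
  apply: funext => M; rewrite [in LHS](matrix_sum_delta M) linear_sum.
  rewrite -(pair_bigA _ (fun i j => M i j *: L (delta_mx i j))) /=.
  apply: eq_bigr => i _; rewrite linear_sum.
  by apply: eq_bigr => j _; rewrite linearZ.
elim: (index_enum _) => [|k r IH] M.
  have -> : (fun M : 'M[R]_(p, q) =>
     \sum_(k <- [::]) M k.1 k.2 *: L (delta_mx k.1 k.2)) = fun=> 0.
    by apply: funext => N; rewrite big_nil.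
  exact: cst_continuous.
have -> : (fun M : 'M[R]_(p, q) =>
     \sum_(k <- k :: r) M k.1 k.2 *: L (delta_mx k.1 k.2)) =
   (fun M => M k.1 k.2 *: L (delta_mx k.1 k.2) +
     \sum_(k <- r) M k.1 k.2 *: L (delta_mx k.1 k.2)).
  by apply: funext => N; rewrite big_cons.
have ck : {for M, continuous (fun N : 'M[R]_(p, q) =>
    N k.1 k.2 *: L (delta_mx k.1 k.2))}.
  have cM := @coord_continuous R p q k.1 k.2 M.
  exact: (cvgZr_tmp cM).
exact: (continuousD ck (IH M)).
Qed.

Lemma smooth_at_mx_linear p q B (L : {linear 'M[R]_(p, q) -> B}) x :
  smooth_at x L.
Proof. exact/smooth_at_linear/mx_linear_continuous. Qed.

Lemma diff_mx_linear p q B (L : {linear 'M[R]_(p, q) -> B}) x :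
  differentiable L x /\ 'd L x = L :> (_ -> _).
Proof.
have cL := @mx_linear_continuous _ _ _ L.
by split; [exact: linear_differentiable|exact: diff_lin].
Qed.

Definition entry p q i j (M : 'M[R]_(p, q)) : R := M i j.

Fact entry_is_linear p q i j : linear (@entry p q i j).
Proof. by move=> a M N; rewrite /entry !mxE. Qed.

HB.instance Definition _ p q i j := GRing.isLinear.Build R 'M[R]_(p, q) R _
  (@entry p q i j) (@entry_is_linear p q i j).

Lemma diff_entry A p q (h : A -> 'M[R]_(p, q)) x v i j :
  differentiable h x ->
  differentiable (fun y => h y i j) x /\
  ('d h x v) i j = 'd (fun y => h y i j) x v.
Proof.
move=> dh; have [dE DE] := diff_mx_linear (@entry p q i j) (h x).
have := differentiable_comp dh dE; split => //.
by rewrite (@diff_comp _ _ _ _ h (@entry p q i j)) //= DE.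
Qed.

Lemma Ck_on_entry A p q k (h : A -> 'M[R]_(p, q)) U i j : open U ->
  Ck_on k h U -> Ck_on k (fun y => h y i j) U.
Proof.
move=> oU; elim: k h => [|k IH] h /=.
  move=> ch x /ch cx; exact: (continuous_comp cx (@coord_continuous _ _ _ i j _)).
move=> [dh ch]; split=> [x /dh dx|v].
  by have [] := diff_entry 0 i j dx.
by apply: Ck_on_ext (IH _ (ch v)) => // x /dh dx; have [_ ->] := diff_entry v i j dx.
Qed.

Lemma Ck_on_sum A B k (U : set A) I (r : seq I) (f : I -> A -> B) : open U ->
  (forall i, Ck_on k (f i) U) -> Ck_on k (fun y => \sum_(i <- r) f i y) U.
Proof.
move=> oU sf; elim: r => [|i r IH].
  by apply: Ck_on_ext (@Ck_on_cst A B k 0 U) => // x _; rewrite big_nil.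
by apply: Ck_on_ext (Ck_onD oU (sf i) IH) => // x _; rewrite big_cons.
Qed.

(** In coordinates the derivative of g o f along v is a sum of products of the
entries of df(v) with derivatives of g composed with f; induction on k reduces
the chain rule to sums and products. *)
Lemma Ck_on_comp A B k n (f : A -> 'rV[R]_n) (g : 'rV[R]_n -> B) U U' :
  open U -> (forall x, U x -> U' (f x)) ->
  Ck_on k f U -> Ck_on k g U' -> Ck_on k (g \o f) U.
Proof.
move=> oU fU; elim: k g => [|k IH] g.
  by move=> /= cf cg x Ux; apply: continuous_comp; [exact: cf|exact/cg/fU].
move=> cf' cg'; have [[df cf] [dg cg]] := (cf', cg').
split=> [x Ux|v]; first by apply: differentiable_comp; [exact: df|exact/dg/fU].
have cS := Ck_on_sum (index_enum 'I_n) oU (fun j =>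
  Ck_onZ oU (Ck_on_entry 0 j oU (cf v)) (IH _ (Ck_onS cf') (cg (delta_mx 0 j)))).
apply: Ck_on_ext cS => // x Ux.
rewrite (diff_comp (df _ Ux) (dg _ (fU _ Ux))) /=.
rewrite [in RHS](row_sum_delta ('d f x v)) linear_sum.
by apply: eq_bigr => j _; rewrite linearZ.
Qed.

Lemma smooth_at_comp A B n (f : A -> 'rV[R]_n) (g : 'rV[R]_n -> B) x :
  smooth_at x f -> smooth_at (f x) g -> smooth_at x (g \o f).
Proof.
move=> sf [V [oV Vx] sV]; have [U [oU Ux] sU] := sf.
have fV : \forall y \near x, V (f y).
  exact: (smooth_at_continuous sf (open_nbhs_nbhs (conj oV Vx))).
exists (U `&` [set y | V (f y)]°).
  split; first by apply: openI => //; exact: open_interior.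
  by split => //; exact: nbhs_interior fV.
move=> k; apply: (@Ck_on_comp _ _ _ _ _ _ _ V).
- by apply: openI => //; exact: open_interior.
- by move=> y [_ /interior_subset].
- by apply: Ck_on_sub (sU k) => y [].
- exact: sV.
Qed.

Lemma smooth_at_mxP A p q x (h : A -> 'M[R]_(p, q)) :
  smooth_at x h <-> forall i j, smooth_at x (fun y => h y i j).
Proof.
split=> [sh i j|sh].
  have [W [oW Wx] sW] := sh; exists W => // k; exact: Ck_on_entry.
apply: (@smooth_at_ext _ _ _
  (fun y => \sum_(k : 'I_p * 'I_q) h y k.1 k.2 *: delta_mx k.1 k.2)).
  apply: nearW => y; rewrite [in RHS](matrix_sum_delta (h y)).
  by rewrite -(pair_bigA _ (fun i j => h y i j *: delta_mx i j)).
apply: smooth_at_sum => k _; apply: smooth_atZ; first exact: sh.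
exact: smooth_at_cst.
Qed.

End SmoothAt.

(** * Differentiation rules and symmetry of second derivatives *)

Section Rules.
Variable R : realType.
Implicit Types A B C : normedModType R.

Lemma diffDf A B (f g : A -> B) x v : differentiable f x -> differentiable g x ->
  'd (fun y => f y + g y) x v = 'd f x v + 'd g x v.
Proof. by move=> df dg; rewrite (@diffD _ _ _ f g). Qed.

Lemma diffBf A B (f g : A -> B) x v : differentiable f x -> differentiable g x ->
  'd (fun y => f y - g y) x v = 'd f x v - 'd g x v.
Proof. by move=> df dg; rewrite (@diffB _ _ _ f g). Qed.

Lemma diffZf A B (s : A -> R) (f : A -> B) x v :
  differentiable s x -> differentiable f x ->
  'd (fun y => s y *: f y) x v = s x *: 'd f x v + 'd s x v *: f x.
Proof. by move=> ds df; have [_ ->] := is_diffZf ds df. Qed.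

Lemma diffZcf A B (c : R) (f : A -> B) x v : differentiable f x ->
  'd (fun y => c *: f y) x v = c *: 'd f x v.
Proof. by move=> df; rewrite (@diffZ _ _ _ f). Qed.

Lemma diff_sumf A B I (r : seq I) (f : I -> A -> B) x v :
  (forall i, differentiable (f i) x) ->
  differentiable (fun y => \sum_(i <- r) f i y) x /\
  'd (fun y => \sum_(i <- r) f i y) x v = \sum_(i <- r) 'd (f i) x v.
Proof.
move=> df; elim: r => [|i r [dr Dr]].
  have -> : (fun y => \sum_(i <- [::]) f i y) = cst 0.
    by apply: funext => y; rewrite big_nil.
  by rewrite big_nil diff_cst; split => //; exact: differentiable_cst.
have -> : (fun y => \sum_(j <- i :: r) f j y) =
    (fun y => f i y + \sum_(j <- r) f j y).
  by apply: funext => y; rewrite big_cons.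
split; first exact: (@differentiableD _ _ _ (f i) _ _ (df i) dr).
by apply: etrans (diffDf v (df i) dr) _; rewrite big_cons; congr (_ + _).
Qed.

Lemma smooth_lin_family A B p (T : A -> 'rV[R]_p -> B) (a : A -> 'rV[R]_p) x :
  (forall y, linear (T y)) -> (forall b, smooth_at x (fun y => T y b)) ->
  smooth_at x a -> smooth_at x (fun y => T y (a y)).
Proof.
move=> lT sT sa.
apply: (@smooth_at_ext _ _ _ _ (fun y => \sum_j a y 0 j *: T y (delta_mx 0 j))).
  apply: nearW => y; pose Ly := GRing.isLinear.Build _ _ _ _ (T y) (lT y).
  pose L : {linear 'rV[R]_p -> B} := HB.pack (T y) Ly.
  rewrite [in RHS](row_sum_delta (a y)) -[T y _]/(L _) linear_sum.
  by apply: eq_bigr => j _; rewrite linearZ.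
apply: smooth_at_sum => j _; apply: smooth_atZ; last exact: sT.
by move/smooth_at_mxP : sa; exact.
Qed.

(** The product rule for the evaluation of a moving linear map at a moving
vector: in coordinates both sides are sums of products by scalars. *)
Lemma diff_lin_family A B p (T : A -> 'rV[R]_p -> B) (a : A -> 'rV[R]_p) x v :
  (forall y, linear (T y)) -> (forall b, differentiable (fun y => T y b) x) ->
  differentiable a x ->
  'd (fun y => T y (a y)) x v = 'd (fun y => T y (a x)) x v + T x ('d a x v).
Proof.
move=> lT dT da.
have E b : forall y, T y b = \sum_j b 0 j *: T y (delta_mx 0 j).
  move=> y; pose Ly := GRing.isLinear.Build _ _ _ _ (T y) (lT y).
  pose L : {linear 'rV[R]_p -> B} := HB.pack (T y) Ly.
  rewrite [in LHS](row_sum_delta b) -[T y _]/(L _) linear_sum.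
  by apply: eq_bigr => j _; rewrite linearZ.
have -> : (fun y => T y (a y)) = fun y => \sum_j a y 0 j *: T y (delta_mx 0 j).
  by apply: funext => y; exact: E.
have -> : (fun y => T y (a x)) = fun y => \sum_j a x 0 j *: T y (delta_mx 0 j).
  by apply: funext => y; exact: E.
have daj j : differentiable (fun y => a y 0 j) x by have [] := diff_entry 0 0 j da.
have dTa j : differentiable (fun y => a y 0 j *: T y (delta_mx 0 j)) x.
  by have [] := is_diffZf (daj j) (dT (delta_mx 0 j)).
have dTc j : differentiable (fun y => a x 0 j *: T y (delta_mx 0 j)) x.
  exact: (differentiableZ (a x 0 j) (dT (delta_mx 0 j))).
apply: etrans (diff_sumf (index_enum 'I_p) v dTa).2 _.
apply/esym.
apply: etrans (congr2 +%R (diff_sumf (index_enum 'I_p) v dTc).2 (E _ _)) _.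
rewrite -big_split /=; apply: eq_bigr => j _.
apply/esym; apply: etrans (diffZf v (daj j) (dT (delta_mx 0 j))) _.
congr (_ + _); first exact/esym/(diffZcf _ v (dT (delta_mx 0 j))).
by congr (_ *: _); exact/esym/(diff_entry v 0 j da).2.
Qed.

End Rules.

Section Schwarz.
Variable R : realType.
Implicit Types A B : normedModType R.

Lemma is_derive_comp A B (c : R -> A) (c' : A) (F : A -> B) (s : R) :
  is_derive s (1 : R) c c' -> differentiable F (c s) ->
  is_derive s (1 : R) (F \o c) ('d F (c s) c').
Proof.
move=> [dc Dc] dF; have dc1 : differentiable c s by exact/derivable1_diffP.
have dFc := differentiable_comp dc1 dF.
apply: DeriveDef; first exact/derivable1_diffP.
by rewrite deriveE // diff_comp //= -Dc deriveE.
Qed.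

Lemma is_derive_line A (p v : A) (s : R) :
  is_derive s (1 : R) (fun t => p + t *: v) v.
Proof.
have := is_diffD (is_diff_cst p s) (is_diff_scalel s v).
move=> [dL DL]; apply: DeriveDef; first exact/derivable1_diffP.
by rewrite deriveE // DL /= !fctE add0r scale1r.
Qed.

Lemma MVT_line A (F : A -> R) (p v : A) (s : R) : 0 < s ->
  (forall t, 0 <= t <= s -> differentiable F (p + t *: v)) ->
  exists2 t, 0 < t < s & F (p + s *: v) - F p = s * 'd F (p + t *: v) v.
Proof.
move=> s0 dF.
have dl t : 0 <= t <= s ->
    is_derive t (1 : R) (F \o (fun t => p + t *: v)) ('d F (p + t *: v) v).
  by move=> ts; apply: is_derive_comp; [exact: is_derive_line|exact: dF].
have [|/=|t ts] := @MVT R (F \o (fun t => p + t *: v))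
    (fun t => 'd F (p + t *: v) v) 0 s s0.
- by move=> t /[!in_itv]/= /andP[t0 ts]; apply: dl; rewrite !ltW.
- apply: derivable_within_continuous => t /[!in_itv]/= ts.
  by have [] := dl t ts.
- rewrite /= scale0r addr0 subr0 mulrC => ->; exists t => //.
Qed.

(** The mean value theorem applied twice: along v to the increment y |-> F(y +
sw) - F(y), then along w to the derivative of F. *)
Lemma second_difference A (F : A -> R) (x v w : A) (s : R) : 0 < s ->
  (forall t u, 0 <= t <= s -> 0 <= u <= s -> smooth_at (x + t *: v + u *: w) F) ->
  exists t u, [/\ 0 < t < s, 0 < u < s &
    F (x + s *: v + s *: w) - F (x + s *: v) - (F (x + s *: w) - F x) =
    s * s * 'd (fun y => 'd F y v) (x + t *: v + u *: w) w].
Proof.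
move=> s0 sF; have ss : 0 <= s <= s by rewrite lexx ltW.
have s00 : 0 <= (0 : R) <= s by rewrite lexx ltW.
have d1 t u : 0 <= t <= s -> 0 <= u <= s -> differentiable F (x + t *: v + u *: w).
  by move=> ts us; exact/smooth_at_differentiable/sF.
pose G y := F (y + s *: w) - F y.
have sh (y z : A) : differentiable F (y + z) ->
    differentiable (fun y => F (y + z)) y /\
    (forall v, 'd (fun y => F (y + z)) y v = 'd F (y + z) v).
  move=> dF; have dz : is_diff y (fun y : A => y + z) (id + 0 : A -> A).
    exact: is_diffD.
  have := is_diff_comp dz (differentiableP dF) => -[dFz DFz]; split => // u.
  by have /= -> := congr1 (fun h : A -> R => h u) DFz; rewrite !fctE addr0.
have dG t : 0 <= t <= s -> differentiable G (x + t *: v).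
  move=> ts; apply: differentiableB.
    by apply: (proj1 (sh _ _ _)); exact: d1.
  by rewrite -[x + _]addr0 -(scale0r w); exact: d1.
have [t ts] := MVT_line s0 dG.
have ts' : 0 <= t <= s by case/andP : ts => ? ?; rewrite !ltW.
rewrite diffBf; last 2 first.
- by apply: (proj1 (sh _ _ _)); exact: d1.
- by rewrite -[x + _]addr0 -(scale0r w); exact: d1.
rewrite (proj2 (sh _ _ (d1 t s ts' ss))) => E.
have [|u us E2] := @MVT_line _ (fun y => 'd F y v) (x + t *: v) w s s0.
  by move=> u us; apply/smooth_at_differentiable/smooth_at_diff/sF.
exists t, u; split => //.
have -> : F (x + s *: v + s *: w) - F (x + s *: v) - (F (x + s *: w) - F x) =
   G (x + s *: v) - G x by [].
by rewrite E E2 mulrA.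
Qed.

(** The second difference is symmetric in v and w, and both mixed derivatives
are limits of it, divided by s^2. *)
Lemma schwarz_scalar A (F : A -> R) (x v w : A) : smooth_at x F ->
  'd (fun y => 'd F y v) x w = 'd (fun y => 'd F y w) x v.
Proof.
move=> sF; apply/eqP; rewrite -subr_eq0 -normr_le0.
set a := 'd _ x w; set b := 'd _ x v.
apply/ler_addgt0Pl => e e0; rewrite addr0.
have cv v' w' : {for x, continuous (fun y => 'd (fun z => 'd F z v') y w')}.
  by apply: smooth_at_continuous; apply: smooth_at_diff; exact: smooth_at_diff.
have e2 : 0 < e / 2 by rewrite divr_gt0.
have N : \forall y \near x, smooth_at y F /\
   `|a - 'd (fun z => 'd F z v) y w| < e / 2 /\
   `|b - 'd (fun z => 'd F z w) y v| < e / 2.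
  near=> y; split; first by near: y; exact: smooth_at_near.
  split; near: y.
    by have /cvgrPdist_lt/(_ _ e2) := cv v w.
  by have /cvgrPdist_lt/(_ _ e2) := cv w v.
move/nbhs_ballP : N => [d /= d0 N].
pose s := d / (`|v| + `|w| + 1).
have D0 : 0 < `|v| + `|w| + 1 by rewrite ltr_wpDl // addr_ge0.
have s0 : 0 < s by rewrite divr_gt0.
have inb t u : 0 <= t <= s -> 0 <= u <= s -> ball x d (x + t *: v + u *: w).
  move=> /andP[t0 ts] /andP[u0 us]; rewrite -ball_normE /ball_ /=.
  rewrite -addrA opprD addrA subrr add0r normrN.
  apply: le_lt_trans (ler_normD _ _) _; rewrite !normrZ !ger0_norm //.
  have H : t * `|v| + u * `|w| <= s * (`|v| + `|w|).
    by rewrite mulrDr lerD // ler_wpM2r.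
  apply: le_lt_trans H _; rewrite -[ltRHS](divfK (lt0r_neq0 D0)) -/s.
  by rewrite ltr_pM2l // ltrDl.
have [t [u [ts us E1]]] := second_difference s0
  (fun t u ts us => (N _ (inb t u ts us)).1).
have inb' t' u' : 0 <= t' <= s -> 0 <= u' <= s ->
    ball x d (x + t' *: w + u' *: v).
  by move=> ts' us'; rewrite addrAC; exact: inb.
have [t' [u' [ts' us' E2]]] := second_difference s0
  (fun t u ts us => (N _ (inb' t u ts us)).1).
have lew z : 0 < z < s -> 0 <= z <= s by case/andP => ? ?; rewrite !ltW.
have [_ [H1 _]] := N _ (inb _ _ (lew _ ts) (lew _ us)).
have [_ [_ H2]] := N _ (inb' _ _ (lew _ ts') (lew _ us')).
have E3 : 'd (fun z => 'd F z v) (x + t *: v + u *: w) w =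
   'd (fun z => 'd F z w) (x + t' *: w + u' *: v) v.
  apply: (@mulfI _ (s * s)); first by rewrite mulf_neq0 // gt_eqF.
  rewrite -E1 -E2 [x + s *: w + s *: v]addrAC; ring.
rewrite -(subrKA ('d (fun z => 'd F z v) (x + t *: v + u *: w) w)).
apply: le_trans (ler_normD _ _) _; rewrite [leRHS]splitr lerD //; first exact: ltW.
by rewrite E3 distrC ltW.
Unshelve. all: by end_near. Qed.

Lemma schwarz A p q (F : A -> 'M[R]_(p, q)) (x v w : A) : smooth_at x F ->
  'd (fun y => 'd F y v) x w = 'd (fun y => 'd F y w) x v.
Proof.
move=> sF.
have E v' w' i j : ('d (fun y => 'd F y v') x w') i j =
    'd (fun y => 'd (fun y => F y i j) y v') x w'.
  have sFv := smooth_at_diff v' sF.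
  have [_ ->] := diff_entry w' i j (smooth_at_differentiable sFv).
  apply: near_eq_diff.
    apply/smooth_at_differentiable/smooth_at_diff.
    by move/smooth_at_mxP : sF; exact.
  apply: filterS (smooth_at_near sF) => y /smooth_at_differentiable dF.
  by have [_ ->] := diff_entry v' i j dF.
apply/matrixP => i j; rewrite !E; apply: schwarz_scalar.
by move/smooth_at_mxP : sF; exact.
Qed.

End Schwarz.

(** * Ordinary differential equations *)

Section MeanValue.
Variable R : realType.

Lemma mx_norm_leP p q (A : 'M[R]_(p, q)) (b : R) : 0 <= b ->
  `|A| <= b <-> forall i j, `|A i j| <= b.
Proof.
move=> b0; rewrite [`|A|]/Num.Def.normr /= mx_normrE; split=> [h i j|h].
  by apply: le_trans h; exact: (le_bigmax _ (fun k => `|A k.1 k.2|) (i, j)).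
by apply: bigmax_le => // k _; exact: h.
Qed.

Lemma mx_norm_entry p q (A : 'M[R]_(p, q)) i j : `|A i j| <= `|A|.
Proof. by have /mx_norm_leP := lexx `|A|; apply. Qed.

Lemma norm_mulmx_le p q (s : 'rV[R]_p) (A : 'M[R]_(p, q)) :
  `|s *m A| <= p%:R * `|s| * `|A|.
Proof.
apply/mx_norm_leP => [|i j]; first by rewrite !mulr_ge0.
rewrite mxE; apply: le_trans (ler_norm_sum _ _ _) _.
apply: (@le_trans _ _ (\sum_(k < p) `|s| * `|A|)).
  apply: ler_sum => k _; rewrite normrM.
  by apply: ler_pM => //; exact: mx_norm_entry.
by rewrite sumr_const card_ord -mulrA mulr_natl.
Qed.

Lemma mean_value_le p (y dy : R -> 'rV[R]_p) (a b B : R) : a <= b -> 0 <= B ->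
  (forall t, a <= t <= b -> is_derive t (1 : R) y (dy t)) ->
  (forall t, a <= t <= b -> `|dy t| <= B) -> `|y b - y a| <= B * (b - a).
Proof.
rewrite le_eqVlt => /orP[/eqP ->|ab] B0 yd yB.
  by rewrite !subrr mulr0 normr0.
apply/mx_norm_leP => [|i j]; first by rewrite mulr_ge0 // subr_ge0 ltW.
have ye t : a <= t <= b -> is_derive t (1 : R) (fun t => y t i j) (dy t i j).
  move=> /yd[dyt <-]; have dt : differentiable y t by exact/derivable1_diffP.
  have [de De] := diff_entry (1 : R) i j dt.
  apply: DeriveDef; first exact/derivable1_diffP.
  by rewrite deriveE // -De deriveE.
have [|/=|t ts] := @MVT R (fun t => y t i j) (fun t => dy t i j) a b ab.
- by move=> t /[!in_itv]/= /andP[t0 t1]; apply: ye; rewrite !ltW.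
- by apply: derivable_within_continuous => t /[!in_itv]/= /ye[].
- have ba : 0 < b - a by rewrite subr_gt0.
  rewrite !mxE => ->; rewrite normrM (gtr0_norm ba).
  rewrite ler_pM2r //; apply: le_trans (mx_norm_entry _ _ _) _.
  by apply: yB; move: ts; rewrite in_itv /= => /andP[? ?]; rewrite !ltW.
Qed.

(** When the linear rate is at most 1/2, the maximum of the norm over the unit
interval absorbs itself. *)
Lemma gronwall_half p (w dw : R -> 'rV[R]_p) (d : R) : 0 <= d ->
  w 0 = 0 -> (forall t : R, 0 <= t <= 1 -> is_derive t (1 : R) w (dw t)) ->
  (forall t : R, 0 <= t <= 1 -> `|dw t| <= 2^-1 * `|w t| + d) ->
  forall t : R, 0 <= t <= 1 -> `|w t| <= 2 * d.
Proof.
move=> d0 w0 wd wB.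
have cw : {within `[0, 1], continuous (fun t => `|w t| : R)}.
  have wd' : {in `[0, 1], forall x : R, derivable w x 1}.
    by move=> t /[!in_itv]/= /wd[].
  have cw := derivable_within_continuous wd'.
  by move=> t; exact: (continuous_comp (cw t) (@norm_continuous _ _ _)).
have [c /[!in_itv]/= c01 cmax] := @EVT_max R (fun t => `|w t|) 0 1 ler01 cw.
have M (t : R) : 0 <= t <= 1 -> `|w t| <= 2^-1 * `|w c| + d.
  move=> /andP[t0 t1].
  have B0 : 0 <= 2^-1 * `|w c| + d by rewrite addr_ge0 // mulr_ge0.
  have st (u : R) : 0 <= u <= t -> 0 <= u <= 1.
    by case/andP => ? ut; apply/andP; split => //; exact: le_trans ut t1.
  have := @mean_value_le p w dw 0 t _ t0 B0 (fun u ut => wd u (st u ut)).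
  rewrite w0 !subr0 => H; apply: le_trans (H _) _.
    move=> u ut; apply: le_trans (wB u (st u ut)) _.
    rewrite lerD2r ler_pM2l ?invr_gt0 //.
    by apply: cmax; rewrite in_itv /= st.
  by rewrite -[leRHS]mulr1 ler_wpM2l.
move=> t t01; have Mc := M c c01; have Mt := M t t01.
lra.
Qed.

End MeanValue.

Section Antiderivative.
Variable R : realType.

Lemma antiderivative (f : R -> R) : continuous f -> exists F : R -> R,
  F 0 = 0 /\ forall x : R, 0 <= x <= 1 -> is_derive x (1 : R) F (f x).
Proof.
move=> cf; pose mu := @lebesgue_measure R.
pose F (x : R) : R := (\int[mu]_(t in [set` `[(-1 : R), x]]) f t).
have If : mu.-integrable `[(-1 : R), 2] (EFin \o f).
  apply: continuous_compact_integrable; first exact: segment_compact.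
  by apply: continuous_subspaceT => x; exact: cf.
(* the integral starts at -1, which makes the points of [0, 1] interior *)
exists (fun x => F x - F 0); split=> [|x /andP[x0 x1]]; first by rewrite subrr.
have [||dF DF] := @continuous_FTC1_closed R f (-1) x 2 _ If _ (cf x).
- by apply: le_lt_trans x1 _; rewrite ltrn1 || rewrite ltr1n.
- by apply: lt_le_trans x0; rewrite ltrN10.
have dF' : is_derive x (1 : R) F (f x).
  by rewrite derive1E in DF; exact: DeriveDef dF DF.
by have := is_deriveB dF' (is_derive_cst (F 0) x 1); rewrite subr0.
Qed.

Lemma antiderivative_rV p (f : R -> 'rV[R]_p) (y0 : 'rV[R]_p) : continuous f ->
  exists F : R -> 'rV[R]_p,
  F 0 = y0 /\ forall x : R, 0 <= x <= 1 -> is_derive x (1 : R) F (f x).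
Proof.
move=> cf.
have /choice[F HF] : forall j, exists F : R -> R, F 0 = 0 /\
    forall x : R, 0 <= x <= 1 -> is_derive x (1 : R) F (f x 0 j).
  move=> j; apply: antiderivative => x.
  exact: (continuous_comp (cf x) (@coord_continuous _ _ _ 0 j _)).
exists (fun x => y0 + \row_j F j x); split.
  by apply/rowP => j; rewrite !mxE (HF j).1 addr0.
move=> x x01.
have D : derivable (fun x => \row_j F j x) x 1.
  apply/derivable_mxP => i j.
  under eq_fun do rewrite mxE.
  by have [] := (HF j).2 x x01.
have Df : is_derive x (1 : R) (fun x => \row_j F j x) (f x).
  apply: DeriveDef => //; rewrite derive_mx //.
  apply/rowP => j; rewrite mxE; under eq_fun do rewrite mxE.
  by have [_ ->] := (HF j).2 x x01.
by have := is_deriveD (is_derive_cst y0 x 1) Df; rewrite add0r.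
Qed.

End Antiderivative.

Lemma dist_le_continuous (R : realType) (A B : normedModType R) (f : A -> B)
    (k : R) :
  (forall y z, `|f y - f z| <= k * `|y - z|) -> continuous f.
Proof.
move=> fk y; apply/cvgrPdist_lt => e e0; near=> z.
apply: le_lt_trans (fk _ _) _.
apply: (@le_lt_trans _ _ ((`|k| + 1) * `|y - z|)).
  by rewrite ler_wpM2r // (le_trans (ler_norm k)) // lerDl.
rewrite mulrC -ltr_pdivlMr ?ltr_wpDl //.
by near: z; apply: cvgr_dist_lt => //; rewrite divr_gt0 // ltr_wpDl.
Unshelve. all: by end_near. Qed.

Section Picard.
Variables (R : realType) (N : nat) (G : 'rV[R]_N -> 'rV[R]_N) (y0 : 'rV[R]_N).
Variable B : R.
Hypothesis Gbound : forall y, `|G y| <= B.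
Hypothesis Glip : forall y z, `|G y - G z| <= 2^-1 * `|y - z|.

(** The retraction of the line onto [0, 1] extends a curve on [0, 1] to a curve
on the line, whose composite with G has an antiderivative. *)
Let clip (t : R) : R := Num.max 0 (Num.min 1 t).

Let clip01 (t : R) : 0 <= clip t <= 1.
Proof.
rewrite /clip le_max lexx /= ge_max ler01 /=.
by rewrite ge_min lexx.
Qed.

Let clipE (t : R) : 0 <= t <= 1 -> clip t = t.
Proof.
by move=> /andP[t0 t1]; rewrite /clip (min_idPr t1) (max_idPr t0).
Qed.

Let clip_continuous : continuous clip.
Proof.
move=> t; apply: (@continuous_max R R (cst 0) (fun t => Num.min 1 t)).
  exact: cst_continuous.
by apply: (@continuous_min R R (cst 1) id) => //; exact: cst_continuous.
Qed.

Let B0 : 0 <= B. Proof. by apply: le_trans (Gbound 0). Qed.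

Let G_continuous : continuous G.
Proof.
exact: dist_le_continuous Glip.
Qed.

Let solves (u v : R -> 'rV[R]_N) := v 0 = y0 /\
  forall t : R, 0 <= t <= 1 -> is_derive t (1 : R) v (G (u t)).

Let lipschitz (u : R -> 'rV[R]_N) := forall s t : R, 0 <= s <= 1 -> 0 <= t <= 1 ->
  `|u s - u t| <= B * `|s - t|.

Let solve_step u : lipschitz u -> exists2 v, solves u v & lipschitz v.
Proof.
move=> lu.
have cu : continuous (fun t => G (u (clip t))).
  move=> t; apply: (@continuous_comp _ _ _ (fun t => u (clip t)) G); last exact: G_continuous.
  apply/cvgrPdist_lt => e e0; near=> s.
  apply: le_lt_trans (lu _ _ (clip01 _) (clip01 _)) _.
  apply: (@le_lt_trans _ _ ((B + 1) * `|clip t - clip s|)).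
    by rewrite ler_wpM2r // lerDl.
  rewrite mulrC -ltr_pdivlMr ?ltr_wpDl //.
  near: s; have /cvgrPdist_lt := @clip_continuous t; apply.
  by rewrite divr_gt0 // ltr_wpDl.
have [v [v0 dv]] := antiderivative_rV y0 cu.
have sv : solves u v.
  by split => // t t01; have := dv t t01; rewrite clipE.
exists v => //.
have H (s t : R) : 0 <= s -> s <= t -> t <= 1 -> `|v t - v s| <= B * `|t - s|.
  move=> s0 st t1; rewrite (@ger0_norm _ (t - s)) ?subr_ge0 //.
  apply: (@mean_value_le _ _ v (fun t => G (u t))) => // r /andP[sr rt].
  by apply: (sv.2); rewrite (le_trans s0 sr) (le_trans rt t1).
move=> s t /andP[s0 s1] /andP[t0 t1].
have [st|/ltW ts] := leP s t; last exact: H.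
by rewrite distrC (distrC s); exact: H.
Unshelve. all: by end_near. Qed.

Let contract u v u' v' c : 0 <= c ->
  (forall t : R, 0 <= t <= 1 -> `|u t - v t| <= c) ->
  solves u u' -> solves v v' -> forall t : R, 0 <= t <= 1 -> `|u' t - v' t| <= c / 2.
Proof.
move=> c0 uv [u0 du] [v0 dv] t /andP[t0 t1].
have D (s : R) : 0 <= s <= t -> is_derive s (1 : R) (u' - v') (G (u s) - G (v s)).
  move=> /andP[s0 st]; have s01 : 0 <= s <= 1 by rewrite s0 (le_trans st t1).
  by have := is_deriveB (du s s01) (dv s s01).
have c2 : 0 <= c / 2 by rewrite divr_ge0.
have := mean_value_le t0 c2 D.
rewrite /= !fctE u0 v0 subrr !subr0 => H; apply: le_trans (H _) _.
  move=> s /andP[s0 st]; have s01 : 0 <= s <= 1 by rewrite s0 (le_trans st t1).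
  by apply: le_trans (Glip _ _) _; rewrite mulrC ler_pM2r ?invr_gt0 //; exact: uv.
by rewrite ler_piMr.
Qed.

Let iterates : exists y : nat -> R -> 'rV[R]_N,
  forall n, [/\ lipschitz (y n), y n 0 = y0 & solves (y n) (y n.+1)].
Proof.
have /choice[F HF] : forall u : R -> 'rV[R]_N, exists v, lipschitz u ->
    solves u v /\ lipschitz v.
  move=> u; have [lu|nlu] := pselect (lipschitz u); last by exists u.
  by have [v sv lv] := solve_step lu; exists v.
exists (fun n => iter n F (fun=> y0)).
have L n : lipschitz (iter n F (fun=> y0)).
  elim: n => [s t _ _ /=|n IH]; first by rewrite subrr normr0 mulr_ge0.
  by have [] := HF _ IH.
move=> n; split=> //; last by have [] := HF _ (L n).
by case: n => [//|n]; have [[]] := HF _ (L n).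
Qed.

(** Since the Lipschitz constant is 1/2, Picard iteration contracts on the whole
interval [0, 1], with no restriction to small times; the iterates are uniformly
Cauchy, and the limit solves the equation because it agrees with the next
iterate after it. *)
Lemma picard : exists y : R -> 'rV[R]_N, y 0 = y0 /\
  forall t : R, 0 <= t <= 1 -> is_derive t (1 : R) y (G (y t)).
Proof.
have [y Hy] := iterates.
pose c n : R := (2 * B) / 2 ^+ n.
have c0 n : 0 <= c n by rewrite divr_ge0 ?mulr_ge0 ?exprn_ge0.
have cS n : c n = 2 * c n - 2 * c n.+1.
  by rewrite /c exprS; field; rewrite expf_neq0 // pnatr_eq0.
have d1 n (t : R) : 0 <= t <= 1 -> `|y n.+1 t - y n t| <= c n.
  elim: n t => [|n IH] t t01.
    rewrite /c expr0 divr1.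
    have t00 : 0 <= (0 : R) <= 1 by rewrite lexx ler01.
    have l n : `|y n t - y0| <= B.
      have [+ <- _] := Hy n => /(_ t 0 t01 t00) H; apply: le_trans H _.
      by case/andP : t01 => ? ?; rewrite subr0 ger0_norm // ler_piMr.
    rewrite -(subrKA y0); apply: le_trans (ler_normD _ _) _.
    by rewrite mulrDl mul1r lerD // distrC.
  have -> : c n.+1 = c n / 2.
    by rewrite /c exprS; field; rewrite expf_neq0 // pnatr_eq0.
  by have [_ _ s1] := Hy n.+1; have [_ _ s0] := Hy n; exact: contract IH s1 s0 t t01.
have dn n k (t : R) : 0 <= t <= 1 -> `|y (n + k)%N t - y n t| <= 2 * c n.
  move=> t01; apply: (@le_trans _ _ (2 * c n - 2 * c (n + k)%N)); last first.
    by rewrite lerBlDr lerDl mulr_ge0.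
  elim: k => [|k IH]; first by rewrite addn0 !subrr normr0.
  rewrite -(subrKA (y (n + k)%N t)); apply: le_trans (ler_normD _ _) _.
  rewrite addnS; have := d1 (n + k)%N t t01; have := cS (n + k)%N; lra.
have csmall (e : R) : 0 < e -> exists n, c n < e.
  move=> e0; have := archi_boundP (divr_ge0 (mulr_ge0 (ler0n R 2) B0) (ltW e0)).
  set n := Num.bound _ => ne; exists n.
  rewrite ltr_pdivrMr ?exprn_gt0 // [e * _]mulrC -ltr_pdivrMr //.
  by apply: lt_le_trans ne _; rewrite -natrX ler_nat ltnW // ltn_expl.
have cvgy (t : R) : 0 <= t <= 1 -> cvg (y n t @[n --> \oo]).
  move=> t01; apply: cauchy_cvg; apply: cauchy_exP => e e0.
  have [|n ne] := csmall (e / 2); first by rewrite divr_gt0.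
  exists (y n t); exists n => // p /= np; rewrite -ball_normE /= distrC.
  rewrite -(subnKC np); apply: le_lt_trans (dn n (p - n)%N t t01) _.
  by rewrite mulrC -ltr_pdivlMr.
pose Y (t : R) : 'rV[R]_N := lim (y n t @[n --> \oo]).
have dY n (t : R) : 0 <= t <= 1 -> `|Y t - y n t| <= 2 * c n.
  move=> t01; have cY : (fun p => `|y p t - y n t| : R) @ \oo --> `|Y t - y n t|.
    apply: cvg_norm; apply: cvgB; [exact: cvgy|exact: cvg_cst].
  apply: (closed_cvg (fun r => r <= 2 * c n)) cY.
    exact: closed_le.
  by exists n => // p /= np; rewrite -(subnKC np); exact: dn.
have lY : lipschitz Y.
  move=> s t s01 t01; apply/ler_addgt0Pr => e e0.
  have [|n ne] := csmall (e / 4); first by rewrite divr_gt0.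
  rewrite -(subrKA (y n s)) -(subrKA (y n t) (y n s)).
  have [+ _ _] := Hy n => /(_ s t s01 t01) l.
  have := dY n s s01; have := dY n t t01; rewrite (distrC (Y t)) => dt ds.
  have := ler_normD (Y s - y n s) (y n s - y n t + (y n t - Y t)).
  have := ler_normD (y n s - y n t) (y n t - Y t).
  lra.
have [v [v0 dv] _] := solve_step lY.
have vY (t : R) : 0 <= t <= 1 -> v t = Y t.
  move=> t01; apply/eqP; rewrite -subr_eq0 -normr_le0.
  apply/ler_addgt0Pr => e e0; rewrite add0r.
  have [|n ne] := csmall (e / 3); first by rewrite divr_gt0.
  have [_ _ sn] := Hy n.
  have := contract (mulr_ge0 (ler0n R 2) (c0 n)) (dY n) (conj v0 dv) sn t01.
  have := dY n.+1 t t01; rewrite (distrC (Y t)).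
  have := ler_normD (v t - y n.+1 t) (y n.+1 t - Y t).
  have := cS n; have := c0 n; rewrite subrKA; lra.
by exists v; split => // t t01; rewrite vY //; exact: dv.
Qed.
End Picard.

(** * Total differential equations *)

Section TaylorBounds.
Variable R : realType.

Lemma near_forall (A : normedModType R) (x : A) (I : finType) (P : I -> A -> Prop) :
  (forall k, \forall z \near x, P k z) -> \forall z \near x, forall k, P k z.
Proof. by move=> H; apply: filter_forall. Qed.

Lemma smooth_at_diff_bounded N (B : normedModType R) (F : 'rV[R]_N -> B) x :
  smooth_at x F -> exists2 K : R, 0 < K &
  \forall z \near x, forall v, `|'d F z v| <= K * `|v|.
Proof.
move=> sF; pose c k := `|'d F x (delta_mx 0 k)| + 1.
exists (\sum_k c k + 1).
  by rewrite ltr_wpDl // sumr_ge0 // => k _; rewrite addr_ge0.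
have : \forall z \near x, forall k : 'I_N, `|'d F z (delta_mx 0 k)| <= c k.
  apply: near_forall => k.
  have /cvgrPdist_lt/(_ _ ltr01) := smooth_at_continuous (smooth_at_diff (delta_mx 0 k) sF).
  apply: filterS => z /ltW zx; rewrite /c -lerBlDl.
  by apply: le_trans zx; rewrite distrC; exact: lerB_dist.
apply: filterS => z H v; rewrite [in leLHS](row_sum_delta v) linear_sum.
apply: le_trans (ler_norm_sum _ _ _) _.
apply: (@le_trans _ _ (\sum_k c k * `|v|)).
  apply: ler_sum => k _; rewrite linearZ normrZ mulrC.
  by apply: ler_pM => //; exact: mx_norm_entry.
by rewrite -mulr_suml ler_wpM2r // lerDl.
Qed.

Lemma smooth_at_diff2_bounded N p q (F : 'rV[R]_N -> 'M[R]_(p, q)) x :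
  smooth_at x F -> exists2 K : R, 0 < K &
  \forall z \near x, forall v w,
    `|'d (fun y => 'd F y v) z w| <= K * `|v| * `|w|.
Proof.
move=> sF.
have /choice[K HK] : forall k : 'I_N, exists K : R, 0 < K /\
    \forall z \near x, forall w,
      `|'d (fun y => 'd F y (delta_mx 0 k)) z w| <= K * `|w|.
  move=> k; have [K K0 HK] := smooth_at_diff_bounded (smooth_at_diff (delta_mx 0 k) sF).
  by exists K.
exists (\sum_k K k + 1).
  by rewrite ltr_wpDl // sumr_ge0 // => k _; rewrite ltW //; case: (HK k).
have H : \forall z \near x, forall (k : 'I_N) w,
      `|'d (fun y => 'd F y (delta_mx 0 k)) z w| <= K k * `|w|.
  by apply: near_forall => k; case: (HK k).
have := smooth_at_near sF.
apply: filter_app; apply: filterS H => z H sFz v w.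
have E : (fun y => 'd F y v) = fun y => \sum_k v 0 k *: 'd F y (delta_mx 0 k).
  apply: funext => y; rewrite [in LHS](row_sum_delta v) linear_sum.
  by apply: eq_bigr => k _; rewrite linearZ.
have dk k : differentiable (fun y => 'd F y (delta_mx 0 k)) z.
  exact/smooth_at_differentiable/smooth_at_diff.
have dvk k : differentiable (fun y => v 0 k *: 'd F y (delta_mx 0 k)) z.
  exact: (differentiableZ (v 0 k) (dk k)).
rewrite E (diff_sumf (index_enum 'I_N) w dvk).2.
apply: le_trans (ler_norm_sum _ _ _) _.
apply: (@le_trans _ _ (\sum_k K k * `|v| * `|w|)).
  apply: ler_sum => k _; rewrite (diffZcf (v 0 k) w (dk k)) normrZ.
  rewrite mulrAC mulrC; apply: ler_pM => //; first exact: mx_norm_entry.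
by rewrite -!mulr_suml ler_wpM2r // ler_wpM2r // lerDl.
Qed.

Lemma mean_value_line p q (A : normedModType R) (F : A -> 'M[R]_(p, q)) x v (K : R) :
  0 <= K ->
  (forall t : R, 0 <= t <= 1 -> differentiable F (x + t *: v)) ->
  (forall t : R, 0 <= t <= 1 -> `|'d F (x + t *: v) v| <= K) ->
  `|F (x + v) - F x| <= K.
Proof.
move=> K0 dF FK; apply/mx_norm_leP => // i j; rewrite !mxE.
have [|t /andP[t0 t1]] := @MVT_line R A (fun y => F y i j) x v 1 ltr01.
  by move=> t t01; have [] := diff_entry v i j (dF t t01).
have t01 : 0 <= t <= 1 by rewrite !ltW.
rewrite scale1r mul1r => ->; rewrite -(diff_entry v i j (dF t t01)).2.
by apply: le_trans (mx_norm_entry _ _ _) _; exact: FK.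
Qed.

Lemma taylor_line p q (A : normedModType R) (F : A -> 'M[R]_(p, q)) x v (K : R) :
  0 <= K ->
  (forall t : R, 0 <= t <= 1 -> smooth_at (x + t *: v) F) ->
  (forall t : R, 0 <= t <= 1 -> `|'d (fun y => 'd F y v) (x + t *: v) v| <= K) ->
  `|F (x + v) - F x - 'd F x v| <= K.
Proof.
move=> K0 sF FK; apply/mx_norm_leP => // i j.
have dF t (t01 : 0 <= t <= 1) := smooth_at_differentiable (sF t t01).
have [|t /andP[t0 t1]] := @MVT_line R A (fun y => F y i j) x v 1 ltr01.
  by move=> t t01; have [] := diff_entry v i j (dF t t01).
have t01 : 0 <= t <= 1 by rewrite !ltW.
rewrite scale1r mul1r -(diff_entry v i j (dF t t01)).2 => E.
rewrite [leLHS](_ : _ = `|('d F (x + t *: v) v - 'd F x v) i j|); last first.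
  by rewrite mxE [(F _ - _) i j]mxE [(- F x) i j]mxE E [in RHS]mxE.
apply: le_trans (mx_norm_entry _ _ _) _.
apply: (@mean_value_line _ _ _ (fun y => 'd F y v)) => // s /andP[s0 s1];
  have st : 0 <= s * t <= 1 by rewrite mulr_ge0 ?mulr_ile1 // ltW.
  by rewrite scalerA; exact/smooth_at_differentiable/smooth_at_diff/sF.
rewrite scalerA linearZ normrZ (ger0_norm (ltW t0)).
by apply: le_trans (FK _ st); rewrite ler_piMl // ltW.
Qed.

(** The first and second order bounds near y0 on which the construction of
solutions of total differential equations relies. *)
Lemma taylor_bounds N p q (L : 'rV[R]_N -> 'M[R]_(p, q)) (y0 : 'rV[R]_N)
    (P : set 'rV[R]_N) :
  smooth_at y0 L -> nbhs y0 P ->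
  exists rho K : R, [/\ 0 < rho, 0 < K,
   forall y, `|y - y0| <= rho -> smooth_at y L /\ P y /\ `|L y| <= K,
   forall y v, `|y - y0| <= rho -> `|'d L y v| <= K * `|v| &
   forall y z, `|y - y0| <= rho -> `|z - y0| <= rho ->
     `|L y - L z| <= K * `|y - z| /\
     `|L y - L z - 'd L z (y - z)| <= K * `|y - z| * `|y - z|].
Proof.
move=> sL NP.
have [K1 K10 H1] := smooth_at_diff_bounded sL.
have [K2 K20 H2] := smooth_at_diff2_bounded sL.
have H0 : \forall z \near y0, `|L z| <= `|L y0| + 1.
  have /cvgrPdist_lt/(_ _ ltr01) := smooth_at_continuous sL.
  apply: filterS => z /ltW zx; rewrite -lerBlDl.
  by apply: le_trans zx; rewrite distrC; exact: lerB_dist.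
have /nbhs_ballP[d /= d0 Hd] : \forall z \near y0, (smooth_at z L /\ P z) /\
    `|L z| <= `|L y0| + 1 /\ (forall v, `|'d L z v| <= K1 * `|v|) /\
    forall v w, `|'d (fun y => 'd L y v) z w| <= K2 * `|v| * `|w|.
  by exact: (filterI (filterI (smooth_at_near sL) NP) (filterI H0 (filterI H1 H2))).
exists (d / 2), (`|L y0| + 1 + K1 + K2).
have K0 : 0 <= `|L y0| by [].
have KK : 0 <= `|L y0| + 1 + K1 + K2 by lra.
have inb z : `|z - y0| <= d / 2 -> ball y0 d z.
  move=> zd; rewrite -ball_normE /= distrC; apply: le_lt_trans zd _.
  by rewrite ltr_pdivrMr // ltr_pMr // ltr1n.
have conv y z (t : R) : `|y - y0| <= d / 2 -> `|z - y0| <= d / 2 -> 0 <= t <= 1 ->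
    `|z + t *: (y - z) - y0| <= d / 2.
  move=> yd zd /andP[t0 t1].
  have -> : z + t *: (y - z) - y0 = (1 - t) *: (z - y0) + t *: (y - y0).
    by rewrite scalerBl scale1r !scalerBr; apply/rowP => i; rewrite !mxE; ring.
  apply: le_trans (ler_normD _ _) _; rewrite !normrZ (ger0_norm t0).
  rewrite (ger0_norm (_ : 0 <= 1 - t)) ?subr_ge0 //.
  have := ler_wpM2l t0 yd; have := @ler_wpM2l _ (1 - t) _ _ _ zd.
  rewrite subr_ge0 => /(_ t1); lra.
split; first by rewrite divr_gt0.
- by lra.
- move=> y /inb/Hd[[? ?] [Ly _]]; do 2 split => //.
  by apply: le_trans Ly _; lra.
- move=> y v /inb/Hd[_ [_ [dLy _]]]; apply: le_trans (dLy v) _.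
  rewrite ler_wpM2r //; lra.
- move=> y z yd zd; split.
    have := @mean_value_line _ _ _ L z (y - z) ((`|L y0| + 1 + K1 + K2) * `|y - z|).
    rewrite subrKC; apply.
    + by rewrite mulr_ge0.
    + by move=> t t01; have [[/smooth_at_differentiable]] := Hd _ (inb _ (conv y z t yd zd t01)).
    + move=> t t01; have [_ [_ [H _]]] := Hd _ (inb _ (conv y z t yd zd t01)).
      apply: le_trans (H _) _; rewrite ler_wpM2r //; lra.
  have := @taylor_line _ _ _ L z (y - z) ((`|L y0| + 1 + K1 + K2) * `|y - z| * `|y - z|).
  rewrite subrKC; apply.
  + by rewrite !mulr_ge0.
  + by move=> t t01; have [[]] := Hd _ (inb _ (conv y z t yd zd t01)).
  + move=> t t01; have [_ [_ [_ H]]] := Hd _ (inb _ (conv y z t yd zd t01)).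
    apply: le_trans (H _ _) _; rewrite ler_wpM2r // ler_wpM2r //; lra.
Qed.

End TaylorBounds.

Section TotalDifferential.
Variable R : realType.

Definition truncate (rho a : R) : R := Num.max (- rho) (Num.min rho a).

Lemma truncate_le rho a : 0 <= rho -> `|truncate rho a| <= rho.
Proof.
move=> r0; rewrite ler_norml /truncate le_max lexx /=.
by rewrite ge_max ge_min lexx /= andbT; lra.
Qed.

Lemma truncate_id rho a : `|a| <= rho -> truncate rho a = a.
Proof.
rewrite ler_norml => /andP[a0 a1].
by rewrite /truncate (min_idPr a1) (max_idPr a0).
Qed.

Lemma truncate_lip rho a b : 0 <= rho ->
  `|truncate rho a - truncate rho b| <= `|a - b|.
Proof.
move=> r0; rewrite /truncate /Num.max /Num.min.
case: (ger0P (a - b)) => ab; case: (ltP rho a) => ha; case: (ltP rho b) => hb;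
  do ?[case: (ltP (- rho) _) => ?]; rewrite ler_norml; apply/andP; split; lra.
Qed.

(** The retraction onto the box of radius rho around y0. It is 1-Lipschitz for
the maximum norm, so composing with it makes the estimates near y0 global. *)
Definition clip_around N (y0 : 'rV[R]_N) (rho : R) (y : 'rV[R]_N) : 'rV[R]_N :=
  y0 + map_mx (truncate rho) (y - y0).

Lemma clip_around_le N (y0 : 'rV[R]_N) rho y : 0 <= rho ->
  `|clip_around y0 rho y - y0| <= rho.
Proof.
move=> r0; rewrite /clip_around addrC addKr.
by apply/mx_norm_leP => // i j; rewrite mxE; exact: truncate_le.
Qed.

Lemma clip_around_id N (y0 : 'rV[R]_N) rho y : `|y - y0| <= rho ->
  clip_around y0 rho y = y.
Proof.
move=> yr; rewrite /clip_around; apply/rowP => j; rewrite !mxE truncate_id.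
  by rewrite addrC subrK.
by apply: le_trans yr; have := mx_norm_entry (y - y0) 0 j; rewrite !mxE.
Qed.

Lemma clip_around_lip N (y0 : 'rV[R]_N) rho y z : 0 <= rho ->
  `|clip_around y0 rho y - clip_around y0 rho z| <= `|y - z|.
Proof.
move=> r0; apply/mx_norm_leP => // i j; rewrite ord1 !mxE opprD addrACA subrr add0r.
apply: le_trans (truncate_lip _ _ r0) _.
rewrite opprB addrA subrK.
by have := mx_norm_entry (y - z) 0 j; rewrite !mxE.
Qed.

Lemma is_deriveZf (B : normedModType R) (s : R -> R) (f : R -> B) (t ds : R) df :
  is_derive t (1 : R) s ds -> is_derive t (1 : R) f df ->
  is_derive t (1 : R) (fun t => s t *: f t) (s t *: df + ds *: f t).
Proof.
move=> [ds1 ds2] [df1 df2].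
have ds' : differentiable s t by exact/derivable1_diffP.
have df' : differentiable f t by exact/derivable1_diffP.
have [dsf Dsf] := is_diffZf ds' df'.
apply: DeriveDef; first exact/derivable1_diffP.
by rewrite deriveE // Dsf -ds2 -df2 !deriveE.
Qed.

Lemma is_derive_mulmxl p q k (h : 'M[R]_(p, q)) (A : R -> 'M[R]_(q, k)) (t : R) dA :
  is_derive t (1 : R) A dA -> is_derive t (1 : R) (fun t => h *m A t) (h *m dA).
Proof.
move=> dAt; have [dL DL] := diff_mx_linear (mulmx h : {linear 'M[R]_(q, k) -> _}) (A t).
by have := is_derive_comp dAt dL; rewrite DL.
Qed.

(** Solutions are built along rays from the origin, one ordinary equation for each
direction; the compatibility condition enters only when two neighbouring rays
are compared, where it turns the derivative of the defect
y_(s+h) - y_s - t h L(y_s) into a small multiple of the defect itself, up to an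
error of second order in h. *)
Theorem total_differential N m (L : 'rV[R]_N -> 'M[R]_(m, N)) (y0 : 'rV[R]_N)
    (P : set 'rV[R]_N) :
  smooth_at y0 L -> nbhs y0 P ->
  (\forall y \near y0, forall s h : 'rV[R]_m,
     h *m 'd L y (s *m L y) = s *m 'd L y (h *m L y)) ->
  exists (F : 'rV[R]_m -> 'rV[R]_N) (r : R), [/\ 0 < r, F 0 = y0 &
   forall s, `|s| < r -> [/\ P (F s), smooth_at (F s) L, differentiable F s &
     forall v, 'd F s v = v *m L (F s)]].
Proof.
move=> sL NP NI.
have [rho [K [rho0 K0 bL bD bT]]] := taylor_bounds sL (filterI NP NI).
pose mm : R := m%:R; have mm0 : 0 <= mm by exact: ler0n.
have mK0 : 0 <= mm * K by rewrite mulr_ge0 // ltW.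
(* below r the rays stay in the ball where the bounds hold, and s L is Lipschitz
   with constant 1/2 *)
pose c := mm * K + 1; have c0 : 0 < c by rewrite ltr_wpDl.
pose r := Num.min (rho / c) (2^-1 / c).
have r0 : 0 < r by rewrite lt_min !divr_gt0.
have small s : `|s : 'rV[R]_m| < r -> mm * `|s| * K <= rho /\ mm * `|s| * K <= 2^-1.
  rewrite lt_min !ltr_pdivlMr // => /andP[s1 s2].
  have s00 : 0 <= `|s| by [].
  have : mm * `|s| * K <= `|s| * c by rewrite /c; nra.
  by move=> H; split; apply: le_trans H _; exact: ltW.
have mulL (s : 'rV[R]_m) (A : 'M[R]_(m, N)) b : `|A| <= b -> `|s *m A| <= mm * `|s| * b.
  move=> Ab; apply: le_trans (norm_mulmx_le _ _) _.
  by rewrite ler_wpM2l // mulr_ge0.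
have ray s : exists y : R -> 'rV[R]_N, `|s : 'rV[R]_m| < r -> y 0 = y0 /\
   forall t : R, 0 <= t <= 1 -> `|y t - y0| <= rho /\
     is_derive t (1 : R) y (s *m L (y t)).
  have [sr|nsr] := pselect (`|s| < r); last by exists (fun=> 0).
  have [s1 s2] := small s sr.
  have [||y [yE dy]] := @picard R N (fun y => s *m L (clip_around y0 rho y)) y0 (mm * `|s| * K).
  - by move=> y; apply: mulL; have [_ []] := bL _ (clip_around_le y0 y (ltW rho0)).
  - move=> y z; rewrite -mulmxBr.
    have [bl _] := bT _ _ (clip_around_le y0 y (ltW rho0)) (clip_around_le y0 z (ltW rho0)).
    apply: le_trans (mulL _ _ _ bl) _; rewrite mulrA.
    by apply: ler_pM => //; [rewrite !mulr_ge0 // ltW|exact: clip_around_lip (ltW rho0)].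
  have yb (t : R) : 0 <= t <= 1 -> `|y t - y0| <= rho.
    move=> /andP[t0 t1]; rewrite -[X in _ - X]yE.
    have B0 : 0 <= mm * `|s| * K by rewrite !mulr_ge0 // ltW.
    have := @mean_value_le _ _ y (fun t => s *m L (clip_around y0 rho (y t))) 0 t _ t0 B0.
    rewrite subr0 => H; apply: le_trans (H _ _) _.
    + by move=> u /andP[u0 ut]; apply: dy; rewrite u0 (le_trans ut).
    + by move=> u _; apply: mulL; have [_ []] := bL _ (clip_around_le y0 (y u) (ltW rho0)).
    + by apply: le_trans s1; rewrite ler_piMr.
  exists y => _; split => // t t01; split; first exact: yb.
  by have := dy t t01; rewrite clip_around_id //; exact: yb.
have [y Hy] := choice ray.
pose F s := y s 1.
have one01 : 0 <= (1 : R) <= 1 by rewrite ler01 lexx.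
have zero0 : `|0 : 'rV[R]_m| < r by rewrite normr0.
exists F, r; split => //.
  have [yE dy] := Hy 0 zero0.
  have := @mean_value_le _ _ (y 0) (fun t => 0 *m L (y 0 t)) 0 1 0 ler01 (lexx 0).
  rewrite yE mul0r => H; apply/eqP; rewrite -subr_eq0 -normr_le0.
  by apply: H => t t01; [have [] := dy t t01|rewrite mul0mx normr0].
move=> s sr; have [yE dy] := Hy s sr; have [s1 s2] := small s sr.
have Fb : `|F s - y0| <= rho by have [] := dy 1 one01.
have [sLF [[PF _] _]] := bL _ Fb.
suff [dF DF] : differentiable F s /\ 'd F s = mulmxr (L (F s)) :> (_ -> _).
  by split => // v; rewrite DF.
apply: diff_of_epsilon; first exact: mx_linear_continuous.
(* C1 bounds the distance between the rays s and h + s to first order in h, C2 the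
   defect of the linear approximation to second order *)
pose C1 := 2 * (mm * K); pose C2 := 2 * (2^-1 * C1 * C1 + mm * K * C1).
have C10 : 0 <= C1 by rewrite mulr_ge0.
have C20 : 0 <= C2.
  by rewrite mulr_ge0 // addr_ge0 //; [rewrite -mulrA mulr_ge0 // mulr_ge0|exact: mulr_ge0].
have est h : `|h + s| < r -> `|F (h + s) - F s - h *m L (F s)| <= C2 * `|h| * `|h|.
  move=> hr; have [zE dz] := Hy (h + s) hr.
  set z := y (h + s) in zE dz; set u := y s in yE dy.
  have h0 : 0 <= `|h| by [].
  have mh0 : 0 <= mm * `|h| * K by rewrite !mulr_ge0 // ltW.
  have D1 (t : R) : 0 <= t <= 1 -> `|z t - u t| <= C1 * `|h|.
    have := @gronwall_half R N (z - u) (fun t => (h + s) *m L (z t) - s *m L (u t)) (mm * `|h| * K) mh0.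
    rewrite /= !fctE zE yE subrr => /(_ erefl) H t01.
    have -> : C1 * `|h| = 2 * (mm * `|h| * K) by rewrite /C1; ring.
    apply: H => // {t01}t t01; have [zb dzt] := dz t t01; have [ub dut] := dy t t01.
      exact: is_deriveB.
    rewrite mulmxDl -addrA -mulmxBr addrC; apply: le_trans (ler_normD _ _) _.
    have [_ [_ Lz]] := bL _ zb; have [Lzu _] := bT _ _ zb ub.
    rewrite lerD //; last exact: mulL.
    apply: le_trans (mulL _ _ _ Lzu) _; rewrite mulrA ler_wpM2r //.
  have D2 (t : R) : 0 <= t <= 1 ->
      is_derive t (1 : R) (fun t => L (u t)) ('d L (u t) (s *m L (u t))).
    move=> t01; have [ub dut] := dy t t01; have [sLu _] := bL _ ub.
    exact: is_derive_comp (smooth_at_differentiable sLu).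
  have := @gronwall_half R N (fun t => z t - u t - t *: (h *m L (u t)))
     (fun t => (h + s) *m L (z t) - s *m L (u t) -
        (t *: (h *m 'd L (u t) (s *m L (u t))) + h *m L (u t))) (2^-1 * C2 * `|h| * `|h|).
  have -> : C2 * `|h| * `|h| = 2 * (2^-1 * C2 * `|h| * `|h|) by field.
  rewrite zE yE subrr scale0r subr0 => H.
  rewrite -[h *m L (F s)]scale1r; apply: H => //.
  - by do 3!apply: mulr_ge0 => //.
  - move=> t t01; have [zb dzt] := dz t t01; have [ub dut] := dy t t01.
    have dth := is_deriveZf (is_derive_id t (1 : R)) (is_derive_mulmxl h (D2 t t01)).
    by have := is_deriveB (is_deriveB dzt dut) dth; rewrite scale1r.
  - move=> t t01; have [zb dzt] := dz t t01; have [ub dut] := dy t t01.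
    have [_ [[_ I] _]] := bL _ ub; have [Lzu Tzu] := bT _ _ zb ub.
    have -> : (h + s) *m L (z t) - s *m L (u t) -
        (t *: (h *m 'd L (u t) (s *m L (u t))) + h *m L (u t)) =
      s *m (L (z t) - L (u t) - 'd L (u t) (z t - u t)) +
      s *m 'd L (u t) (z t - u t - t *: (h *m L (u t))) +
      h *m (L (z t) - L (u t)).
      rewrite I [X in _ = _ + s *m X + _]linearB linearZ /= !(mulmxBr, mulmxDl) -scalemxAr.
      move: (h *m L (z t)) (s *m L (z t)) (s *m L (u t)) (s *m 'd L (u t) (h *m L (u t)))
        (h *m L (u t)) (s *m 'd L (u t) (z t - u t)) => a1 a2 a3 a4 a5 a6.
      by apply/rowP => j; rewrite !mxE; ring.
    have D := D1 t t01; have Ds0 : 0 <= `|z t - u t| by [].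
    set w := z t - u t - _.
    have ms0 : 0 <= mm * `|s| by rewrite mulr_ge0.
    have N1 := mulL s _ _ Tzu; have N2 := mulL s _ _ (bD (u t) w ub).
    have N3 := mulL h _ _ Lzu.
    have w0 : 0 <= `|w| by [].
    apply: le_trans (ler_normD _ _) _.
    apply: (@le_trans _ _ (2^-1 * (C1 * `|h|) * (C1 * `|h|) + 2^-1 * `|w| +
       mm * `|h| * (K * (C1 * `|h|)))); last first.
      by rewrite le_eqVlt; apply/orP; left; apply/eqP; rewrite /C2; field.
    have KD : K * `|z t - u t| <= K * (C1 * `|h|) by rewrite ler_wpM2l // ltW.
    apply: lerD; last first.
      by apply: le_trans N3 _; rewrite ler_wpM2l // mulr_ge0.
    apply: le_trans (ler_normD _ _) _; apply: lerD.
      apply: le_trans N1 _.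
      apply: (@le_trans _ _ (2^-1 * `|z t - u t| * `|z t - u t|)).
        by rewrite !mulrA ler_wpM2r // ler_wpM2r.
      by rewrite -!(mulrA 2^-1) ler_wpM2l //; apply: ler_pM.
    by apply: le_trans N2 _; rewrite mulrA ler_wpM2r.
move=> e e0.
have d0 : 0 < Num.min (r - `|s|) (e / (C2 + 1)).
  by rewrite lt_min subr_gt0 sr divr_gt0 // ltr_wpDl.
apply/nbhs_ballP; exists (Num.min (r - `|s|) (e / (C2 + 1))) => // h.
rewrite -ball_normE /= sub0r normrN lt_min => /andP[h1 h2].
apply: le_trans (est h _) _.
  by apply: le_lt_trans (ler_normD _ _) _; rewrite -ltrBrDr.
rewrite ler_wpM2r //; move: h2; rewrite ltr_pdivlMr ?ltr_wpDl // => /ltW.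
by apply: le_trans; rewrite mulrC ler_wpM2l // lerDl.
Qed.

End TotalDifferential.

(** * Smooth matrix-valued maps *)

Section SmoothMatrices.
Variable R : realType.
Implicit Types A B : normedModType R.

Lemma smooth_at_eq A B x (f g : A -> B) : (forall y, f y = g y) ->
  smooth_at x f -> smooth_at x g.
Proof. by move=> /funext ->. Qed.

Lemma smooth_at_mulmx A p q k x (f : A -> 'M[R]_(p, q)) (g : A -> 'M[R]_(q, k)) :
  smooth_at x f -> smooth_at x g -> smooth_at x (fun y => f y *m g y).
Proof.
move=> /smooth_at_mxP sf /smooth_at_mxP sg; apply/smooth_at_mxP => i j.
apply: (@smooth_at_ext _ _ _ _ (fun y => \sum_k f y i k * g y k j)).
  by apply: nearW => y; rewrite mxE.
by apply: smooth_at_sum => l _; apply: smooth_atM.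
Qed.

Lemma smooth_at_trmx A p q x (f : A -> 'M[R]_(p, q)) :
  smooth_at x f -> smooth_at x (fun y => (f y)^T).
Proof.
move=> /smooth_at_mxP sf; apply/smooth_at_mxP => i j.
by apply: smooth_at_ext (sf j i); apply: nearW => y; rewrite mxE.
Qed.

Lemma smooth_at_row A p q x (f : A -> 'M[R]_(p, q)) i :
  smooth_at x f -> smooth_at x (fun y => row i (f y)).
Proof.
move=> /smooth_at_mxP sf; apply/smooth_at_mxP => k j.
by apply: smooth_at_ext (sf i j); apply: nearW => y; rewrite mxE.
Qed.

Lemma smooth_at_det A p x (f : A -> 'M[R]_p) :
  smooth_at x f -> smooth_at x (fun y => \det (f y)).
Proof.
move=> /smooth_at_mxP sf; apply: smooth_at_sum => s _.
apply: smooth_atM; first exact: smooth_at_cst.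
by apply: smooth_at_prod => i _.
Qed.

Lemma smooth_at_unitmx A p x (f : A -> 'M[R]_p) : smooth_at x f ->
  f x \in unitmx -> \forall y \near x, f y \in unitmx.
Proof.
move=> sf; rewrite unitmxE unitfE => fx.
apply: filterS (smooth_at_neq0 (smooth_at_det sf) fx) => y.
by rewrite unitmxE unitfE.
Qed.

(** Cramer's rule. *)
Lemma smooth_at_invmx A p x (f : A -> 'M[R]_p) : f x \in unitmx ->
  smooth_at x f -> smooth_at x (fun y => invmx (f y)).
Proof.
move=> fx sf; apply: (@smooth_at_ext _ _ _ _ (fun y => (\det (f y))^-1 *: \adj (f y))).
  by apply: filterS (smooth_at_unitmx sf fx) => y fy; rewrite /invmx fy.
apply: smooth_atZ.
  apply: smooth_atV; last exact: smooth_at_det.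
  by rewrite -unitfE -unitmxE.
apply/smooth_at_mxP => i j.
apply: (@smooth_at_ext _ _ _ _ (fun y => (-1) ^+ (j + i) * \det (row' j (col' i (f y))))).
  by apply: nearW => y; rewrite mxE.
apply: smooth_atM; first exact: smooth_at_cst.
apply: smooth_at_det; apply/smooth_at_mxP => k l.
move/smooth_at_mxP : sf => sf.
by apply: smooth_at_ext (sf (lift j k) (lift i l)); apply: nearW => y; rewrite !mxE.
Qed.

Lemma diff_jacobian p q (h : 'rV[R]_p -> 'rV[R]_q) x v :
  'd h x v = v *m jacobian h x.
Proof. by rewrite /jacobian mul_rV_lin1. Qed.

Lemma smooth_at_jacobian p q (h : 'rV[R]_p -> 'rV[R]_q) x :
  smooth_at x h -> smooth_at x (fun y => jacobian h y).
Proof.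
move=> sh; apply/smooth_at_mxP => i j.
have /smooth_at_mxP/(_ 0 j) := smooth_at_diff (delta_mx 0 i) sh.
by apply: smooth_at_eq => y; rewrite diff_jacobian -rowE mxE.
Qed.

(** The differential of a solution is a smooth function of the solution, so each
order of differentiability gives the next. *)
Lemma smooth_of_total_differential N m (L : 'rV[R]_N -> 'M[R]_(m, N))
    (F : 'rV[R]_m -> 'rV[R]_N) (U : set 'rV[R]_m) : open U ->
  (forall s, U s -> [/\ smooth_at (F s) L, differentiable F s &
     forall v, 'd F s v = v *m L (F s)]) ->
  smooth_on F U.
Proof.
move=> oU H; elim=> [|k IH].
  by move=> s /H[_ dF _]; exact: differentiable_continuous.
split=> [s /H[]//|v].
apply: (@Ck_on_ext _ _ _ _ ((fun y => v *m L y) \o F)) => //.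
  by move=> s /H[_ _ ->].
apply: (@Ck_on_comp _ _ _ _ _ _ _ _ [set y | smooth_at y (fun y => v *m L y)]) => //.
  move=> s /H[sL _ _] /=; apply: smooth_at_mulmx => //; exact: smooth_at_cst.
apply: Ck_onP => y [W [oW Wy] /(_ k)]; apply: Ck_on_sub => _ -> //.
Qed.

(** The common source of the product rules for Christoffel terms and for metric
products along a map: T depends on a base point and is bilinear in the other two
arguments. *)
Lemma diff_bilin_family A n p q B (T : 'rV[R]_n -> 'rV[R]_p -> 'rV[R]_q -> B)
    (F : A -> 'rV[R]_n) (a : A -> 'rV[R]_p) (b : A -> 'rV[R]_q) x v :
  (forall y c, linear (fun b => T y b c)) -> (forall y b, linear (T y b)) ->
  (forall b c, smooth_at (F x) (fun y => T y b c)) ->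
  smooth_at x F -> smooth_at x a -> smooth_at x b ->
  smooth_at x (fun u => T (F u) (a u) (b u)) /\
  'd (fun u => T (F u) (a u) (b u)) x v =
    'd (fun y => T y (a x) (b x)) (F x) ('d F x v) +
    T (F x) ('d a x v) (b x) + T (F x) (a x) ('d b x v).
Proof.
move=> l1 l2 sT sF sa sb.
have s1 b0 c0 : smooth_at x (fun u => T (F u) b0 c0).
  exact: (smooth_at_comp sF (sT b0 c0)).
have s2 c0 : smooth_at x (fun u => T (F u) (a u) c0).
  exact: (smooth_lin_family (T := fun u b => T (F u) b c0)).
split; first exact: (smooth_lin_family (T := fun u => T (F u) (a u))).
have dd := smooth_at_differentiable.
rewrite (diff_lin_family (T := fun u => T (F u) (a u)) v) //; last 2 first.
- by move=> c0; exact/dd.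
- exact: dd.
congr (_ + _).
rewrite (diff_lin_family (T := fun u b0 => T (F u) b0 (b x)) v) //; last 2 first.
- by move=> c0; exact/dd.
- exact: dd.
congr (_ + _).
by rewrite (@diff_comp _ _ _ _ F (fun y => T y (a x) (b x))) //; exact: dd.
Qed.

End SmoothMatrices.

(** * Connections in coordinates *)

Lemma mxDZ (R : realType) p q (a : R) (A B : 'M[R]_(p, q)) i j :
  (a *: A + B) i j = a * A i j + B i j.
Proof. by rewrite !mxE. Qed.

Section LocalGeometry.
Variables (R : realType) (n : nat) (O : set 'rV[R]_n).
Variable Gam : 'I_n -> 'rV[R]_n -> 'M[R]_n.
Hypothesis oO : open O.
Hypothesis Gam_smooth : forall k y, O y -> smooth_at y (Gam k).

Definition chr (y v w : 'rV[R]_n) : 'rV[R]_n := \row_k (v *m Gam k y *m w^T) 0 0.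

Hypothesis chr_sym : forall y v w, O y -> chr y v w = chr y w v.

Definition curv (y u v w : 'rV[R]_n) : 'rV[R]_n :=
  'd (fun z => chr z v w) y u - 'd (fun z => chr z u w) y v
  + chr y u (chr y v w) - chr y v (chr y u w).

(** The covariant derivative, in the direction of the constant vector v, of the
field xi along the map F. *)
Definition along d (F xi : 'rV[R]_d -> 'rV[R]_n) (u v : 'rV[R]_d) : 'rV[R]_n :=
  'd xi u v + chr (F u) ('d F u v) (xi u).

Lemma chrE y v w k : chr y v w 0 k = (v *m Gam k y *m w^T) 0 0.
Proof. by rewrite mxE. Qed.

Lemma chr_linearl y w : linear (fun v => chr y v w).
Proof.
move=> a u v; apply/rowP => k.
by rewrite mxDZ !chrE !mulmxDl -!scalemxAl mxDZ.
Qed.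

Lemma chr_linearr y v : linear (chr y v).
Proof.
move=> a u w; apply/rowP => k.
by rewrite mxDZ !chrE linearP /= mulmxDr -scalemxAr mxDZ.
Qed.

Lemma chr_smooth y v w : O y -> smooth_at y (fun z => chr z v w).
Proof.
move=> Oy; apply/smooth_at_mxP => i k.
apply: (@smooth_at_eq _ _ _ _ (fun z => (v *m Gam k z *m w^T) 0 0)).
  by move=> z; rewrite -chrE ord1.
have : smooth_at y (fun z => v *m Gam k z *m w^T).
  apply: smooth_at_mulmx; last exact: smooth_at_cst.
  by apply: smooth_at_mulmx; [exact: smooth_at_cst|exact: Gam_smooth].
by move/smooth_at_mxP.
Qed.

Lemma chrDr y u v w : chr y u (v + w) = chr y u v + chr y u w.
Proof. by have := chr_linearr y u 1 v w; rewrite !scale1r. Qed.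

Lemma chrZr y a u v : chr y u (a *: v) = a *: chr y u v.
Proof.
by apply/rowP => k; rewrite chrE [RHS]mxE chrE linearZ /= -scalemxAr mxE.
Qed.

Variable G : 'rV[R]_n -> 'M[R]_n.
Hypothesis G_smooth : forall y, O y -> smooth_at y G.

Definition dot (y v w : 'rV[R]_n) : R := (v *m G y *m w^T) 0 0.

Hypothesis G_compat : forall y v w z, O y ->
  'd (fun y => dot y w z) y v = dot y (chr y v w) z + dot y w (chr y v z).

Lemma dot_linearl y w : linear (fun v => dot y v w : R).
Proof. by move=> a u v; rewrite /dot !mulmxDl -!scalemxAl mxDZ. Qed.

Lemma dot_linearr y v : linear (dot y v : _ -> R).
Proof. by move=> a u w; rewrite /dot linearP /= mulmxDr -scalemxAr mxDZ. Qed.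

Lemma dot_smooth y v w : O y -> smooth_at y (fun z => dot z v w : R).
Proof.
move=> Oy; have : smooth_at y (fun z => v *m G z *m w^T).
  apply: smooth_at_mulmx; last exact: smooth_at_cst.
  by apply: smooth_at_mulmx; [exact: smooth_at_cst|exact: G_smooth].
by move/smooth_at_mxP => /(_ 0 0).
Qed.

Lemma dotDl y u v w : dot y (u + v) w = dot y u w + dot y v w.
Proof. by rewrite /dot !mulmxDl mxE. Qed.

Lemma dotDr y u v w : dot y u (v + w) = dot y u v + dot y u w.
Proof. by rewrite /dot linearD /= mulmxDr mxE. Qed.

Lemma dotNr y u v : dot y u (- v) = - dot y u v.
Proof. by rewrite /dot linearN /= mulmxN mxE. Qed.

Lemma dotNl y u v : dot y (- u) v = - dot y u v.
Proof. by rewrite /dot !mulNmx mxE. Qed.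

Section AlongMaps.
Variable d : nat.
Implicit Types (F xi e : 'rV[R]_d -> 'rV[R]_n) (u v a b : 'rV[R]_d).

Lemma smooth_chr F (a xi : 'rV[R]_d -> 'rV[R]_n) u v : O (F u) ->
  smooth_at u F -> smooth_at u a -> smooth_at u xi ->
  smooth_at u (fun z => chr (F z) (a z) (xi z)) /\
  'd (fun z => chr (F z) (a z) (xi z)) u v =
    'd (fun y => chr y (a u) (xi u)) (F u) ('d F u v) +
    chr (F u) ('d a u v) (xi u) + chr (F u) (a u) ('d xi u v).
Proof.
move=> OF sF sa sxi; apply: diff_bilin_family => //.
- by move=> y c; exact: chr_linearl.
- by move=> y b; exact: chr_linearr.
- by move=> b c; exact: chr_smooth.
Qed.

Lemma smooth_along F xi u v : O (F u) -> smooth_at u F -> smooth_at u xi ->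
  smooth_at u (fun z => along F xi z v).
Proof.
move=> OF sF sxi; apply: smooth_atD; first exact: smooth_at_diff.
by apply: (smooth_chr 0 OF sF (smooth_at_diff v sF) sxi).1.
Qed.

Lemma along_diff_sym F u a b : O (F u) -> smooth_at u F ->
  along F (fun z => 'd F z b) u a = along F (fun z => 'd F z a) u b.
Proof. by move=> OF sF; exact: congr2 (schwarz b a sF) (chr_sym _ _ OF). Qed.

Lemma alongD F xi eta u v : smooth_at u xi -> smooth_at u eta ->
  along F (fun z => xi z + eta z) u v = along F xi u v + along F eta u v.
Proof.
move=> sxi seta; rewrite /along.
have D := diffDf v (smooth_at_differentiable sxi) (smooth_at_differentiable seta).
by apply: etrans (congr2 _ D (chrDr _ _ _ _)) _; rewrite addrACA.
Qed.

Lemma alongZ F (s : 'rV[R]_d -> R) xi u v : smooth_at u s -> smooth_at u xi ->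
  along F (fun z => s z *: xi z) u v =
  s u *: along F xi u v + 'd s u v *: xi u.
Proof.
move=> ss sxi; rewrite /along.
have D := diffZf v (smooth_at_differentiable ss) (smooth_at_differentiable sxi).
by apply: etrans (congr2 _ D (chrZr _ _ _ _)) _; rewrite scalerDr addrAC.
Qed.

Lemma along_ext F xi eta u v : differentiable xi u ->
  (\forall z \near u, xi z = eta z) -> along F eta u v = along F xi u v.
Proof.
move=> dxi e; rewrite /along -(nbhs_singleton e).
have D : 'd eta u v = 'd xi u v.
  exact: (@near_eq_diff R _ _ xi eta u v dxi e).
by apply: (f_equal (fun w => w + _)).
Qed.

(** The second derivatives of F and of xi drop out by their symmetry, and the
remaining terms are those of the curvature. *)
Lemma ricci_identity F xi u a b : O (F u) -> smooth_at u F -> smooth_at u xi ->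
  along F (fun z => along F xi z b) u a - along F (fun z => along F xi z a) u b =
  curv (F u) ('d F u a) ('d F u b) (xi u).
Proof.
move=> OF sF sxi.
pose A a' b' := 'd (fun z => 'd xi z b') u a'.
have SA : A b a = A a b := schwarz a b sxi.
pose B a' b' := 'd (fun y => chr y ('d F u b') (xi u)) (F u) ('d F u a').
pose C a' b' := 'd (fun z => 'd F z b') u a'.
have SC : C b a = C a b := schwarz a b sF.
have E a' b' : along F (fun z => along F xi z b') u a' =
   A a' b' + (B a' b' + chr (F u) (C a' b') (xi u) +
    chr (F u) ('d F u b') ('d xi u a')) +
   (chr (F u) ('d F u a') ('d xi u b') +
    chr (F u) ('d F u a') (chr (F u) ('d F u b') (xi u))).
  have [sc Dc] := smooth_chr a' OF sF (smooth_at_diff b' sF) sxi.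
  have D := diffDf a' (smooth_at_differentiable (smooth_at_diff b' sxi)) (smooth_at_differentiable sc).
  have D' := etrans D (f_equal (fun w => _ + w) Dc).
  by apply: etrans (congr2 _ D' (chrDr _ _ _ _)) _.
have EC : curv (F u) ('d F u a) ('d F u b) (xi u) = B a b - B b a +
  chr (F u) ('d F u a) (chr (F u) ('d F u b) (xi u)) -
  chr (F u) ('d F u b) (chr (F u) ('d F u a) (xi u)) by [].
apply: etrans (congr2 (fun p q => p - q) (E a b) (E b a)) (etrans _ (esym EC)).
rewrite SA SC; clearbody A B C.
have alg (p1 p2 p3 p4 p5 p6 p7 p8 : 'rV[R]_n) :
    p1 + (p2 + p3 + p4) + (p5 + p6) - (p1 + (p7 + p3 + p5) + (p4 + p8)) =
    p2 - p7 + p6 - p8.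
  by apply/rowP => j; rewrite !mxE; ring.
exact: alg.
Qed.

Lemma metric_along F xi eta u v : O (F u) ->
  smooth_at u F -> smooth_at u xi -> smooth_at u eta ->
  smooth_at u (fun z => dot (F z) (xi z) (eta z) : R) /\
  'd (fun z => dot (F z) (xi z) (eta z) : R) u v =
  dot (F u) (along F xi u v) (eta u) + dot (F u) (xi u) (along F eta u v).
Proof.
move=> OF sF sxi seta.
have [|||s D] := @diff_bilin_family R _ n n n _ dot F xi eta u v _ _ _ sF sxi seta.
- by move=> y c; exact: dot_linearl.
- by move=> y b; exact: dot_linearr.
- by move=> b c; exact: dot_smooth.
split => //; apply: etrans D _; rewrite /along dotDl dotDr (G_compat _ _ _ OF).
by move: (dot _ _ _) (dot _ _ _) (dot _ _ _) (dot _ _ _) => x1 x2 x3 x4; ring.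
Qed.

(** Differentiating dF + D xi = phi e and skew-symmetrizing: the contribution of
dF vanishes because the connection is symmetric, and that of D xi is the
curvature. *)
Lemma curv_of_rank_one_differential F xi e (phi : 'rV[R]_d -> 'rV[R]_d -> R) u a b : O (F u) ->
  smooth_at u F -> smooth_at u xi -> smooth_at u e ->
  (forall b, smooth_at u (fun z => phi z b)) ->
  (\forall z \near u, forall b, 'd F z b + along F xi z b = phi z b *: e z) ->
  curv (F u) ('d F u a) ('d F u b) (xi u) =
    ('d (fun z => phi z b) u a - 'd (fun z => phi z a) u b) *: e u +
    (phi u b *: along F e u a - phi u a *: along F e u b).
Proof.
move=> OF sF sxi se sphi H.
have E a' b' : along F (fun z => 'd F z b') u a' +
     along F (fun z => along F xi z b') u a' =
   phi u b' *: along F e u a' + 'd (fun z => phi z b') u a' *: e u.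
  apply: etrans (esym (alongD _ _ (smooth_at_diff b' sF) (smooth_along b' OF sF sxi))) _.
  apply: etrans _ (alongZ _ _ (sphi b') se).
  apply: along_ext; first exact/smooth_at_differentiable/smooth_atZ.
  by apply: filterS H => z ->.
have E1 := E a b; have E2 := E b a; have S := along_diff_sym a b OF sF.
rewrite -(ricci_identity a b OF sF sxi).
have alg (z z2 z3 A B : 'rV[R]_n) : z + z2 = A -> z + z3 = B -> z2 - z3 = A - B.
  by move=> <- <-; apply/rowP => j; rewrite !mxE; ring.
apply: etrans (alg _ _ _ _ _ (etrans (f_equal (fun w => w + _) (esym S)) E1) E2) _.
have alg2 (pa pb s s' : R) (w w' e' : 'rV[R]_n) :
    pb *: w + s *: e' - (pa *: w' + s' *: e') =
    (s - s') *: e' + (pb *: w - pa *: w').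
  by apply/rowP => j; rewrite !mxE; ring.
exact: alg2.
Qed.

End AlongMaps.

(** The second derivatives of the metric products of constant fields are
symmetric, and by compatibility their skew part is the left-hand side. *)
Lemma curv_skew y a b w z : O y ->
  dot y (curv y a b w) z + dot y w (curv y a b z) = 0.
Proof.
move=> Oy.
have sid v : smooth_at v (@idfun 'rV[R]_n).
  exact: (smooth_at_mx_linear (idfun : {linear 'rV[R]_n -> 'rV[R]_n})).
have did v c : 'd (@idfun 'rV[R]_n) v c = c.
  by rewrite (diff_mx_linear (idfun : {linear 'rV[R]_n -> 'rV[R]_n}) v).2.
(* fields are fields along the identity map *)
have alid xi v c : along idfun xi v c = 'd xi v c + chr v c (xi v).
  have E (c' : 'rV[R]_n) : c' = c -> 'd xi v c + chr v c' (xi v) = 'd xi v c + chr v c (xi v).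
    by move=> ->.
  exact: E (did v c).
have alc (c' : 'rV[R]_n) v c : along idfun (cst c') v c = chr v c c'.
  apply: etrans (alid _ _ _) _; have D0 : 'd (cst c') v c = 0 by rewrite diff_cst.
  exact: etrans (f_equal (fun w => w + _) D0) (add0r _).
have E a' b' : 'd (fun y => 'd (fun y => dot y w z : R) y b') y a' =
   dot y ('d (fun y => chr y b' w) y a' + chr y a' (chr y b' w)) z +
   dot y (chr y b' w) (chr y a' z) +
   (dot y (chr y a' w) (chr y b' z) +
    dot y w ('d (fun y => chr y b' z) y a' + chr y a' (chr y b' z))).
  have [s1 D1] := metric_along (F := idfun) a' Oy (sid y) (chr_smooth b' w Oy) (@smooth_at_cst _ _ _ y z).
  have [s2 D2] := metric_along (F := idfun) a' Oy (sid y) (@smooth_at_cst _ _ _ y w) (chr_smooth b' z Oy).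
  have N : \forall x \near y, dot x (chr x b' w) z + dot x w (chr x b' z) = 'd (fun y => dot y w z : R) x b'.
    apply: filterS (open_nbhs_nbhs (conj oO Oy)) => x Ox.
    exact/esym/G_compat.
  apply: etrans (near_eq_diff a' (smooth_at_differentiable (smooth_atD s1 s2)) N) _.
  apply: etrans (diffDf a' (smooth_at_differentiable s1) (smooth_at_differentiable s2)) _.
  apply: etrans (congr2 +%R D1 D2) _.
  by rewrite (alid (fun y => chr y b' w)) (alc z) (alc w) (alid (fun y => chr y b' z)).
have S := schwarz_scalar a b (dot_smooth w z Oy).
have {}S := etrans (esym (E b a)) (etrans S (E a b)).
rewrite /curv !(dotDl, dotDr, dotNl, dotNr).
move: S; rewrite !(dotDl, dotDr).
have alg (x1 x2 x3 x4 x5 x6 x7 x8 x9 x10 : R) :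
  x1 + x2 + x3 + (x4 + (x5 + x6)) = x7 + x8 + x4 + (x3 + (x9 + x10)) ->
  x7 - x1 + x8 - x2 + (x9 - x5 + x10 - x6) = 0 by lra.
exact: alg.
Qed.

End LocalGeometry.

(** * Charts *)

Section ChartCalculus.
Variables (R : realType) (n : nat) (M : manifold R n).
Implicit Types (p q r x : M) (v : 'rV[R]_n).

Lemma dom_open p : open (dom p).
Proof. exact: cdom_open. Qed.

Lemma dom_self p : dom p p.
Proof. exact: chart_at_dom. Qed.

Lemma point_coord p x : dom p x -> point p (coord p x) = x.
Proof. exact: cmapK. Qed.

Lemma chart_continuous p x : dom p x -> {for x, continuous (coord p)}.
Proof.
move=> px; have := @cmap_continuous _ _ _ (chart_at p).
by rewrite continuous_open_subspace; [apply; rewrite inE|exact: dom_open].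
Qed.

Lemma point_continuous p u : (coord p @` dom p) u -> {for u, continuous (point p)}.
Proof.
move=> pu; have := @cinv_continuous _ _ _ (chart_at p).
by rewrite continuous_open_subspace; [apply; rewrite inE|exact: cimg_open].
Qed.

Lemma near_chart p x : dom p x ->
  \forall u \near coord p x, (coord p @` dom p) u.
Proof.
move=> px; apply: open_nbhs_nbhs; split; first exact: cimg_open.
by exists x.
Qed.

Lemma near_coord p x (P : set 'rV[R]_n) : dom p x ->
  (\forall u \near coord p x, P u) -> \forall y \near x, P (coord p y).
Proof. by move=> px Px; have := chart_continuous px; apply. Qed.

Lemma coord_point p u : (coord p @` dom p) u ->
  dom p (point p u) /\ coord p (point p u) = u.
Proof. by move=> [x px <-]; rewrite point_coord. Qed.

Lemma near_point p x (A : set M) : dom p x -> nbhs x A ->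
  \forall u \near coord p x, A (point p u).
Proof.
move=> px Ax; have pu : (coord p @` dom p) (coord p x) by exists x.
by have := point_continuous pu; apply; rewrite point_coord.
Qed.

Lemma near_dom p x q : dom p x -> dom q x -> \forall u \near coord p x,
  [/\ dom p (point p u), dom q (point p u) & coord p (point p u) = u].
Proof.
move=> px qx; have Q := near_point px (open_nbhs_nbhs (conj (dom_open q) qx)).
by apply: filterS2 (near_chart px) Q => u /coord_point[].
Qed.

Lemma chart_image_open p (W : set M) : open W -> open (coord p @` (dom p `&` W)).
Proof.
move=> oW; rewrite openE => _ [x [px Wx] <-].
rewrite /interior; apply: filterS2 (near_chart px)
  (near_point px (open_nbhs_nbhs (conj oW Wx))) => u /coord_point[pu Eu] Wu.
by exists (point p u).
Qed.

Lemma transition_smooth p q x : dom p x -> dom q x ->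
  smooth_at (coord p x) (transition p q).
Proof.
move=> px qx; have oO := @chart_image_open p _ (dom_open q).
by apply: ((smooth_onP _ oO).1 (@chart_compat _ _ M p q)); exists x.
Qed.

Lemma transition_coord p q x : dom p x -> transition p q (coord p x) = coord q x.
Proof. by move=> px; rewrite /transition /= point_coord. Qed.

Lemma diff_transition p q r x v : dom p x -> dom q x -> dom r x ->
  'd (transition q r) (coord q x) ('d (transition p q) (coord p x) v) =
  'd (transition p r) (coord p x) v.
Proof.
move=> px qx rx.
have d1 := smooth_at_differentiable (transition_smooth px qx).
have d2 := smooth_at_differentiable (transition_smooth qx rx).
rewrite -(transition_coord q px) in d2 *.
have N : \forall u \near coord p x, (transition q r \o transition p q) u = transition p r u.
  apply: filterS (near_dom px qx) => u [pu qu _].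
  by rewrite /transition /= point_coord.
apply/esym; apply: etrans (near_eq_diff v (differentiable_comp d1 d2) N) _.
exact: (f_equal (fun h : 'rV[R]_n -> 'rV[R]_n => h v) (diff_comp d1 d2)).
Qed.

Lemma diff_transition_id p x v : dom p x -> 'd (transition p p) (coord p x) v = v.
Proof.
move=> px.
have N : \forall u \near coord p x, u = transition p p u.
  by apply: filterS (near_dom px px) => u [_ _ E]; rewrite /transition /= E.
have [d D] := diff_mx_linear (idfun : {linear 'rV[R]_n -> 'rV[R]_n}) (coord p x).
by apply: etrans (near_eq_diff v d N) _; rewrite D.
Qed.

(** The inverse of the identification tcoord q x of T_xM with the chart q. *)
Definition tback q x v : 'rV[R]_n := 'd (transition q x) (coord q x) v.

Lemma tcoordK q x v : dom q x -> tback q x (tcoord q x v) = v.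
Proof.
move=> qx; have xx := dom_self x.
apply: etrans (diff_transition v xx qx xx) _; exact: diff_transition_id.
Qed.

Lemma tback_tcoord q q' x v : dom q x -> dom q' x ->
  tcoord q' x (tback q x v) = 'd (transition q q') (coord q x) v.
Proof. by move=> qx q'x; exact: diff_transition (dom_self x) q'x. Qed.

Lemma tbackK q x v : dom q x -> tcoord q x (tback q x v) = v.
Proof. by move=> qx; apply: etrans (tback_tcoord v qx qx) _; exact: diff_transition_id. Qed.

Lemma tcoord_trans q q' x v : dom q x -> dom q' x ->
  'd (transition q q') (coord q x) (tcoord q x v) = tcoord q' x v.
Proof. by move=> qx q'x; exact: diff_transition (dom_self x) qx q'x. Qed.

Lemma tcoord_self x v : tcoord x x v = v.
Proof. exact: (diff_transition_id v (dom_self x)). Qed.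

Lemma tcoord_inj q x : dom q x -> injective (tcoord q x).
Proof. by move=> qx; apply: (can_inj (g := tback q x)) => v; exact: tcoordK. Qed.

Lemma tcoord_is_linear q x : linear (tcoord q x).
Proof. by move=> a u v; rewrite /tcoord linearP. Qed.

HB.instance Definition _ q x := GRing.isLinear.Build R 'rV[R]_n 'rV[R]_n _
  (tcoord q x) (@tcoord_is_linear q x).

End ChartCalculus.

Section MapCalculus.
Variables (R : realType) (d n : nat) (V : manifold R d) (M : manifold R n).
Variables (f : V -> M) (sf : smooth_map f).
Implicit Types (p : V) (q : M) (x y : V).

Definition frep p q : 'rV[R]_d -> 'rV[R]_n := coord q \o f \o point p.

Lemma f_near_dom q y : dom q (f y) -> nbhs y (f @^-1` dom q).
Proof.
move=> qy; apply: (sf.1 y); exact: open_nbhs_nbhs (conj (dom_open q) qy).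
Qed.

Lemma preimage_dom_open q : open (f @^-1` dom q).
Proof. by apply: open_comp; [move=> y _; exact: sf.1|exact: dom_open]. Qed.

Lemma frep_coord p q y : dom p y -> frep p q (coord p y) = coord q (f y).
Proof. by move=> py; rewrite /frep /= point_coord. Qed.

Lemma frep_smooth p q y : dom p y -> dom q (f y) -> smooth_at (coord p y) (frep p q).
Proof.
move=> py qy; have oO := @chart_image_open _ _ _ p _ (preimage_dom_open q).
by apply: ((smooth_onP _ oO).1 (sf.2 p q)); exists y.
Qed.

Lemma diff_frep p q p' q' y v : dom p y -> dom p' y -> dom q (f y) -> dom q' (f y) ->
  'd (frep p q) (coord p y) ('d (transition p' p) (coord p' y) v) =
  'd (transition q' q) (coord q' (f y)) ('d (frep p' q') (coord p' y) v).
Proof.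
move=> py p'y qy q'y.
have d1 := smooth_at_differentiable (transition_smooth p'y py).
have d2 := smooth_at_differentiable (frep_smooth py qy).
have d3 := smooth_at_differentiable (frep_smooth p'y q'y).
have d4 := smooth_at_differentiable (transition_smooth q'y qy).
rewrite -(transition_coord p p'y) in d2 *.
rewrite -(frep_coord q' p'y) in d4 *.
have N : \forall u \near coord p' y, (frep p q \o transition p' p) u =
    (transition q' q \o frep p' q') u.
  apply: filterS2 (near_dom p'y py) (near_point p'y (f_near_dom q'y)) => u [_ pu _] fu.
  by rewrite /frep /transition /= !point_coord.
apply: etrans (f_equal (fun h : 'rV[R]_d -> 'rV[R]_n => h v) (esym (diff_comp d1 d2))) _.
apply: etrans _ (f_equal (fun h : 'rV[R]_d -> 'rV[R]_n => h v) (diff_comp d3 d4)).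
exact/esym/(near_eq_diff v (differentiable_comp d1 d2) N).
Qed.

Lemma tmap_chart p q y v : dom p y -> dom q (f y) ->
  tcoord q (f y) (tmap f y v) = 'd (frep p q) (coord p y) (tcoord p y v).
Proof.
move=> py qy; apply/esym.
exact: (diff_frep v py (dom_self y) qy (dom_self (f y))).
Qed.

Lemma tmap_linear y : linear (tmap f y).
Proof. by move=> a u v; rewrite /tmap linearP. Qed.

HB.instance Definition _ y := GRing.isLinear.Build R 'rV[R]_d 'rV[R]_n _
  (tmap f y) (@tmap_linear y).

Lemma smooth_fieldP (W : set V) xi : open W -> smooth_field f W xi <->
  forall y p q, W y -> dom p y -> dom q (f y) ->
    smooth_at (coord p y) (field_rep f p q xi).
Proof.
move=> oW.
have oO p q : open (coord p @` (dom p `&` W `&` f @^-1` dom q)).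
  by rewrite -setIA; apply: chart_image_open; apply: openI => //; exact: preimage_dom_open.
split=> [H y p q Wy py qy|H p q].
  by apply: ((smooth_onP _ (oO p q)).1 (H p q)); exists y.
apply/(smooth_onP _ (oO p q)).
by move=> _ [y [[py Wy] qy] <-]; exact: H.
Qed.

Lemma field_rep_near p q p' q' y xi : dom p y -> dom p' y -> dom q (f y) -> dom q' (f y) ->
  \forall u \near coord p y, field_rep f p q xi u =
   'd (transition q' q) (frep p' q' (transition p p' u))
     (field_rep f p' q' xi (transition p p' u)).
Proof.
move=> py p'y qy q'y.
apply: filterS3 (near_dom py p'y) (near_point py (f_near_dom qy))
  (near_point py (f_near_dom q'y)) => u [_ pu _] qu q'u.
rewrite /field_rep /frep /transition /= point_coord //.
exact/esym/tcoord_trans.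
Qed.

Lemma field_rep_change p q p' q' y xi : dom p y -> dom p' y -> dom q (f y) -> dom q' (f y) ->
  smooth_at (coord p' y) (field_rep f p' q' xi) ->
  smooth_at (coord p y) (field_rep f p q xi).
Proof.
move=> py p'y qy q'y sxi.
have N := field_rep_near xi py p'y qy q'y.
apply: (smooth_at_ext (filterS (fun _ e => esym e) N)).
apply: (@smooth_at_comp _ _ _ _ (transition p p')
  (fun w => 'd (transition q' q) (frep p' q' w) (field_rep f p' q' xi w))).
  exact: transition_smooth.
rewrite transition_coord //.
apply: (@smooth_lin_family _ _ _ _ (fun w => 'd (transition q' q) (frep p' q' w))) => //.
  by move=> w a u v; rewrite linearP.
move=> b.
apply: (@smooth_at_comp _ _ _ _ (frep p' q') (fun w => 'd (transition q' q) w b)).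
  exact: frep_smooth.
apply: smooth_at_diff; rewrite frep_coord //; exact: transition_smooth.
Qed.

End MapCalculus.

(** * Metric products and covariant derivatives in charts *)

Section LeviCivita.
Variables (R : realType) (n : nat) (M : manifold R n).
Variables (g : lorentz_metric M) (D : connection M) (hD : levi_civita g D).
Implicit Types (q : M).

Definition coord_image q : set 'rV[R]_n := coord q @` dom q.

Lemma image_open q : open (coord_image q).
Proof. exact: cimg_open. Qed.

Lemma image_coord q x : dom q x -> coord_image q (coord q x).
Proof. by move=> qx; exists x. Qed.

Lemma Gam_smooth_at q k u : coord_image q u -> smooth_at u (Gam D q k).
Proof. exact: (smooth_onP _ (@image_open q)).1 (Gam_smooth D q k) u. Qed.

Lemma gcoef_smooth_at q u : coord_image q u -> smooth_at u (gcoef g q).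
Proof. exact: (smooth_onP _ (@image_open q)).1 (@gcoef_smooth _ _ _ g q) u. Qed.

Lemma chr_Gam_sym q u v w : coord_image q u ->
  chr (Gam D q) u v w = chr (Gam D q) u w v.
Proof. by move=> qu; have [H _] := hD qu; exact: H. Qed.

Lemma dot_gcoef_compat q u v w z : coord_image q u ->
  'd (fun y => dot (gcoef g q) y w z : R) u v =
  dot (gcoef g q) u (chr (Gam D q) u v w) z + dot (gcoef g q) u w (chr (Gam D q) u v z).
Proof. by move=> qu; have [_ H] := hD qu; exact: H. Qed.

Lemma gprod_chart q x v w : dom q x ->
  gprod g x v w = dot (gcoef g q) (coord q x) (tcoord q x v) (tcoord q x w).
Proof.
move=> qx; have xx := dom_self x.
have ov : overlap x q (coord x x) by exists x.
rewrite /gprod (gcoef_transition g ov) transition_coord //.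
have E a : tcoord q x a = a *m jacobian (transition x q) (coord x x) by exact: diff_jacobian.
by rewrite /dot !E !trmx_mul !mulmxA.
Qed.

Lemma gprod_self x v w : gprod g x v w = dot (gcoef g x) (coord x x) v w.
Proof. by []. Qed.

Variables (d : nat) (V : manifold R d) (f : V -> M) (sf : smooth_map f).

Lemma covd_along y (v : 'rV[R]_d) xi :
  covd D f y v xi = along (Gam D (f y)) (frep f y (f y))
    (field_rep f y (f y) xi) (coord y y) v.
Proof.
rewrite /covd /along (frep_coord _ _ (dom_self y)).
rewrite {3}/field_rep (point_coord (dom_self y)) tcoord_self.
by [].
Qed.

(** Covariant differentiation commutes with changes of charts: the inhomogeneous
term in the transformation of the symbols cancels the derivative of the
differential of the transition map. *)
Lemma covd_chart p q y (v : 'rV[R]_d) xi : dom p y -> dom q (f y) ->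
  smooth_at (coord y y) (field_rep f y (f y) xi) ->
  tcoord q (f y) (covd D f y v xi) =
  along (Gam D q) (frep f p q) (field_rep f p q xi) (coord p y) (tcoord p y v).
Proof.
move=> py qy sxi; have yy := dom_self y; have fy := dom_self (f y).
pose c := coord y y; pose psi := transition (f y) q.
pose X := field_rep f y (f y) xi; pose F := frep f y (f y).
have sX : smooth_at c X by [].
have Fc : F c = coord (f y) (f y) by exact: frep_coord.
have Xc : X c = xi y by rewrite /X /field_rep (point_coord yy) tcoord_self.
have spsi : smooth_at (F c) psi by rewrite Fc; exact: transition_smooth.
have sF : smooth_at c F by exact: (frep_smooth sf).
pose Th w := 'd psi (F w) (X w).
have lpsi z : linear (fun b => 'd psi z b) by move=> a u w; rewrite linearP.
have sT b : smooth_at c (fun w => 'd psi (F w) b).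
  exact: (smooth_at_comp sF (smooth_at_diff b spsi)).
have sTh : smooth_at c Th.
  exact: (smooth_lin_family (T := fun w b => 'd psi (F w) b) (fun w => lpsi (F w)) sT sX).
have DTh : 'd Th c v = 'd (fun z => 'd psi z (xi y)) (F c) (tmap f y v) + 'd psi (F c) ('d X c v).
  apply: etrans (diff_lin_family v (T := fun w b => 'd psi (F w) b) (fun w => lpsi (F w))
    (fun b => smooth_at_differentiable (sT b)) (smooth_at_differentiable sX)) _.
  have E0 (a b e : 'rV[R]_n) : a = b -> a + e = b + e by move=> ->.
  apply: E0; rewrite Xc.
  have dd := diff_comp (smooth_at_differentiable sF) (smooth_at_differentiable (smooth_at_diff (xi y) spsi)).
  exact: (f_equal (fun h : 'rV[R]_d -> 'rV[R]_n => h v) dd).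
have st := transition_smooth py yy.
have Et : transition p y (coord p y) = c by exact: transition_coord.
have D1 : 'd (field_rep f p q xi) (coord p y) (tcoord p y v) = 'd Th c v.
  have sTh' : smooth_at (transition p y (coord p y)) Th by rewrite Et.
  have N : \forall u \near coord p y, (Th \o transition p y) u = field_rep f p q xi u.
    exact: (filterS (fun _ e => esym e) (field_rep_near sf xi py yy qy fy)).
  have dd := differentiable_comp (smooth_at_differentiable st) (smooth_at_differentiable sTh').
  apply: etrans (near_eq_diff _ dd N) _.
  apply: etrans (f_equal (fun h : 'rV[R]_d -> 'rV[R]_n => h (tcoord p y v))
    (diff_comp (smooth_at_differentiable st) (smooth_at_differentiable sTh'))) _.
  rewrite /= Et; apply: (f_equal ('d Th c)).
  exact: (tcoordK v py).
have ov : overlap (f y) q (F c) by rewrite Fc; exists (f y).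
have GT := Gam_transition D (tmap f y v) (xi y) ov.
have E1 : field_rep f p q xi (coord p y) = 'd psi (F c) (xi y).
  by rewrite /field_rep (point_coord py) Fc.
have E2 : 'd (frep f p q) (coord p y) (tcoord p y v) = 'd psi (F c) (tmap f y v).
  by rewrite Fc; exact/esym/(tmap_chart sf v py qy).
have E3 : frep f p q (coord p y) = psi (F c).
  by rewrite (frep_coord _ _ py) Fc /psi transition_coord.
have chr3 (a a' b b' e e' x x' : 'rV[R]_n) : x = x' -> a = a' -> b = b' -> e = e' ->
    x + chr (Gam D q) a b e = x' + chr (Gam D q) a' b' e' by move=> -> -> -> ->.
apply/esym; apply: etrans (chr3 _ _ _ _ _ _ _ _ (etrans D1 DTh) E3 E2 E1) _.
have E4 : tcoord q (f y) (covd D f y v xi) = 'd psi (F c) ('d X c v) +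
    'd psi (F c) (christoffel_apply (Gam D) (f y) (F c) (tmap f y v) (xi y)).
  by rewrite Fc /covd /Gamma; exact: linearD.
have assoc (a b e e' w : 'rV[R]_n) : w = b + e' -> e' = a + e -> a + b + e = w.
  by move=> -> ->; rewrite addrAC addrC.
exact: assoc E4 GT.
Qed.

End LeviCivita.

(** * Linear algebra of Lorentzian forms *)

Section LinearAlgebra.
Variable R : realType.

Definition bil n (H : 'M[R]_n) (v w : 'rV[R]_n) : R := (v *m H *m w^T) 0 0.

Lemma bilDl n (H : 'M[R]_n) u v w : bil H (u + v) w = bil H u w + bil H v w.
Proof. by rewrite /bil !mulmxDl mxE. Qed.

Lemma bilZl n (H : 'M[R]_n) a v w : bil H (a *: v) w = a * bil H v w.
Proof. by rewrite /bil -!scalemxAl mxE. Qed.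

Lemma bilC n (H : 'M[R]_n) v w : H^T = H -> bil H v w = bil H w v.
Proof.
move=> Hs; rewrite /bil; have -> : w *m H *m v^T = (v *m H *m w^T)^T.
  by rewrite !trmx_mul trmxK Hs mulmxA.
by rewrite [RHS]mxE.
Qed.

Lemma bilDr n (H : 'M[R]_n) u v w : bil H u (v + w) = bil H u v + bil H u w.
Proof. by rewrite /bil linearD /= mulmxDr mxE. Qed.

Lemma bilZr n (H : 'M[R]_n) a v w : bil H v (a *: w) = a * bil H v w.
Proof. by rewrite /bil linearZ /= -scalemxAr mxE. Qed.

Lemma bil_mul n k (H : 'M[R]_n) (J : 'M[R]_(k, n)) (v w : 'rV[R]_k) :
  bil H (v *m J) (w *m J) = bil (J *m H *m J^T) v w.
Proof. by rewrite /bil trmx_mul !mulmxA. Qed.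

Lemma bil_delta n (H : 'M[R]_n) i j : bil H (delta_mx 0 i) (delta_mx 0 j) = H i j.
Proof. by rewrite /bil -rowE trmx_delta -colE !mxE. Qed.

Lemma bil_eq0 n (H : 'M[R]_n) v : (forall w, bil H v w = 0) -> v *m H = 0.
Proof.
move=> v0; apply/rowP => j; have := v0 (delta_mx 0 j).
by rewrite /bil trmx_delta -colE !mxE.
Qed.

Lemma bil0_of_mul0 n (H : 'M[R]_n) v w : v *m H = 0 -> bil H v w = 0.
Proof. by move=> v0; rewrite /bil v0 mul0mx mxE. Qed.

Definition lorentzian n (H : 'M[R]_n) := exists2 P : 'M[R]_n, P \in unitmx &
  P *m H *m P^T = diag_mx (\row_(i < n) (if i.+1 == n then -1 else 1)).

(** With l the time coordinate in a basis that diagonalizes H, the vector l(a) v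
- l(v) a has no time component, and its square is l(a)^2 times that of v. An
isotropic vector without time component is zero, so l(a) is not zero. *)
Lemma lorentz_isotropic_orth n (H : 'M[R]_n.+1) (a v : 'rV[R]_n.+1) :
  H^T = H -> lorentzian H -> a != 0 -> bil H a a = 0 -> bil H v a = 0 ->
  0 <= bil H v v.
Proof.
move=> Hs [P Pu PH] a0 aa va.
pose l (x : 'rV[R]_n.+1) := (x *m invmx P) 0 ord_max.
have sq (x : 'rV[R]_n.+1) : l x = 0 -> bil H x x = \sum_i (x *m invmx P) 0 i ^+ 2.
  move=> lx; have -> : bil H x x = bil (P *m H *m P^T) (x *m invmx P) (x *m invmx P).
    by rewrite -bil_mul mulmxKV.
  rewrite PH /bil mul_mx_diag mxE; apply: eq_bigr => i _; rewrite !mxE expr2.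
  have [/eqP iE|ni] := boolP (i.+1 == n.+1); last by rewrite mulr1.
  have -> : i = ord_max by apply: val_inj; case: iE.
  by move: lx; rewrite /l mxE => ->; rewrite !(mulr0, mul0r).
have sqge (x : 'rV[R]_n.+1) : l x = 0 -> 0 <= bil H x x.
  by move=> /sq ->; apply: sumr_ge0 => i _; exact: sqr_ge0.
have la : l a != 0.
  apply: contra a0 => /eqP la; have := sq a la; rewrite aa => /esym/eqP.
  rewrite psumr_eq0; last by move=> i _; exact: sqr_ge0.
  move=> /allP a0; have : a *m invmx P = 0.
    apply/rowP => i; have := a0 i (mem_index_enum i).
    by rewrite sqrf_eq0 => /eqP ->; rewrite mxE.
  by move/(congr1 (mulmx^~ P)); rewrite mulmxKV // mul0mx => ->.
have lw : l (l a *: v - l v *: a) = 0.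
  by rewrite /l mulmxBl -!scalemxAl !mxE mulrC subrr.
have := sqge _ lw; rewrite -scaleNr !(bilDl, bilDr, bilZl, bilZr) aa va.
rewrite (bilC _ _ Hs) va !mulr0 !addr0 mulrA -expr2.
by rewrite pmulr_rge0 // exprn_even_gt0.
Qed.

Definition radical_line n (N : 'M[R]_n) :=
  (exists2 k : 'rV[R]_n, k != 0 & k *m N = 0) /\
  forall k k' : 'rV[R]_n, k != 0 -> k *m N = 0 -> k' *m N = 0 ->
    exists c, k' = c *: k.

Lemma radical_line_rank n (N : 'M[R]_n.+1) : \rank N = n -> radical_line N.
Proof.
move=> rN; have rk : \rank (kermx N) = 1%N by rewrite mxrank_ker rN subSnn.
split.
  have : kermx N != 0 by rewrite -mxrank_eq0 rk.
  by move=> /rowV0Pn[k /sub_kermxP kN k0]; exists k.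
move=> k k' k0 /sub_kermxP kN /sub_kermxP k'N.
have : (k :=: kermx N)%MS.
  by apply/eqmxP; rewrite -(geq_leqif (mxrank_leqif_eq kN)) rk rank_rV k0.
by move=> E; move: k'N; rewrite -E => /sub_rVP.
Qed.

Lemma complete_row n (k : 'rV[R]_n.+1) : k != 0 ->
  exists2 K : 'M[R]_n.+1, K \in unitmx & exists2 c, c != 0 & row 0 K = c *: k.
Proof.
move=> k0; exists (row_ebase k); first exact: row_ebase_unit.
have := mulmx_ebase k; rewrite rank_rV k0 => E.
set c := col_ebase k in E.
have cu : c 0 0 != 0.
  have := col_ebase_unit k; rewrite -/c unitmxE unitfE.
  by rewrite det_mx11.
exists (c 0 0)^-1; first by rewrite invr_eq0.
apply/rowP => j; rewrite [LHS]mxE [RHS]mxE.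
have {2}-> : k = c *m (pid_mx true *m row_ebase k) by rewrite mulmxA.
rewrite [X in _ * X]mxE big_ord1 [X in _ * (_ * X)]mxE.
rewrite (bigD1 0) //= big1 => [|i ni]; last first.
  by case: i ni => -[|i] // hi _; rewrite mxE /= mul0r.
by rewrite mxE /= mul1r addr0 mulrA mulVf ?mul1r.
Qed.

Lemma row'_indep n (K : 'M[R]_n.+1) (p : 'rV[R]_n) c : K \in unitmx ->
  p *m row' ord0 K = c *: row ord0 K -> p = 0.
Proof.
move=> Ku pK; have : (row_mx (- c%:M) p : 'rV[R]_(1 + n)) *m K = 0.
  have -> : K = col_mx (row ord0 K) (row' ord0 K) :> 'M[R]_(1 + n, n.+1).
    apply/matrixP => i j; rewrite mxE; case: splitP => k ik; rewrite mxE.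
      by congr (K _ _); apply: val_inj; rewrite /= ik ord1.
    by congr (K _ _); apply: val_inj; rewrite /= ik.
  by rewrite mul_row_col pK mulNmx mul_scalar_mx addNr.
move/(congr1 (mulmx^~ (invmx K))); rewrite mulmxK // mul0mx => E0.
by rewrite -(row_mxKr (- c%:M) p) E0; apply/rowP => j; rewrite !mxE.
Qed.

Lemma row0_neq0 n (K : 'M[R]_n.+1) : K \in unitmx -> row ord0 K != 0.
Proof.
move=> Ku; apply/eqP; rewrite rowE => /(congr1 (mulmx^~ (invmx K))).
rewrite /= mulmxK // mul0mx => /rowP/(_ ord0); rewrite !mxE eqxx => /eqP.
by rewrite oner_eq0.
Qed.

(** A vector of square zero is in the radical: otherwise the square of q - t p
would be negative for large t and a suitable q. *)
Lemma posdef_of_semidef n (G : 'M[R]_n) : G^T = G -> G \in unitmx ->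
  (forall p, 0 <= bil G p p) -> forall p, p != 0 -> 0 < bil G p p.
Proof.
move=> Gs Gu psd p p0; rewrite lt_def psd andbT.
apply: contra p0 => /eqP pp.
suff : p *m G = 0 by move/(congr1 (mulmx^~ (invmx G))); rewrite mulmxK // mul0mx => ->.
apply: bil_eq0 => q; apply/eqP; apply: contraT => pq.
have := psd (q - ((bil G q q + 1) / (2 * bil G p q)) *: p).
rewrite -scaleNr !(bilDl, bilDr, bilZl, bilZr) pp (bilC q p Gs) !mulr0 addr0.
have -> : bil G q q + - ((bil G q q + 1) / (2 * bil G p q)) * bil G p q +
   - ((bil G q q + 1) / (2 * bil G p q)) * bil G p q = -1 by field.
by rewrite lerNr oppr0 ler10.
Qed.

End LinearAlgebra.

(** * Isotropic frames *)

Section FrameAlgebra.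
Variables (R : realType) (m : nat).

Lemma ia_lift (a : 'I_m) : ia a = lift ord_max (lift ord0 a).
Proof. by apply: val_inj; rewrite /= /bump /=; have := ltn_ord a; lia. Qed.

Lemma i1_lift : i1 m = lift ord_max ord0.
Proof. by apply: val_inj; rewrite /= /bump /=. Qed.

Lemma sum_frame (A : nmodType) (F : 'I_m.+2 -> A) :
  \sum_i F i = F (i1 m) + \sum_a F (ia a) + F (inn m).
Proof.
rewrite big_ord_recl big_ord_recr /= addrA; congr (_ + _ + _).
  apply: eq_bigr => a _; congr F; apply: val_inj.
  by rewrite /= /bump /=; have := ltn_ord a; lia.
by congr F; apply: val_inj.
Qed.

Definition screen_mx (E : 'M[R]_m.+2) : 'M[R]_(m, m.+2) :=
  \matrix_(a, j) E (ia a) j.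

Lemma row_screen E a : row a (screen_mx E) = row (ia a) E.
Proof. by apply/rowP => j; rewrite !mxE. Qed.

Lemma mulmx_frame (c : 'rV[R]_m.+2) (E : 'M[R]_m.+2) :
  c *m E = c 0 (i1 m) *: row (i1 m) E + (\row_a c 0 (ia a)) *m screen_mx E +
           c 0 (inn m) *: row (inn m) E.
Proof.
rewrite mulmx_sum_row sum_frame; congr (_ + _ + _).
by rewrite mulmx_sum_row; apply: eq_bigr => a _; rewrite row_screen mxE.
Qed.

Variables (M : manifold R m.+2) (g : lorentz_metric M).
Variables (V : manifold R m.+1) (f : V -> M) (hf : immersion f).
Hypothesis hlight : lightlike g f.

Local Notation H x := (gcoef g (f x) (coord (f x) (f x))).

Lemma gprod_bil x v w : gprod g x v w = bil (gcoef g x (coord x x)) v w.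
Proof. by []. Qed.

Lemma gcoef_self_sym y : (gcoef g y (coord y y))^T = gcoef g y (coord y y).
Proof. by apply: gcoef_sym; exists y; [exact: dom_self|]. Qed.

Lemma gcoef_self_lorentz y : lorentzian (gcoef g y (coord y y)).
Proof. by apply: gcoef_signature; exists y; [exact: dom_self|]. Qed.

Lemma gprodC x v w : gprod g x v w = gprod g x w v.
Proof. exact: bilC (gcoef_self_sym x). Qed.

Lemma screen_gramE x E :
  screen_gram g f x E = screen_mx E *m H x *m (screen_mx E)^T.
Proof.
apply/matrixP => a b; rewrite mxE gprod_bil -!row_screen.
by rewrite -[row a _]mul1mx -bil_delta -bil_mul -!rowE mul1mx.
Qed.

Definition radical x (k : 'rV[R]_m.+1) :=
  forall v, gprod g (f x) (tmap f x k) (tmap f x v) = 0.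

Lemma tmap_mx x v : tmap f x v = v *m lin1_mx (tmap f x).
Proof. by rewrite mul_rV_lin1. Qed.

Lemma radicalP x k : radical x k <->
  k *m (lin1_mx (tmap f x) *m H x *m (lin1_mx (tmap f x))^T) = 0.
Proof.
split=> [rk|k0 v].
  by apply: bil_eq0 => w; rewrite -bil_mul -!tmap_mx; exact: rk.
by rewrite gprod_bil !tmap_mx bil_mul; exact: bil0_of_mul0.
Qed.

Lemma radical_exists x : exists2 k, k != 0 & radical x k.
Proof.
have [[k k0 kN] _] := radical_line_rank (hlight x).
by exists k => //; apply/radicalP.
Qed.

Lemma radical_unique x k k' : k != 0 -> radical x k -> radical x k' ->
  exists c, k' = c *: k.
Proof.
move=> k0 /radicalP rk /radicalP rk'.
by have [_ U] := radical_line_rank (hlight x); exact: U rk'.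
Qed.

Lemma tmap_eq0 x v : tmap f x v = 0 -> v = 0.
Proof. by move=> v0; apply: (hf.2 x); rewrite v0 [RHS]linear0. Qed.

Lemma tangent_span x (K : 'M[R]_m.+1) (E : 'M[R]_m.+2) : K \in unitmx ->
  (forall i, row (lift ord_max i) E = tmap f x (row i K)) ->
  tangent_image f x = <<[seq row (lift ord_max i) E | i <- enum 'I_m.+1]>>%VS.
Proof.
move=> Ku EK; apply/eqP; rewrite eqEsubv; apply/andP; split.
  apply/subvP => w /memv_imgP[v _ ->]; rewrite lfunE /=.
  rewrite -[v in tmap f x v](mulmxKV Ku) mulmx_sum_row.
  rewrite [tmap f x _]linear_sum; apply: memv_suml => i _.
  rewrite linearZ; apply: memvZ; apply: memv_span.
  by apply/mapP; exists i; rewrite ?mem_enum // EK.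
apply/span_subvP => w /mapP[i _ ->]; rewrite EK.
by apply/memv_imgP; exists (row i K); rewrite ?memvf // lfunE.
Qed.

Lemma screen_tmap x (K : 'M[R]_m.+1) (E : 'M[R]_m.+2) p :
  (forall i, row (lift ord_max i) E = tmap f x (row i K)) ->
  p *m screen_mx E = tmap f x (p *m row' ord0 K).
Proof.
move=> EK; have Ea a : row (ia a) E = tmap f x (row (lift ord0 a) K) by rewrite ia_lift.
rewrite !mulmx_sum_row [tmap f x _]linear_sum; apply: eq_bigr => a _.
by rewrite linearZ row_screen Ea; congr (_ *: tmap f x _); apply/rowP => j; rewrite !mxE.
Qed.

(** A combination of the screen vectors that is orthogonal to all of them is
radical, hence proportional to the radical vector of the basis. *)
Lemma screen_gram_unit x (K : 'M[R]_m.+1) (E : 'M[R]_m.+2) :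
  K \in unitmx ->
  (forall i, row (lift ord_max i) E = tmap f x (row i K)) ->
  radical x (row ord0 K) -> screen_gram g f x E \in unitmx.
Proof.
move=> Ku EK rK; have TE p := screen_tmap p EK; have K0 := row0_neq0 Ku.
rewrite -row_free_unit -kermx_eq0; apply/rowV0P => p /sub_kermxP pG.
apply: contraTeq isT => p0.
have rp : radical x (p *m row' ord0 K).
  move=> v; rewrite -TE.
  have -> : v = (v *m invmx K) 0 0 *: row ord0 K + (\row_a (v *m invmx K) 0 (lift ord0 a)) *m row' ord0 K.
    rewrite -{1}(mulmxKV Ku v) [LHS]mulmx_sum_row big_ord_recl; congr (_ + _).
    rewrite [RHS]mulmx_sum_row; apply: eq_bigr => a _.
    rewrite [(\row_b _) 0 a]mxE; congr (_ *: _).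
    by apply/rowP => j; rewrite !mxE.
  have Lt a u w : tmap f x (a *: u + w) = a *: tmap f x u + tmap f x w.
    exact: linearP.
  rewrite Lt -TE gprod_bil bilDr bilZr.
  rewrite (bilC _ _ (gcoef_self_sym _)) TE -gprod_bil rK mulr0 add0r -!TE bil_mul -screen_gramE.
  exact: bil0_of_mul0.
have [c pc] := radical_unique K0 rK rp.
by rewrite (row'_indep Ku pc) eqxx in p0.
Qed.

(** Positivity on the screen and linear independence follow from the signature and
from the radical being a line. *)
Lemma isotropic_frame_intro x (K : 'M[R]_m.+1) (E : 'M[R]_m.+2) :
  K \in unitmx ->
  (forall i, row (lift ord_max i) E = tmap f x (row i K)) ->
  radical x (row ord0 K) ->
  gprod g (f x) (row (inn m) E) (row (inn m) E) = 0 ->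
  gprod g (f x) (row (i1 m) E) (row (inn m) E) = -1 ->
  (forall a, gprod g (f x) (row (ia a) E) (row (inn m) E) = 0) ->
  isotropic_frame g f x E.
Proof.
move=> Ku EK rK nn n1 na.
have E1 : row (i1 m) E = tmap f x (row ord0 K) by rewrite i1_lift.
have Ea a : row (ia a) E = tmap f x (row (lift ord0 a) K) by rewrite ia_lift.
have K0 := row0_neq0 Ku.
have e10 : row (i1 m) E != 0.
  by rewrite E1; apply: contra K0 => /eqP /tmap_eq0 ->.
have e11 : gprod g (f x) (row (i1 m) E) (row (i1 m) E) = 0 by rewrite E1.
have ea1 a : gprod g (f x) (row (ia a) E) (row (i1 m) E) = 0.
  by rewrite gprodC E1 Ea.
have TE p := screen_tmap p EK.
have Gu := screen_gram_unit Ku EK rK.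
have Gs : (screen_gram g f x E)^T = screen_gram g f x E.
  by apply/matrixP => a b; rewrite !mxE gprodC.
have pos p : p != 0 -> 0 < bil (screen_gram g f x E) p p.
  apply: posdef_of_semidef => // q; rewrite screen_gramE -bil_mul.
  apply: lorentz_isotropic_orth (gcoef_self_lorentz _) e10 e11 _.
    exact: gcoef_self_sym.
  by rewrite TE E1 -gprod_bil gprodC.
split => //; last exact: tangent_span Ku EK.
rewrite -row_free_unit -kermx_eq0; apply/rowV0P => c /sub_kermxP cE.
have W w : bil (H x) (c *m E) w = 0 by rewrite cE /bil !mul0mx mxE.
have pa1 (p : 'rV[R]_m) : bil (H x) (p *m screen_mx E) (row (i1 m) E) = 0.
  by rewrite TE E1 -gprod_bil gprodC.
have pan (p : 'rV[R]_m) : bil (H x) (p *m screen_mx E) (row (inn m) E) = 0.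
  rewrite mulmx_sum_row; elim/big_ind: _ => [|u v u0 v0|a _].
  - by rewrite /bil !mul0mx mxE.
  - by rewrite bilDl u0 v0 addr0.
  - by rewrite bilZl row_screen -gprod_bil na mulr0.
have cn : c 0 (inn m) = 0.
  have := W (row (i1 m) E); rewrite mulmx_frame !bilDl !bilZl pa1.
  rewrite (bilC (row (inn m) E) _ (gcoef_self_sym _)) -!gprod_bil e11 n1 mulr0 !add0r.
  by rewrite mulrN1 => /eqP; rewrite oppr_eq0 => /eqP.
have c1 : c 0 (i1 m) = 0.
  have := W (row (inn m) E); rewrite mulmx_frame !bilDl !bilZl pan -!gprod_bil nn n1.
  by rewrite mulr0 !addr0 mulrN1 => /eqP; rewrite oppr_eq0 => /eqP.
move: cE; rewrite mulmx_frame cn c1 !scale0r add0r addr0.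
set p := \row_a _ => pE.
have p0 : p = 0.
  apply/eqP; apply: contraT => /pos; rewrite screen_gramE -bil_mul pE /bil !mul0mx mxE.
  by rewrite ltxx.
apply/rowP => i; rewrite [RHS]mxE.
have [->//|i1N] := eqVneq i (i1 m); have [->//|inN] := eqVneq i (inn m).
have [a ->] : exists a, i = ia a.
  have i0 : (0 < i)%N by rewrite lt0n; apply: contra i1N => /eqP i0; apply/eqP/val_inj.
  have im : (i.-1 < m)%N.
    have := ltn_ord i; have : (i : nat) != m.+1.
      by apply: contra inN => /eqP E'; apply/eqP/val_inj.
    by lia.
  exists (Ordinal im); apply: val_inj; rewrite /= /bump /=; lia.
by have := congr1 (fun q : 'rV_m => q 0 a) p0; rewrite !mxE.
Qed.

End FrameAlgebra.

Section LiftField.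
Variables (R : realType) (d n : nat) (V : manifold R d) (M : manifold R n).
Variables (f : V -> M) (sf : smooth_map f).

Lemma tback_field_rep (x : V) (q : M) (h : 'rV[R]_d -> 'rV[R]_n) y :
  dom x y -> dom q (f y) ->
  \forall u \near coord x y,
    field_rep f x q (fun y => tback q (f y) (h (coord x y))) u = h u.
Proof.
move=> xy qy.
apply: filterS2 (near_dom xy xy) (near_point xy (f_near_dom sf qy)) => u [_ _ xu] qu.
by rewrite /field_rep tbackK // xu.
Qed.

Lemma smooth_field_tback (x : V) (q : M) (h : 'rV[R]_d -> 'rV[R]_n) (W : set V) :
  open W -> (forall y, W y -> dom x y /\ dom q (f y)) ->
  (forall y, W y -> smooth_at (coord x y) h) ->
  smooth_field f W (fun y => tback q (f y) (h (coord x y))).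
Proof.
move=> oW WD sh; apply/(smooth_fieldP sf _ oW) => y p q' Wy py qy.
have [xy qqy] := WD y Wy.
apply: (field_rep_change sf py xy qy qqy).
apply: smooth_at_ext (sh y Wy).
exact: (filterS (fun _ e => esym e) (tback_field_rep h xy qqy)).
Qed.

Lemma tmap_tback (x y : V) (q : M) k : dom x y -> dom q (f y) ->
  tmap f y (tback x y k) = tback q (f y) ('d (frep f x q) (coord x y) k).
Proof.
move=> xy qy; apply: (tcoord_inj qy); rewrite tbackK //.
have := tmap_chart sf (tback x y k) xy qy; rewrite tbackK //.
Qed.

End LiftField.

Lemma tback_jacobian (R : realType) n (M : manifold R n) (p x : M) k :
  tback p x k = k *m jacobian (transition p x) (coord p x).
Proof. exact: diff_jacobian. Qed.

Lemma jacobian_transition_unit (R : realType) n (M : manifold R n) (p x : M) :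
  dom p x -> jacobian (transition p x) (coord p x) \in unitmx.
Proof.
move=> px.
have E : jacobian (transition p x) (coord p x) *m jacobian (transition x p) (coord x x) = 1%:M.
  apply/row_matrixP => i; rewrite row1 rowE mulmxA -!diff_jacobian.
  exact: (tbackK (delta_mx 0 i) px).
exact: (proj1 (mulmx1_unit E)).
Qed.

Section NullDual.
Variable R : realType.

(** The null vector dual to e and orthogonal to the rows of T: normalize z
against e, project it off the span of T, and correct its square along e. *)
Definition null_dual n k (H : 'M[R]_n) (e : 'rV[R]_n) (T : 'M[R]_(k, n)) (z : 'rV[R]_n) :=
  let z1 := - (bil H z e)^-1 *: z in
  let z2 := z1 - z1 *m H *m T^T *m invmx (T *m H *m T^T) *m T in
  z2 + (2^-1 * bil H z2 z2) *: e.

Lemma null_dualP n k (H : 'M[R]_n) (e : 'rV[R]_n) (T : 'M[R]_(k, n)) (z : 'rV[R]_n) :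
  H^T = H -> bil H z e != 0 -> bil H e e = 0 -> (forall p, bil H (p *m T) e = 0) ->
  T *m H *m T^T \in unitmx ->
  let n := null_dual H e T z in
  [/\ bil H n n = 0, bil H e n = -1 & forall p, bil H (p *m T) n = 0].
Proof.
move=> Hs ze ee Te Gu; rewrite /null_dual.
set z1 := - _ *: z; set z2 := z1 - _.
have z1e : bil H z1 e = -1 by rewrite /z1 bilZl mulNr mulVf.
have z2e : bil H z2 e = -1.
  by rewrite /z2 -[- (_ *m T)]mulNmx bilDl Te addr0.
have z2T p : bil H (p *m T) z2 = 0.
  rewrite bilC // /bil /z2 trmx_mul mulmxA !mulmxBl.
  have E (w : 'rV[R]_k) : w *m invmx (T *m H *m T^T) *m T *m H *m T^T = w.
    by rewrite -(mulmxA (w *m _) T) -(mulmxA (w *m _) (T *m H)) mulmxKV.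
  by rewrite E subrr mxE.
have ez2 : bil H e z2 = -1 by rewrite bilC.
clearbody z2; split; last by move=> p; rewrite bilDr bilZr z2T Te mulr0 addr0.
  rewrite !(bilDl, bilDr, bilZl, bilZr) ez2 z2e ee !mulr0 addr0 !mulrN1.
  by field.
by rewrite bilDr bilZr ez2 ee mulr0 addr0.
Qed.

Lemma smooth_at_bil (A : normedModType R) n x (H : A -> 'M[R]_n) (v w : A -> 'rV[R]_n) :
  smooth_at x H -> smooth_at x v -> smooth_at x w ->
  smooth_at x (fun y => bil (H y) (v y) (w y) : R).
Proof.
move=> sH sv sw; have : smooth_at x (fun y => v y *m H y *m (w y)^T).
  by apply: smooth_at_mulmx; [exact: smooth_at_mulmx|exact: smooth_at_trmx].
by move/smooth_at_mxP => /(_ 0 0).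
Qed.

Lemma smooth_null_dual (A : normedModType R) n k x (H : A -> 'M[R]_n) (e : A -> 'rV[R]_n)
    (T : A -> 'M[R]_(k, n)) (z : 'rV[R]_n) :
  smooth_at x H -> smooth_at x e -> smooth_at x T ->
  bil (H x) z (e x) != 0 -> T x *m H x *m (T x)^T \in unitmx ->
  smooth_at x (fun y => null_dual (H y) (e y) (T y) z).
Proof.
move=> sH se sT ze Gu; rewrite /null_dual.
have sz1 : smooth_at x (fun y => - (bil (H y) z (e y))^-1 *: z).
  apply: smooth_atZ; last exact: smooth_at_cst.
  apply: smooth_atN; apply: smooth_atV => //.
  by apply: smooth_at_bil => //; exact: smooth_at_cst.
have sG : smooth_at x (fun y => T y *m H y *m (T y)^T).
  by apply: smooth_at_mulmx; [exact: smooth_at_mulmx|exact: smooth_at_trmx].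
have sz2 : smooth_at x (fun y => let z1 := - (bil (H y) z (e y))^-1 *: z in
   z1 - z1 *m H y *m (T y)^T *m invmx (T y *m H y *m (T y)^T) *m T y).
  apply: smooth_atB => //; apply: smooth_at_mulmx => //.
  apply: smooth_at_mulmx; last exact: smooth_at_invmx.
  by apply: smooth_at_mulmx; [exact: smooth_at_mulmx|exact: smooth_at_trmx].
apply: smooth_atD => //; apply: smooth_atZ => //.
by apply: smooth_atM; [exact: smooth_at_cst|exact: smooth_at_bil].
Qed.

End NullDual.

Section FrameExistence.
Variables (R : realType) (m : nat).
Variables (M : manifold R m.+2) (g : lorentz_metric M).
Variables (V : manifold R m.+1) (f : V -> M) (hf : immersion f).
Hypothesis hlight : lightlike g f.

Definition top_row (k : 'rV[R]_m.+1) (K : 'M[R]_m.+1) : 'M[R]_m.+1 :=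
  \matrix_(i, j) if i == ord0 then k 0 j else K i j.

Lemma row_top_row0 k K : row ord0 (top_row k K) = k.
Proof. by apply/rowP => j; rewrite !mxE eqxx. Qed.

Lemma row'_top_row k K : row' ord0 (top_row k K) = row' ord0 K.
Proof. by apply/matrixP => i j; rewrite !mxE. Qed.

Lemma mulmx_top (c : 'rV[R]_m.+1) (K : 'M[R]_m.+1) :
  c *m K = c 0 ord0 *: row ord0 K + (\row_a c 0 (lift ord0 a)) *m row' ord0 K.
Proof.
rewrite [LHS]mulmx_sum_row big_ord_recl; congr (_ + _).
rewrite [RHS]mulmx_sum_row; apply: eq_bigr => a _.
rewrite [(\row_b _) 0 a]mxE; congr (_ *: _).
by apply/rowP => j; rewrite !mxE.
Qed.

Definition frame_of (K : 'M[R]_m.+1) (J : 'M[R]_(m.+1, m.+2)) (e : 'rV[R]_m.+2) :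
    'M[R]_m.+2 :=
  \matrix_(i, j) if unlift ord_max i is Some k then (K *m J) k j else e 0 j.

Lemma row_frame_of_tangent K J e i :
  row (lift ord_max i) (frame_of K J e) = row i K *m J.
Proof. by rewrite -row_mul; apply/rowP => j; rewrite !mxE liftK mxE. Qed.

Lemma row_frame_of_last K J e : row (inn m) (frame_of K J e) = e.
Proof. by apply/rowP => j; rewrite !mxE unlift_none. Qed.

Lemma nonzero_pairing n (H : 'M[R]_n) (e : 'rV[R]_n) : H^T = H -> lorentzian H ->
  e != 0 -> exists z, bil H z e != 0.
Proof.
move=> Hs [P Pu PH] e0; apply: contrapT => nz.
have ze z : bil H e z = 0.
  by rewrite bilC //; apply/eqP; apply: contrapT => /negP zn; apply: nz; exists z.
have eH := bil_eq0 ze.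
have Hu : H \in unitmx.
  have : P *m H *m P^T \in unitmx.
    rewrite PH unitmxE det_diag unitfE; apply/prodf_neq0 => i _; rewrite mxE.
    by case: ifP; rewrite ?oppr_eq0 oner_eq0.
  by rewrite !unitmx_mul => /andP[/andP[]].
move/negP: e0; apply; apply/eqP.
by have := congr1 (mulmx^~ (invmx H)) eH; rewrite /= mulmxK // mul0mx.
Qed.

(** The radical is a line at every point, so the Schur complement of an
invertible block of the induced Gram matrix vanishes identically; this writes
the radical direction, hence a frame, as a rational expression of the
coefficients of the metric. *)
Lemma frame_field_exists (x0 : V) : exists (W : set V) (E : V -> 'M[R]_m.+2),
  isotropic_frame_field g f W E /\ W x0.
Proof.
have sf := hf.1.
pose q0 := f x0; pose F := frep f x0 q0; pose c := coord x0 x0.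
have xx := dom_self x0; have qq := dom_self q0.
pose H u := gcoef g q0 (F u); pose J u := jacobian F u.
pose Nm u := J u *m H u *m (J u)^T.
have Nform y a b : dom x0 y -> dom q0 (f y) ->
    bil (Nm (coord x0 y)) a b = gprod g (f y) (tmap f y (tback x0 y a)) (tmap f y (tback x0 y b)).
  move=> xy qy; rewrite (gprod_chart _ _ _ qy) /Nm -bil_mul -!diff_jacobian.
  rewrite !(tmap_tback sf _ xy qy) !tbackK //.
  by rewrite /H /F (frep_coord _ _ xy).
have Nrad y : dom x0 y -> dom q0 (f y) ->
    (exists2 k : 'rV[R]_m.+1, k != 0 & k *m Nm (coord x0 y) = 0) /\
    forall k k' : 'rV[R]_m.+1, k != 0 -> k *m Nm (coord x0 y) = 0 -> k' *m Nm (coord x0 y) = 0 ->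
      exists c, k' = c *: k.
  move=> xy qy.
  have radE k : radical g f y (tback x0 y k) <-> k *m Nm (coord x0 y) = 0.
    split=> [rk|k0 v].
      by apply: bil_eq0 => w; rewrite Nform.
    have := Nform y k (tcoord x0 y v) xy qy; rewrite tcoordK // => <-.
    exact: bil0_of_mul0.
  have tb0 k : k != 0 -> tback x0 y k != 0.
    apply: contra => /eqP k0; rewrite -(tbackK k xy) k0; apply/eqP; exact: linear0.
  split.
    have [k k0 rk] := radical_exists hlight y.
    exists (tcoord x0 y k); last by apply/radE; rewrite tcoordK.
    apply: contra k0 => /eqP k0; rewrite -(tcoordK k xy) k0; apply/eqP; exact: linear0.
  move=> k k' k0 /radE rk /radE rk'.
  have [a ka] := radical_unique hlight (tb0 k k0) rk rk'.
  exists a; rewrite -(tbackK k' xy) ka -[in RHS](tbackK k xy); exact: linearZ.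
have Fc : F c = coord q0 q0 by exact: frep_coord.
have [[k1 k10 k1N] _] := Nrad x0 xx qq.
have [K0 K0u [a0 a00 K0r]] := complete_row k10.
pose k0 := row ord0 K0; pose T0 := row' ord0 K0.
have k0N : k0 *m Nm c = 0 by rewrite /k0 K0r -scalemxAl k1N scaler0.
have k00 : k0 != 0 by rewrite /k0 K0r scaler_eq0 negb_or a00.
pose G u := T0 *m Nm u *m T0^T.
pose kk u := k0 - k0 *m Nm u *m T0^T *m invmx (G u) *m T0.
pose K u := top_row (kk u) K0.
pose e1 u := kk u *m J u; pose T u := T0 *m J u.
have GE u : G u = T u *m H u *m (T u)^T.
  by rewrite /G /T /Nm trmx_mul !mulmxA.
have kkc : kk c = k0 by rewrite /kk k0N !mul0mx subr0.
have Kc : K c = K0.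
  by apply/matrixP => i j; rewrite mxE kkc; case: eqP => [->|//]; rewrite mxE.
have K_row0 u : row ord0 (K u) = kk u by exact: row_top_row0.
have K_row' u : row' ord0 (K u) = T0 by exact: row'_top_row.
have decomp u (v : 'rV[R]_m.+1) : K u \in unitmx -> exists a p, v = a *: kk u + p *m T0.
  move=> Ku; exists ((v *m invmx (K u)) 0 ord0), (\row_a (v *m invmx (K u)) 0 (lift ord0 a)).
  apply: etrans (etrans (esym (mulmxKV Ku v)) (mulmx_top _ _)) _.
  by rewrite K_row0 K_row'.
have Nsym y : dom x0 y -> dom q0 (f y) -> (Nm (coord x0 y))^T = Nm (coord x0 y).
  move=> xy qy; have HH : (H (coord x0 y))^T = H (coord x0 y).
    by apply: gcoef_sym; rewrite /F (frep_coord _ _ xy); exists (f y).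
  by rewrite /Nm !trmx_mul trmxK HH mulmxA.
(* uniqueness of the radical makes the block G invertible at the center *)
have Gc : G c \in unitmx.
  rewrite -row_free_unit -kermx_eq0; apply/rowV0P => p /sub_kermxP pG.
  have pN : (p *m T0) *m Nm c = 0.
    apply: bil_eq0 => w; have [a [q ->]] : exists a q, w = a *: k0 + q *m T0.
      by rewrite -kkc; apply: decomp; rewrite Kc.
    rewrite bilDr bilZr (bilC (p *m T0) k0 (Nsym _ xx qq)) (bil0_of_mul0 _ k0N) mulr0 add0r.
    by rewrite bil_mul -/(G c); exact: bil0_of_mul0.
  have [_ uniq] := Nrad x0 xx qq.
  have [a pa] := uniq _ _ k00 k0N pN.
  have rel : (\row_i (if unlift ord0 i is Some j then p 0 j else - a)) *m K0 = 0.
    rewrite mulmx_top mxE unlift_none -/k0 -/T0 scaleNr -pa; apply/eqP.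
    rewrite addrC subr_eq0; apply/eqP; congr (_ *m _); apply/rowP => j.
    by rewrite !mxE liftK.
  have := congr1 (mulmx^~ (invmx K0)) rel; rewrite /= mulmxK // mul0mx => r0.
  apply/rowP => j; have := congr1 (fun r : 'rV_m.+1 => r 0 (lift ord0 j)) r0.
  by rewrite !mxE liftK.
have kkN y : dom x0 y -> dom q0 (f y) -> K (coord x0 y) \in unitmx ->
    G (coord x0 y) \in unitmx -> kk (coord x0 y) *m Nm (coord x0 y) = 0.
  move=> xy qy Ku Gu; have [[k kn0 kN] _] := Nrad y xy qy.
  have [a [p kE]] := decomp _ k Ku.
  have kT : kk (coord x0 y) *m Nm (coord x0 y) *m T0^T = 0.
    rewrite /kk !mulmxBl.
    have E (w : 'rV[R]_m) : w *m invmx (G (coord x0 y)) *m T0 *m Nm (coord x0 y) *m T0^T = w.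
      by rewrite -(mulmxA (w *m _) T0) -(mulmxA (w *m _) (T0 *m _)) mulmxKV.
    by rewrite E subrr.
  have p0 : p = 0.
    have : p *m G (coord x0 y) = 0.
      have := congr1 (mulmx^~ T0^T) kN.
      rewrite /= kE mul0mx !mulmxDl -!scalemxAl kT scaler0 add0r => <-.
      by rewrite /G !mulmxA.
    by move/(congr1 (mulmx^~ (invmx (G (coord x0 y))))); rewrite /= mulmxK // mul0mx.
  move: kE; rewrite p0 mul0mx addr0 => kE.
  have a1 : a != 0 by apply: contra kn0 => /eqP a0'; rewrite kE a0' scale0r.
  by apply: (scalerI a1); rewrite scaler0 scalemxAl -kE.
have sF y : dom x0 y -> dom q0 (f y) -> smooth_at (coord x0 y) F.
  by move=> xy qy; exact: frep_smooth.
have sH y : dom x0 y -> dom q0 (f y) -> smooth_at (coord x0 y) H.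
  move=> xy qy; apply: (smooth_at_comp (sF y xy qy)).
  by apply: gcoef_smooth_at; rewrite /F (frep_coord _ _ xy); exact: image_coord.
have sJ y : dom x0 y -> dom q0 (f y) -> smooth_at (coord x0 y) J.
  by move=> xy qy; exact: smooth_at_jacobian (sF y xy qy).
have sN y : dom x0 y -> dom q0 (f y) -> smooth_at (coord x0 y) Nm.
  move=> xy qy; apply: smooth_at_mulmx; last exact: smooth_at_trmx (sJ y xy qy).
  by apply: smooth_at_mulmx; [exact: sJ|exact: sH].
have sG y : dom x0 y -> dom q0 (f y) -> smooth_at (coord x0 y) G.
  move=> xy qy; apply: smooth_at_mulmx; last exact: smooth_at_cst.
  by apply: smooth_at_mulmx; [exact: smooth_at_cst|exact: sN].
have skk y : dom x0 y -> dom q0 (f y) -> G (coord x0 y) \in unitmx ->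
    smooth_at (coord x0 y) kk.
  move=> xy qy Gu; apply: smooth_atB; first exact: smooth_at_cst.
  apply: smooth_at_mulmx; last exact: smooth_at_cst.
  apply: smooth_at_mulmx; last exact: smooth_at_invmx (sG y xy qy).
  apply: smooth_at_mulmx; last exact: smooth_at_cst.
  by apply: smooth_at_mulmx; [exact: smooth_at_cst|exact: sN].
have sK y : dom x0 y -> dom q0 (f y) -> G (coord x0 y) \in unitmx ->
    smooth_at (coord x0 y) K.
  move=> xy qy Gu; apply/smooth_at_mxP => i j.
  apply: (@smooth_at_eq _ _ _ _ (fun u => if i == ord0 then kk u 0 j else K0 i j)).
    by move=> u; rewrite [RHS]mxE.
  case: eqP => _; last exact: smooth_at_cst.
  by move/smooth_at_mxP: (skk y xy qy Gu).
have se1 y : dom x0 y -> dom q0 (f y) -> G (coord x0 y) \in unitmx ->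
    smooth_at (coord x0 y) e1.
  by move=> xy qy Gu; apply: smooth_at_mulmx; [exact: skk|exact: sJ].
have sT y : dom x0 y -> dom q0 (f y) -> smooth_at (coord x0 y) T.
  by move=> xy qy; apply: smooth_at_mulmx; [exact: smooth_at_cst|exact: sJ].
have e1c : e1 c != 0.
  apply: contra k00 => /eqP; rewrite /e1 kkc -diff_jacobian => e0.
  apply/eqP; apply: (tmap_eq0 hf (x := x0)).
  by [].
have [z zc] : exists z, bil (H c) z (e1 c) != 0.
  apply: nonzero_pairing => //; rewrite /H Fc.
    exact: gcoef_self_sym.
  exact: gcoef_self_lorentz.
pose e u := null_dual (H u) (e1 u) (T u) z.
pose Eh u := frame_of (K u) (J u) (e u).
pose good u := [/\ K u \in unitmx, G u \in unitmx & bil (H u) z (e1 u) != 0].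
have goodc : \forall u \near c, good u.
  have N1 := smooth_at_unitmx (sK x0 xx qq Gc) (etrans (congr1 _ Kc) K0u).
  have N2 := smooth_at_unitmx (sG x0 xx qq) Gc.
  have sb := smooth_at_bil (sH x0 xx qq) (@smooth_at_cst _ _ _ c z) (se1 x0 xx qq Gc).
  have N3 : \forall u \near c, bil (H u) z (e1 u) != 0 := smooth_at_neq0 sb zc.
  by apply: filterS3 N1 N2 N3 => u.
pose A := [set y | [/\ dom x0 y, dom q0 (f y) & good (coord x0 y)]].
have AW y : A° y -> [/\ dom x0 y, dom q0 (f y) & good (coord x0 y)].
  by move/interior_subset.
have sEh y : A° y -> smooth_at (coord x0 y) Eh.
  move=> /AW[xy qy [Ku Gu bz]]; apply/smooth_at_mxP => i j.
  apply: (@smooth_at_eq _ _ _ _ (fun u => if unlift ord_max i is Some k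
       then (K u *m J u) k j else e u 0 j)).
    by move=> u; rewrite [RHS]mxE.
  case: unlift => [k|].
    have : smooth_at (coord x0 y) (fun u => K u *m J u).
      by apply: smooth_at_mulmx; [exact: sK|exact: sJ].
    by move/smooth_at_mxP.
  have : smooth_at (coord x0 y) e.
    by apply: smooth_null_dual; rewrite -?GE //; [exact: sH|exact: se1|exact: sT].
  by move/smooth_at_mxP.
pose E y : 'M[R]_m.+2 := \matrix_(i, j) tback q0 (f y) (row i (Eh (coord x0 y))) 0 j.
have rowEy i y : row i (E y) = tback q0 (f y) (row i (Eh (coord x0 y))).
  by apply/rowP => j; rewrite !mxE.
exists A°, E; split; last first.
  have N1 := open_nbhs_nbhs (conj (dom_open x0) xx).
  have N2 := f_near_dom sf qq.
  have N3 : nbhs x0 (coord x0 @^-1` good).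
    exact: (near_coord xx goodc).
  by apply: filterS3 N1 N2 N3 => y.
split; first exact: open_interior.
  move=> i; have -> : (fun y => row i (E y)) =
      (fun y => tback q0 (f y) (row i (Eh (coord x0 y)))).
    by apply: funext => y; exact: rowEy.
  apply: (@smooth_field_tback _ _ _ _ _ _ sf x0 q0 (fun u => row i (Eh u))).
  - exact: open_interior.
  - by move=> y /AW[].
  - by move=> y /sEh; exact: smooth_at_row.
move=> y /AW[xy qy [Ku Gu bz]].
pose u := coord x0 y; have Fu : F u = coord q0 (f y) by exact: frep_coord.
have gE a b : gprod g (f y) (tback q0 (f y) a) (tback q0 (f y) b) = bil (H u) a b.
  by rewrite (gprod_chart _ _ _ qy) !tbackK // /H Fu.
have kN := kkN y xy qy Ku Gu.
have Hs : (H u)^T = H u by apply: gcoef_sym; rewrite Fu; exists (f y).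
have e1J v : bil (H u) (e1 u) (v *m J u) = 0 by rewrite /e1 bil_mul; exact: bil0_of_mul0.
have [|||||nn n1 nT] := @null_dualP R _ _ (H u) (e1 u) (T u) z.
- exact: Hs.
- exact: bz.
- exact: e1J.
- by move=> p; rewrite bilC // mulmxA; exact: e1J.
- by rewrite -GE.
have rowT i : row (lift ord_max i) (Eh u) = row i (K u) *m J u by exact: row_frame_of_tangent.
have Ee1 : row (i1 m) (Eh u) = e1 u by rewrite i1_lift rowT K_row0.
have Een : row (inn m) (Eh u) = e u by exact: row_frame_of_last.
apply: (@isotropic_frame_intro _ _ _ _ _ _ hf hlight y
   (K u *m jacobian (transition x0 y) u)).
- by rewrite unitmx_mul Ku; exact: jacobian_transition_unit.
- move=> i; rewrite rowEy rowT row_mul -tback_jacobian (tmap_tback sf _ xy qy).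
  by rewrite diff_jacobian.
- move=> v; rewrite row_mul K_row0 -tback_jacobian -(tcoordK v xy) -(Nform _ _ _ xy qy).
  exact: bil0_of_mul0.
- by rewrite rowEy gE Een.
- by rewrite !rowEy gE Een Ee1.
- move=> a; rewrite !rowEy gE Een ia_lift rowT.
  have -> : row (lift ord0 a) (K u) = delta_mx 0 a *m T0.
    by rewrite -rowE -(K_row' u); apply/rowP => j; rewrite !mxE.
  by rewrite -mulmxA; exact: nT.
Qed.

(** The null vector dual to the radical one and orthogonal to the others completes
the basis. *)
Lemma isotropic_frame_of_basis x (K : 'M[R]_m.+1) : K \in unitmx ->
  radical g f x (row ord0 K) -> exists E, isotropic_frame g f x E /\
    forall i, row (lift ord_max i) E = tmap f x (row i K).
Proof.
move=> Ku rK; pose J := lin1_mx (tmap f x); pose H := gcoef g (f x) (coord (f x) (f x)).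
pose E0 := frame_of K J 0; pose T := screen_mx E0.
have rowK e i : row (lift ord_max i) (frame_of K J e) = tmap f x (row i K).
  by rewrite row_frame_of_tangent tmap_mx.
have TE p : p *m T = tmap f x (p *m row' ord0 K) := screen_tmap p (rowK 0).
pose e1 := tmap f x (row ord0 K).
have e10 : e1 != 0 by apply: contra (row0_neq0 Ku) => /eqP /(tmap_eq0 hf) ->.
have Hs : H^T = H := gcoef_self_sym g (f x).
have [z ze] := nonzero_pairing Hs (gcoef_self_lorentz g (f x)) e10.
have [|||n0 n1 nT] := @null_dualP R _ _ H e1 T z Hs ze.
- exact: rK.
- by move=> p; rewrite bilC // TE; exact: rK.
- by rewrite -screen_gramE; exact: screen_gram_unit Ku (rowK 0) rK.
exists (frame_of K J (null_dual H e1 T z)); split; last exact: rowK.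
apply: (@isotropic_frame_intro _ _ _ _ _ _ hf hlight x K) => //.
- by rewrite row_frame_of_last.
- by rewrite row_frame_of_last i1_lift rowK.
- move=> a; rewrite row_frame_of_last.
  have -> : row (ia a) (frame_of K J (null_dual H e1 T z)) = delta_mx 0 a *m T.
    by rewrite -rowE row_screen !ia_lift !rowK.
  exact: nT.
Qed.

End FrameExistence.

Lemma span_ind (R : fieldType) (A : vectType R) (P : A -> Prop) (X : seq A) v :
  P 0 -> (forall a x y, P x -> P y -> P (a *: x + y)) ->
  (forall x, x \in X -> P x) -> v \in <<X>>%VS -> P v.
Proof.
move=> P0 PL PX; elim: X PX v => [|x X IH] PX v.
  by rewrite span_nil memv0 => /eqP ->.
rewrite span_cons => /memv_addP[_ /vlineP[a ->] [w wX ->]].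
apply: PL; first by apply: PX; rewrite mem_head.
by apply: IH wX => y yX; apply: PX; rewrite in_cons yX orbT.
Qed.

Section IsotropicFrames.
Variables (R : realType) (m : nat).
Variables (M : manifold R m.+2) (g : lorentz_metric M).
Variables (V : manifold R m.+1) (f : V -> M).

Section AtPoint.
Variables (x : V) (E : 'M[R]_m.+2) (iE : isotropic_frame g f x E).

Lemma e1_orth w : gprod g (f x) (row (i1 m) E) (tmap f x w) = 0.
Proof.
have : tmap f x w \in tangent_image f x.
  by apply/memv_imgP; exists w; rewrite ?memvf // lfunE.
rewrite (frame_tangent iE).
apply: (span_ind (P := fun u => gprod g (f x) (row (i1 m) E) u = 0)).
- by rewrite gprod_bil /bil trmx0 mulmx0 mxE.
- by move=> a u v; rewrite !gprod_bil bilDr bilZr => -> ->; rewrite mulr0 addr0.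
move=> u /mapP[i _ ->]; rewrite gprodC.
have [->|i0] := eqVneq i ord0; first by rewrite -i1_lift (frame_e1_isotropic iE).
have [a ->] : exists a, i = lift ord0 a.
  by case: (unliftP ord0 i) i0 => [a -> _|->]; [exists a|rewrite eqxx].
by rewrite -ia_lift (frame_ea_e1 iE).
Qed.

Lemma gprod_frame X w : gprod g (f x) X w =
  (X *m invmx E) 0 (i1 m) * gprod g (f x) (row (i1 m) E) w +
  \sum_a (X *m invmx E) 0 (ia a) * gprod g (f x) (row (ia a) E) w +
  (X *m invmx E) 0 (inn m) * gprod g (f x) (row (inn m) E) w.
Proof.
have XE : X = (X *m invmx E) *m E by rewrite mulmxKV // (frame_basis iE).
rewrite {1}XE mulmx_frame !gprod_bil !bilDl !bilZl; congr (_ + _ + _).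
rewrite mulmx_sum_row; set c := X *m invmx E.
elim/big_rec2: _ => [|a y1 y2 _ E12]; first by rewrite /bil !mul0mx mxE.
by rewrite bilDl bilZl E12 row_screen mxE gprod_bil.
Qed.

Lemma gprod_en X : gprod g (f x) X (row (inn m) E) = - (X *m invmx E) 0 (i1 m).
Proof.
rewrite gprod_frame (frame_e1_en iE) (frame_en_isotropic iE) big1 => [|a _].
  by rewrite mulr0 !addr0 mulrN1.
by rewrite (frame_ea_en iE) mulr0.
Qed.

Lemma gprod_e1 X : gprod g (f x) X (row (i1 m) E) = - (X *m invmx E) 0 (inn m).
Proof.
rewrite gprod_frame (frame_e1_isotropic iE) (gprodC _ _ (row (inn m) E)) (frame_e1_en iE).
rewrite big1 => [|a _]; first by rewrite mulr0 !add0r mulrN1.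
by rewrite (frame_ea_e1 iE) mulr0.
Qed.

Lemma gprod_ea X b : gprod g (f x) X (row (ia b) E) =
  \sum_a screen_gram g f x E b a * (X *m invmx E) 0 (ia a).
Proof.
rewrite gprod_frame (gprodC _ _ (row (i1 m) E)) (frame_ea_e1 iE).
rewrite (gprodC _ _ (row (inn m) E)) (frame_ea_en iE) !mulr0 addr0 add0r.
by apply: eq_bigr => a _; rewrite mulrC [screen_gram _ _ _ _ b a]mxE gprodC.
Qed.

Lemma frame_preimage i : exists w, tmap f x w = row (lift ord_max i) E.
Proof.
have : row (lift ord_max i) E \in tangent_image f x.
  rewrite (frame_tangent iE); apply: memv_span; apply/mapP; exists i => //.
  by rewrite mem_enum.
by move=> /memv_imgP[w _ ->]; exists w; rewrite lfunE.
Qed.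

Lemma e1_preimage : exists w, tmap f x w = row (i1 m) E.
Proof. by have [w wE] := frame_preimage ord0; exists w; rewrite i1_lift. Qed.

Lemma ea_preimage a : exists w, tmap f x w = row (ia a) E.
Proof. by have [w wE] := frame_preimage (lift ord0 a); exists w; rewrite ia_lift. Qed.

(** The components along e_n and e_a vanish by pairing with e_1 and with the
e_a, so T_xV has only the isotropic direction as orthogonal complement. *)
Lemma orth_tangent X : (forall w, gprod g (f x) X (tmap f x w) = 0) ->
  X = - gprod g (f x) X (row (inn m) E) *: row (i1 m) E.
Proof.
move=> X0; pose p : 'rV[R]_m := \row_a (X *m invmx E) 0 (ia a).
have X1 : (X *m invmx E) 0 (inn m) = 0.
  apply/eqP; rewrite -oppr_eq0 -gprod_e1; apply/eqP.
  by have [w <-] := e1_preimage; exact: X0.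
have p0 : p = 0.
  apply/eqP; apply: contraT => /(frame_posdef iE); rewrite -/(bil _ _ _).
  suff Gp : p *m screen_gram g f x E = 0 by rewrite (bil0_of_mul0 _ Gp) ltxx.
  apply/rowP => b; rewrite [RHS]mxE; have [w wb] := ea_preimage b.
  have := X0 w; rewrite wb gprod_ea => <-; rewrite mxE.
  apply: eq_bigr => a _; rewrite mulrC [p 0 a]mxE; congr (_ * _).
  by rewrite !mxE gprodC.
have XE : X = (X *m invmx E) *m E by rewrite mulmxKV // (frame_basis iE).
by rewrite gprod_en opprK {1}XE mulmx_frame X1 -/p p0 mul0mx scale0r !addr0.
Qed.

Lemma e1_neq0 : row (i1 m) E != 0.
Proof.
apply/eqP => e0; have := frame_e1_en iE.
by rewrite e0 gprod_bil /bil !mul0mx mxE => /eqP; rewrite eq_sym oppr_eq0 oner_eq0.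
Qed.

Lemma ea_pos a : 0 < gprod g (f x) (row (ia a) E) (row (ia a) E).
Proof.
have := frame_posdef iE (p := delta_mx 0 a); rewrite -/(bil _ _ _) bil_delta mxE.
by apply; apply/eqP => /rowP/(_ a); rewrite !mxE !eqxx => /eqP; rewrite oner_eq0.
Qed.

(** T_xV is spanned by e_1 and the e_a. *)
Lemma tangent_ind (P : 'rV[R]_m.+2 -> Prop) :
  P 0 -> (forall a x y, P x -> P y -> P (a *: x + y)) ->
  P (row (i1 m) E) -> (forall a, P (row (ia a) E)) -> forall w, P (tmap f x w).
Proof.
move=> P0 PL P1 Pa w.
have : tmap f x w \in tangent_image f x.
  by apply/memv_imgP; exists w; rewrite ?memvf // lfunE.
rewrite (frame_tangent iE); apply: span_ind => // u /mapP[i _ ->].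
by case: (unliftP ord0 i) => [a ->|->]; rewrite -?ia_lift -?i1_lift.
Qed.

End AtPoint.
End IsotropicFrames.

(** * Vector fields along a map *)

Section FieldsAlongMap.
Variables (R : realType) (d n : nat) (M : manifold R n).
Variables (g : lorentz_metric M) (D : connection M) (hD : levi_civita g D).
Variables (V : manifold R d) (f : V -> M) (sf : smooth_map f).
Implicit Types (W : set V) (xi eta : V -> 'rV[R]_n) (y : V).

Lemma smooth_field_at W xi y p q : open W -> smooth_field f W xi -> W y ->
  dom p y -> dom q (f y) -> smooth_at (coord p y) (field_rep f p q xi).
Proof. by move=> oW /(smooth_fieldP sf _ oW) H; exact: H. Qed.

Lemma smooth_field_sub W W' xi : open W -> open W' -> W' `<=` W ->
  smooth_field f W xi -> smooth_field f W' xi.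
Proof.
move=> oW oW' sW sxi; apply/(smooth_fieldP sf _ oW') => y p q /sW Wy py qy.
exact: smooth_field_at oW sxi Wy py qy.
Qed.

Lemma field_rep_coord p q xi y : dom p y ->
  field_rep f p q xi (coord p y) = tcoord q (f y) (xi y).
Proof. by move=> py; rewrite /field_rep point_coord. Qed.

Lemma covd_linear y xi : linear (fun v => covd D f y v xi).
Proof.
move=> a u v; rewrite /covd /Gamma.
have := chr_linearl (Gam D (f y)) (coord (f y) (f y)) (xi y) a (tmap f y u) (tmap f y v).
have -> : a *: tmap f y u + tmap f y v = tmap f y (a *: u + v).
  exact/esym/(@tmap_linear _ _ _ _ _ f y).
move=> E; have L : 'd (field_rep f y (f y) xi) (coord y y) (a *: u + v) =
   a *: 'd (field_rep f y (f y) xi) (coord y y) u + 'd (field_rep f y (f y) xi) (coord y y) v.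
  exact: linearP.
apply: etrans (congr2 _ L E) _.
by rewrite scalerDr addrACA.
Qed.

Lemma covd_near W xi eta y v : open W -> smooth_field f W xi -> W y ->
  (forall z, W z -> xi z = eta z) -> covd D f y v eta = covd D f y v xi.
Proof.
move=> oW sxi Wy e; rewrite !covd_along; apply: along_ext.
  apply: smooth_at_differentiable.
  exact: smooth_field_at oW sxi Wy (dom_self y) (dom_self (f y)).
apply: filterS (near_point (dom_self y) (open_nbhs_nbhs (conj oW Wy))) => u Wu.
by rewrite /field_rep e.
Qed.

Lemma covd_scale W (s : V -> R) xi y v : open W -> smooth_field f W xi -> W y ->
  smooth_at (coord y y) (fun u => s (point y u)) ->
  covd D f y v (fun z => s z *: xi z) =
  s y *: covd D f y v xi + 'd (fun u => s (point y u) : R) (coord y y) v *: xi y.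
Proof.
move=> oW sxi Wy ss; rewrite !covd_along.
have -> : field_rep f y (f y) (fun z => s z *: xi z) =
   fun u => s (point y u) *: field_rep f y (f y) xi u.
  by apply: funext => u; rewrite /field_rep linearZ.
have sx := smooth_field_at oW sxi Wy (dom_self y) (dom_self (f y)).
apply: etrans (alongZ (Gam D (f y)) (frep f y (f y)) v ss sx) _.
by rewrite (field_rep_coord _ _ (dom_self y)) tcoord_self (point_coord (dom_self y)).
Qed.

Lemma smooth_field_scale W (s : V -> R) xi : open W -> smooth_field f W xi ->
  (forall y p, W y -> dom p y -> smooth_at (coord p y) (fun u => s (point p u))) ->
  smooth_field f W (fun z => s z *: xi z).
Proof.
move=> oW sxi ss; apply/(smooth_fieldP sf _ oW) => y p q Wy py qy.
have -> : field_rep f p q (fun z => s z *: xi z) =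
   fun u => s (point p u) *: field_rep f p q xi u.
  by apply: funext => u; rewrite /field_rep linearZ.
by apply: smooth_atZ; [exact: ss|exact: smooth_field_at oW sxi Wy py qy].
Qed.

(** Metric compatibility, for fields whose product is constant: this covers all
the relations between the vectors of an isotropic frame. *)
Lemma gprod_covd W xi eta (k : R) y v : open W -> smooth_field f W xi ->
  smooth_field f W eta -> (forall z, W z -> gprod g (f z) (xi z) (eta z) = k) -> W y ->
  gprod g (f y) (covd D f y v xi) (eta y) + gprod g (f y) (xi y) (covd D f y v eta) = 0.
Proof.
move=> oW sxi seta c Wy; have yy := dom_self y; have qq := dom_self (f y).
have sx := smooth_field_at oW sxi Wy yy qq.
have se := smooth_field_at oW seta Wy yy qq.
have Fc : frep f y (f y) (coord y y) = coord (f y) (f y) by exact: frep_coord.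
have OF : coord_image (f y) (frep f y (f y) (coord y y)) by rewrite Fc; exact: image_coord.
have [_ DM] := metric_along (@gcoef_smooth_at _ _ _ g (f y))
  (@dot_gcoef_compat _ _ _ _ _ hD (f y)) v OF (frep_smooth sf yy qq) sx se.
rewrite !covd_along !gprod_self.
have := DM; rewrite Fc !(field_rep_coord _ _ yy) !tcoord_self => <-.
apply: (@diff_near_cst _ _ _ _ k).
apply: filterS2 (near_point yy (f_near_dom sf qq)) (near_point yy (open_nbhs_nbhs (conj oW Wy))).
move=> u qu Wu; rewrite -(c _ Wu) (gprod_chart _ _ _ qu).
by [].
Qed.

End FieldsAlongMap.

(** * Umbilical hypersurfaces *)

Section Umbilical.
Variables (R : realType) (m : nat).
Variables (M : manifold R m.+2) (g : lorentz_metric M).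
Variables (D : connection M) (hD : levi_civita g D).
Variables (V : manifold R m.+1) (f : V -> M) (sf : smooth_map f).

Section FrameField.
Variables (W : set V) (E : V -> 'M[R]_m.+2) (l : V -> R).
Hypothesis uE : umbilical_frame_field g D f W E l.

Local Notation e1 := (fun z => row (i1 m) (E z)).

Lemma field_open : open W. Proof. by have [[]] := uE. Qed.
Lemma field_smooth i : smooth_field f W (fun z => row i (E z)).
Proof. by have [[_ H _]] := uE. Qed.
Lemma field_frame y : W y -> isotropic_frame g f y (E y).
Proof. by have [[_ _ H] _] := uE; exact: H. Qed.
Lemma field_l_neq0 y : W y -> l y != 0.
Proof. by have [_ H] := uE; move=> /H[]. Qed.

(** The frame components of omega^n_a are products of D e_a with e_1, and
differentiating the orthogonality relations turns them into products of D e_1. *)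
Lemma umbilical_eq y v w : W y ->
  gprod g (f y) (covd D f y v e1) (tmap f y w) =
  l y * gprod g (f y) (tmap f y v) (tmap f y w).
Proof.
move=> Wy; have iE := field_frame Wy.
have leib i j k : (forall z, W z -> gprod g (f z) (row i (E z)) (row j (E z)) = k) ->
    gprod g (f y) (covd D f y v (fun z => row i (E z))) (row j (E y)) +
    gprod g (f y) (row i (E y)) (covd D f y v (fun z => row j (E z))) = 0.
  move=> c; exact: (gprod_covd hD sf v field_open (field_smooth i) (field_smooth j) c Wy).
apply: (tangent_ind iE (P := fun X => gprod g (f y) (covd D f y v e1) X =
  l y * gprod g (f y) (tmap f y v) X)).
- by rewrite !gprod_bil /bil trmx0 !mulmx0 mxE mulr0.
- move=> a X Y; rewrite !gprod_bil !bilDr !bilZr => -> ->; ring.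
- rewrite (gprodC _ _ (tmap f y v)) (e1_orth iE) mulr0.
  have := leib (i1 m) (i1 m) 0 (fun z Wz => frame_e1_isotropic (field_frame Wz)).
  rewrite (gprodC _ _ (row _ _) (covd _ _ _ _ _)) => H; lra.
move=> a.
have := leib (ia a) (i1 m) 0 (fun z Wz => frame_ea_e1 (field_frame Wz) a).
rewrite (gprod_e1 iE) (gprodC _ _ (row (ia a) _)) => H.
have [_ sfm] := uE.2 y Wy; have := sfm a v; rewrite /conn_form => cf.
have -> : gprod g (f y) (covd D f y v e1) (row (ia a) (E y)) =
   (covd D f y v (fun z => row (ia a) (E z)) *m invmx (E y)) 0 (inn m) by lra.
rewrite cf (gprod_ea iE) mulr_sumr; apply: eq_bigr => b _.
by rewrite mxE -mulrA.
Qed.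

(** Umbilicity for one pair of vectors gives lambda as the quotient of (D_v e_1,
e_a) by (v, e_a). With v constant in the chart and equal to e_a at y, the
denominator does not vanish near y. *)
Lemma l_smooth (a0 : 'I_m) y p : W y -> dom p y ->
  smooth_at (coord p y) (fun u => l (point p u)).
Proof.
move=> Wy py; pose q := f y; have qy : dom q (f y) := dom_self _.
have iE := field_frame Wy; have [v0 v0E] := ea_preimage iE a0.
pose F := frep f p q; pose v := tcoord p y v0.
pose ea := field_rep f p q (fun z => row (ia a0) (E z)).
pose eh := field_rep f p q e1.
have sF : smooth_at (coord p y) F by exact: frep_smooth.
have se : smooth_at (coord p y) eh := smooth_field_at sf field_open (field_smooth _) Wy py qy.
have sa : smooth_at (coord p y) ea := smooth_field_at sf field_open (field_smooth _) Wy py qy.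
have FE z : dom p z -> F (coord p z) = coord q (f z) by exact: frep_coord.
have OF : coord_image q (F (coord p y)) by rewrite FE //; exact: image_coord.
have sg : smooth_at (coord p y) (fun u => gcoef g q (F u)).
  apply: (smooth_at_comp sF); exact: (@gcoef_smooth_at _ _ _ g q _ OF).
have sA : smooth_at (coord p y) (fun u => along (Gam D q) F eh u v).
  exact: (smooth_along (@Gam_smooth_at _ _ _ _ q)).
(* v is constant in the chart p and corresponds at y to a vector sent to e_a *)
pose num u : R := bil (gcoef g q (F u)) (along (Gam D q) F eh u v) (ea u).
pose den u : R := bil (gcoef g q (F u)) ('d F u v) (ea u).
have sn : smooth_at (coord p y) num by exact: smooth_at_bil.
have sd : smooth_at (coord p y) den.
  by apply: smooth_at_bil => //; exact: smooth_at_diff.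
have key z : W z -> dom p z -> dom q (f z) ->
   num (coord p z) = l z * den (coord p z).
  move=> Wz pz qz; pose w := tback p z v.
  have vw : v = tcoord p z w by rewrite tbackK.
  have [k kE] := ea_preimage (field_frame Wz) a0.
  have := umbilical_eq w k Wz; rewrite kE !(gprod_chart _ _ _ qz).
  rewrite (covd_chart D sf w pz qz); last first.
    exact: (smooth_field_at sf field_open (field_smooth _) Wz (dom_self z) (dom_self (f z))).
  have -> : tcoord q (f z) (row (ia a0) (E z)) = ea (coord p z).
    by rewrite /ea field_rep_coord.
  by rewrite (tmap_chart sf w pz qz) -vw -(FE z pz).
have dn : den (coord p y) != 0.
  rewrite /den /v -(tmap_chart sf v0 py qy) v0E /ea field_rep_coord // FE //.
  have := ea_pos iE a0; rewrite (gprod_chart _ _ _ qy) => H; exact: lt0r_neq0 H.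
have N := smooth_at_neq0 sd dn.
apply: (@smooth_at_ext _ _ _ _ (fun u => num u * (den u)^-1)).
  have N1 := near_point py (open_nbhs_nbhs (conj field_open Wy)).
  have N2 := near_point py (f_near_dom sf qy).
  apply: filterS3 (near_chart py) (filterI N1 N2) N => u /coord_point[pu pE] [Wu qu] du.
  have := key _ Wu pu qu; rewrite pE => ->.
  by rewrite mulfK.
by apply: smooth_atM => //; exact: smooth_atV.
Qed.

End FrameField.
End Umbilical.

(** * The differential of the singular point *)

Lemma linear_form_mx (R : realType) n (h : 'rV[R]_n -> R) (v : 'rV[R]_n) :
  (forall a u w, h (a *: u + w) = a * h u + h w) ->
  h v = (v *m \col_j h (delta_mx 0 j)) 0 0.
Proof.
move=> lh; have h0 : h 0 = 0.
  by have := lh (-1) 0 0; rewrite scaler0 addr0 mulN1r addNr.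
rewrite mxE {1}[v]row_sum_delta.
elim/big_rec2: _ => [//|j y1 y2 _ E12].
by rewrite lh E12 mxE.
Qed.

Section FormsInCharts.
Variables (R : realType) (n : nat) (V : manifold R n).
Implicit Types (W : set V) (phi : V -> 'cV[R]_n) (p y : V).

Definition form_rep phi p (u : 'rV[R]_n) : 'cV[R]_n :=
  jacobian (transition p (point p u)) u *m phi (point p u).

Lemma form_rep_coord phi p y b : dom p y ->
  (b *m form_rep phi p (coord p y)) 0 0 = (tback p y b *m phi y) 0 0.
Proof. by move=> py; rewrite /form_rep mulmxA point_coord // tback_jacobian. Qed.

Lemma form_rep_tcoord phi p y v : dom p y ->
  (tcoord p y v *m form_rep phi p (coord p y)) 0 0 = (v *m phi y) 0 0.
Proof. by move=> py; rewrite form_rep_coord // tcoordK. Qed.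

Lemma form_rep_smooth W phi p y : open W -> smooth_form W phi -> W y -> dom p y ->
  smooth_at (coord p y) (form_rep phi p).
Proof.
move=> oW sphi Wy py; have oO : open (coord p @` (dom p `&` W)).
  exact: chart_image_open oW.
by apply: ((smooth_onP _ oO).1 (sphi p)); exists y.
Qed.

Lemma tback_self y b : tback y y b = b.
Proof. exact: diff_transition_id (dom_self y). Qed.

End FormsInCharts.

Section Pole.
Variables (R : realType) (m : nat) (a0 : 'I_m).
Variables (M : manifold R m.+2) (g : lorentz_metric M).
Variables (D : connection M) (hD : levi_civita g D).
Variables (V : manifold R m.+1) (f : V -> M) (sf : smooth_map f).
Variables (W : set V) (E : V -> 'M[R]_m.+2) (l : V -> R).
Hypothesis uE : umbilical_frame_field g D f W E l.

Local Notation e1 := (fun z => row (i1 m) (E z)).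

(** The vector from x to F. *)
Definition pole (z : V) : 'rV[R]_m.+2 := - (l z)^-1 *: row (i1 m) (E z).

Lemma pole_coef_smooth y p : W y -> dom p y ->
  smooth_at (coord p y) (fun u => - (l (point p u))^-1).
Proof.
move=> Wy py; apply: smooth_atN; apply: smooth_atV.
  by rewrite point_coord // (field_l_neq0 uE).
exact: (l_smooth hD sf uE a0 Wy py).
Qed.

Lemma pole_smooth : smooth_field f W pole.
Proof.
apply: (smooth_field_scale sf (field_open uE) (field_smooth uE (i1 m))).
exact: pole_coef_smooth.
Qed.

Lemma dF_linear y : linear (dF D f E l y).
Proof.
move=> a u v; rewrite /dF.
rewrite (@tmap_linear _ _ _ _ _ f y) (@covd_linear _ _ _ _ D _ f y).
have alg (p q r s : 'rV[R]_m.+2) :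
  a *: p + q + (a *: r + s) = a *: (p + r) + (q + s) by rewrite scalerDr addrACA.
exact: alg.
Qed.

(** Modulo e_1 the two terms of dF(v) are dx(v) and - l^-1 D_v e_1, and umbilicity
makes their products with tangent vectors cancel. *)
Lemma dF_isotropic y v : W y -> dF D f E l y v =
  - gprod g (f y) (dF D f E l y v) (row (inn m) (E y)) *: row (i1 m) (E y).
Proof.
move=> Wy; have iE := field_frame uE Wy; apply: (orth_tangent iE) => w.
rewrite /dF (covd_scale D sf v (field_open uE) (field_smooth uE (i1 m)) Wy); last first.
  exact: pole_coef_smooth (dom_self y).
have alg (p q r s : 'rV[R]_m.+2) c d : c != 0 -> gprod g (f y) r s = 0 ->
    gprod g (f y) q s = c * gprod g (f y) p s ->
    gprod g (f y) (p + (- c^-1 *: q + d *: r)) s = 0.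
  move=> c0; rewrite !gprod_bil !bilDl !bilZl => -> ->.
  by rewrite mulr0 addr0 mulNr mulrA mulVf // mul1r subrr.
exact: (alg _ _ _ _ _ _ (field_l_neq0 uE Wy) (e1_orth iE w) (umbilical_eq hD sf uE v w Wy)).
Qed.

(** Pairing with e_n extracts the coefficient of e_1, up to sign. *)
Definition pole_form (y : V) : 'cV[R]_m.+1 :=
  \col_j - gprod g (f y) (dF D f E l y (delta_mx 0 j)) (row (inn m) (E y)).

Lemma pole_formE y v : (v *m pole_form y) 0 0 =
  - gprod g (f y) (dF D f E l y v) (row (inn m) (E y)).
Proof.
rewrite -(@linear_form_mx _ _ (fun v => - gprod g (f y) (dF D f E l y v) (row (inn m) (E y)))) //.
by move=> a u w; rewrite dF_linear !gprod_bil bilDl bilZl; ring.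
Qed.

Lemma dF_pole_form y v : W y ->
  dF D f E l y v = (v *m pole_form y) 0 0 *: row (i1 m) (E y).
Proof. by move=> Wy; rewrite pole_formE -dF_isotropic. Qed.

Local Notation pole_rep := (form_rep pole_form).

Lemma dF_chart p q y b : W y -> dom p y -> dom q (f y) ->
  tcoord q (f y) (dF D f E l y (tback p y b)) =
  'd (frep f p q) (coord p y) b +
  along (Gam D q) (frep f p q) (field_rep f p q pole) (coord p y) b.
Proof.
move=> Wy py qy; rewrite /dF.
have -> : tcoord q (f y) (tmap f y (tback p y b) + covd D f y (tback p y b) pole) =
  tcoord q (f y) (tmap f y (tback p y b)) + tcoord q (f y) (covd D f y (tback p y b) pole).
  exact: linearD.
rewrite (tmap_chart sf _ py qy) tbackK // (covd_chart D sf _ py qy) ?tbackK //.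
exact: (smooth_field_at sf (field_open uE) pole_smooth Wy (dom_self y) (dom_self (f y))).
Qed.

Lemma pole_rep_eq p q y b : W y -> dom p y -> dom q (f y) ->
  'd (frep f p q) (coord p y) b +
  along (Gam D q) (frep f p q) (field_rep f p q pole) (coord p y) b =
  (b *m pole_rep p (coord p y)) 0 0 *: field_rep f p q e1 (coord p y).
Proof.
move=> Wy py qy; rewrite -dF_chart // dF_pole_form // linearZ /= form_rep_coord //.
by rewrite field_rep_coord.
Qed.

Lemma pole_rep_smooth p y : W y -> dom p y -> smooth_at (coord p y) (pole_rep p).
Proof.
move=> Wy py; pose q := f y; have qy : dom q (f y) := dom_self _.
apply/smooth_at_mxP => j j0; rewrite {j0}ord1.
pose F := frep f p q.
pose xh := field_rep f p q pole.
pose en := field_rep f p q (fun z => row (inn m) (E z)).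
have sF : smooth_at (coord p y) F by exact: frep_smooth.
have sx : smooth_at (coord p y) xh := smooth_field_at sf (field_open uE) pole_smooth Wy py qy.
have se : smooth_at (coord p y) en :=
  smooth_field_at sf (field_open uE) (field_smooth uE _) Wy py qy.
have OF : coord_image q (F (coord p y)).
  by rewrite /F frep_coord //; exact: image_coord.
pose h u : R := - bil (gcoef g q (F u))
  ('d F u (delta_mx 0 j) + along (Gam D q) F xh u (delta_mx 0 j)) (en u).
apply: (@smooth_at_ext _ _ _ _ h); last first.
  apply: smooth_atN; apply: smooth_at_bil => //.
    by apply: (smooth_at_comp sF); exact: (@gcoef_smooth_at _ _ _ g q _ OF).
  apply: smooth_atD; first exact: smooth_at_diff.
  exact: (smooth_along (@Gam_smooth_at _ _ _ _ q)).
have N1 := near_point py (open_nbhs_nbhs (conj (field_open uE) Wy)).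
have N2 := near_point py (f_near_dom sf qy).
apply: filterS3 (near_chart py) N1 N2 => u /coord_point[pu pE] Wu qu.
have -> : pole_rep p u j 0 = ((delta_mx 0 j : 'rV[R]_m.+1) *m pole_rep p u) 0 0.
  by rewrite -rowE [RHS]mxE.
have := form_rep_coord pole_form (delta_mx 0 j) pu; rewrite pE => ->.
rewrite pole_formE (gprod_chart _ _ _ qu) (dF_chart _ Wu pu qu).
by rewrite pE.
Qed.

Lemma pole_form_smooth : smooth_form W pole_form.
Proof.
move=> p; have oO : open (coord p @` (dom p `&` W)).
  exact: chart_image_open (field_open uE).
by apply/(smooth_onP _ oO) => _ [y [py Wy] <-]; exact: pole_rep_smooth.
Qed.

End Pole.

(** * Curvature *)

(** The exterior derivative, in coordinates, of the 1-form whose value on a is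
(a *m psi) 0 0. *)
Definition ext (R : realType) d (psi : 'rV[R]_d -> 'cV[R]_d) u (a b : 'rV[R]_d) : R :=
  (b *m 'd psi u a) 0 0 - (a *m 'd psi u b) 0 0.

Lemma smooth_at_mulmx_left (R : realType) d k (psi : 'rV[R]_d -> 'cV[R]_k) u
    (b : 'rV[R]_k) : smooth_at u psi ->
  smooth_at u (fun z => (b *m psi z) 0 0 : R).
Proof.
move=> sp; have : smooth_at u (fun z => b *m psi z).
  by apply: smooth_at_mulmx => //; exact: smooth_at_cst.
by move/smooth_at_mxP/(_ 0 0).
Qed.

Lemma diff_mulmx_left (R : realType) d k (psi : 'rV[R]_d -> 'cV[R]_k) u a
    (b : 'rV[R]_k) : smooth_at u psi ->
  'd (fun z => (b *m psi z) 0 0 : R) u a = (b *m 'd psi u a) 0 0.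
Proof.
move=> sp; pose h : {linear 'cV[R]_k -> 'M[R]_1} := mulmx b.
have [dh hE] := diff_mx_linear h (psi u).
have dp := smooth_at_differentiable sp.
have dc : differentiable (h \o psi) u by apply: differentiable_comp dp dh.
have [_ E] := diff_entry a 0 0 dc.
apply: etrans (esym E) _.
have D : 'd (h \o psi) u = 'd h (psi u) \o 'd psi u :> (_ -> _) by exact: diff_comp dp dh.
have C : 'd (h \o psi) u a = b *m 'd psi u a.
  apply: etrans (congr1 (fun F => F a) D) _ => /=.
  exact: (congr1 (fun F => F ('d psi u a)) hE).
by rewrite C.
Qed.

Section CurvatureOfPole.
Variables (R : realType) (m : nat) (a0 : 'I_m).
Variables (M : manifold R m.+2) (g : lorentz_metric M).
Variables (D : connection M) (hD : levi_civita g D).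

Lemma riemann_skew x a b w z :
  gprod g x (riemann D x a b w) z + gprod g x w (riemann D x a b z) = 0.
Proof.
have xx := image_coord (dom_self x).
exact: (curv_skew (@image_open _ _ _ x) (@Gam_smooth_at _ _ _ D x)
  (@gcoef_smooth_at _ _ _ g x) (@dot_gcoef_compat _ _ _ _ _ hD x) a b w z xx).
Qed.

Variables (V : manifold R m.+1) (f : V -> M) (sf : smooth_map f).
Variables (W : set V) (E : V -> 'M[R]_m.+2) (l : V -> R).
Hypothesis uE : umbilical_frame_field g D f W E l.

Local Notation e1 := (fun z => row (i1 m) (E z)).
Local Notation pole := (pole E l).
Local Notation phi := (pole_form g D f E l).
Local Notation dphi y := (ext (form_rep (pole_form g D f E l) y) (coord y y)).

(** The exterior derivative of the identity dF = phi e_1. *)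
Lemma riemann_pole y a b : W y ->
  riemann D (f y) (tmap f y a) (tmap f y b) (pole y) =
  dphi y a b *: e1 y +
  ((b *m phi y) 0 0 *: covd D f y a e1 - (a *m phi y) 0 0 *: covd D f y b e1).
Proof.
move=> Wy; have yy := dom_self y; have qq := dom_self (f y).
pose q := f y; pose F := frep f y q; pose c := coord y y.
pose psi := form_rep (pole_form g D f E l) y.
have sF : smooth_at c F by exact: frep_smooth.
have sx : smooth_at c (field_rep f y q pole).
  exact: (smooth_field_at sf (field_open uE) (pole_smooth a0 hD sf uE) Wy yy qq).
have se : smooth_at c (field_rep f y q e1).
  exact: (smooth_field_at sf (field_open uE) (field_smooth uE _) Wy yy qq).
have sp : smooth_at c psi by exact: (pole_rep_smooth a0 hD sf uE Wy yy).
have OF : coord_image q (F c) by rewrite /F frep_coord //; exact: image_coord.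
have H : \forall z \near c, forall b,
    'd F z b + along (Gam D q) F (field_rep f y q pole) z b =
    (b *m psi z) 0 0 *: field_rep f y q e1 z.
  have N1 := near_point yy (open_nbhs_nbhs (conj (field_open uE) Wy)).
  have N2 := near_point yy (f_near_dom sf qq).
  apply: filterS3 (near_chart yy) N1 N2 => u /coord_point[pu pE] Wu qu b'.
  by have := pole_rep_eq a0 hD sf uE b' Wu pu qu; rewrite pE.
have := curv_of_rank_one_differential (@Gam_smooth_at _ _ _ D q) (@chr_Gam_sym _ _ _ _ _ hD q) a b OF sF sx se
  (fun b => smooth_at_mulmx_left b sp) H.
have Fc : F c = coord q q by exact: frep_coord.
rewrite Fc !field_rep_coord // !tcoord_self -!covd_along.
have K (b' : 'rV[R]_m.+1) : (b' *m psi c) 0 0 = (b' *m phi y) 0 0.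
  rewrite /psi /c form_rep_coord //; congr ((_ *m _) 0 0).
  exact: diff_transition_id.
rewrite !K => S; apply: etrans S _; congr (_ *: _ + _).
exact: (congr2 (fun s t => s - t) (diff_mulmx_left a b sp) (diff_mulmx_left b a sp)).
Qed.

End CurvatureOfPole.

Section Nonvanishing.
Variables (R : realType) (m : nat) (a0 : 'I_m).
Variables (M : manifold R m.+2) (g : lorentz_metric M).
Variables (D : connection M) (hD : levi_civita g D).
Variables (V : manifold R m.+1) (f : V -> M) (sf : smooth_map f).

Section AtPoint.
Variables (x : V) (E : 'M[R]_m.+2) (iE : isotropic_frame g f x E).

Lemma Rlow_gprod i j k l : Rlow g D f x E i j k l =
  2^-1 * gprod g (f x) (row i E) (riemann D (f x) (row k E) (row l E) (row j E)).
Proof.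
rewrite /Rlow /Rup; set X := riemann _ _ _ _ _.
have XE : X = (X *m invmx E) *m E by rewrite mulmxKV // (frame_basis iE).
rewrite {2}XE; move: (X *m invmx E) => c.
rewrite mulmx_sum_row (gprodC _ _ _ (\sum_h _)).
have -> : gprod g (f x) (\sum_h c 0 h *: row h E) (row i E) =
   \sum_h c 0 h * gprod g (f x) (row h E) (row i E).
  elim/big_rec2: _ => [|h y1 y2 _ E12]; first by rewrite gprod_bil /bil !mul0mx mxE.
  by rewrite gprod_bil bilDl bilZl -E12 -!gprod_bil.
by rewrite mulr_sumr; apply: eq_bigr => h _; rewrite gprodC; ring.
Qed.

Lemma isotropic_curvature_delta a :
  isotropic_curvature g D f x E (delta_mx 0 a) =
  Rlow g D f x E (i1 m) (ia a) (ia a) (i1 m) / screen_gram g f x E a a.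
Proof.
have S (F : 'I_m -> 'I_m -> R) :
    \sum_b \sum_c F b c * (delta_mx 0 a : 'rV[R]_m) 0 b * (delta_mx 0 a : 'rV[R]_m) 0 c = F a a.
  rewrite (bigD1 a) //= [X in _ + X]big1 ?addr0 => [|b /negPf ba]; last first.
    by apply: big1 => c _; rewrite [delta_mx 0 a 0 b]mxE ba andbF mulr0 mul0r.
  rewrite (bigD1 a) //= [X in _ + X]big1 ?addr0 => [|b /negPf ba]; last first.
    by rewrite [delta_mx 0 a 0 b]mxE ba andbF mulr0.
  by rewrite mxE !eqxx !mulr1.
by rewrite /isotropic_curvature !S.
Qed.

End AtPoint.

Variables (W : set V) (E : V -> 'M[R]_m.+2) (l : V -> R).
Hypothesis uE : umbilical_frame_field g D f W E l.

Local Notation e1 := (fun z => row (i1 m) (E z)).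
Local Notation phi := (pole_form g D f E l).

(** In the product of e_a with R(e_a, e_1) xi only the term phi(e_1) D_(e_a) e_1
survives, and umbilicity evaluates it. *)
Lemma isotropic_curvature_pole x k a : W x -> tmap f x k = row (i1 m) (E x) ->
  Rlow g D f x (E x) (i1 m) (ia a) (ia a) (i1 m) =
  2^-1 * (l x) ^+ 2 * (k *m phi x) 0 0 * screen_gram g f x (E x) a a.
Proof.
move=> Wx kE; have iE := field_frame uE Wx; have l0 := field_l_neq0 uE Wx.
have [wa waE] := ea_preimage iE a.
rewrite (Rlow_gprod iE); set X := riemann _ _ _ _ _.
have := riemann_skew hD (f x) (row (ia a) (E x)) (row (i1 m) (E x))
  (row (ia a) (E x)) (pole E l x); rewrite -/X.
have := riemann_pole a0 hD sf uE wa k Wx; rewrite waE kE => ->.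
have U1 := umbilical_eq hD sf uE wa wa Wx; have U2 := umbilical_eq hD sf uE k wa Wx.
move: U1 U2; rewrite kE waE (gprodC _ _ (row (i1 m) _)) (frame_ea_e1 iE) mulr0.
set ca := covd _ _ _ wa _; set ck := covd _ _ _ k _.
set dp := ext _ _ _ _; set pa := (wa *m _) 0 0; set pk := (k *m _) 0 0.
move=> U1 U2.
have alg (ea e1 X0 c1 c2 : 'rV[R]_m.+2) (c : R) : c != 0 ->
   gprod g (f x) ea e1 = 0 -> gprod g (f x) c1 ea = c * gprod g (f x) ea ea ->
   gprod g (f x) c2 ea = 0 ->
   gprod g (f x) X0 (- c^-1 *: e1) +
   gprod g (f x) ea (dp *: e1 + (pk *: c1 - pa *: c2)) = 0 ->
   gprod g (f x) e1 X0 = c ^+ 2 * pk * gprod g (f x) ea ea.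
  move=> c0 E1 E2 E3; rewrite -scaleNr (gprodC _ _ e1) gprodC.
  rewrite (gprodC _ _ X0) gprod_bil bilZl -gprod_bil.
  rewrite [gprod g (f x) ea _]gprodC [X in _ + X]gprod_bil !bilDl !bilZl -!gprod_bil.
  rewrite (gprodC _ _ e1 ea) E1 E2 E3 => H.
  have : c * (- c^-1 * gprod g (f x) e1 X0 + pk * (c * gprod g (f x) ea ea)) = 0.
    by rewrite -[RHS](mulr0 c) -H; congr (_ * _); ring.
  move: (gprod _ _ e1 X0) (gprod _ _ ea ea) => s t.
  have -> : c * (- c^-1 * s + pk * (c * t)) = c ^+ 2 * pk * t - s by field.
  by move/eqP; rewrite subr_eq0 => /eqP ->.
rewrite /pole => H.
rewrite (alg _ _ _ _ _ _ l0 (frame_ea_e1 iE a) U1 U2 H).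
by rewrite [screen_gram _ _ _ _ _ _]mxE; ring.
Qed.

Hypothesis hK : isotropic_curvature_nonvanishing g D f.

Lemma pole_form_isotropic_neq0 x k : W x -> tmap f x k = row (i1 m) (E x) ->
  (k *m phi x) 0 0 != 0.
Proof.
move=> Wx kE; have iE := field_frame uE Wx.
have d0 : (delta_mx 0 a0 : 'rV[R]_m) != 0.
  by apply/eqP => /rowP/(_ a0); rewrite !mxE !eqxx => /eqP; rewrite oner_eq0.
have := hK iE d0; rewrite isotropic_curvature_delta (isotropic_curvature_pole a0 Wx kE).
by apply: contraNneq => ->; rewrite mulr0 !mul0r.
Qed.

Lemma pole_form_neq0 x : W x -> phi x != 0.
Proof.
move=> Wx; have [k kE] := e1_preimage (field_frame uE Wx).
have := pole_form_isotropic_neq0 Wx kE.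
by apply: contraNneq => ->; rewrite mulmx0 mxE.
Qed.

End Nonvanishing.

(** The determinant is the m-th power of 1 + s l. *)
Lemma singular_parameterP (R : realType) m (l s : R) : (0 < m)%N -> l != 0 ->
  singular_parameter m l s <-> s = - l^-1.
Proof.
move=> m0 l0; rewrite /singular_parameter det_scalar; split=> [/eqP|->].
  rewrite expf_eq0 m0 /= addrC addr_eq0 => /eqP sl.
  by rewrite -[s](mulfK l0) sl mulN1r.
by rewrite mulNr mulVf // subrr expr0n gtn_eqF.
Qed.

Section Invariance.
Variables (R : realType) (m : nat) (a0 : 'I_m).
Variables (M : manifold R m.+2) (g : lorentz_metric M).
Variables (D : connection M) (hD : levi_civita g D).
Variables (V : manifold R m.+1) (f : V -> M) (hf : immersion f).
Hypothesis hlight : lightlike g f.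

(** The isotropic direction is the radical of the induced metric, a line. *)
Lemma e1_unique x E E' : isotropic_frame g f x E -> isotropic_frame g f x E' ->
  exists c, row (i1 m) E' = c *: row (i1 m) E.
Proof.
move=> iE iE'; have [k kE] := e1_preimage iE; have [k' kE'] := e1_preimage iE'.
have k0 : k != 0.
  by apply: contraNneq (e1_neq0 iE) => k0; rewrite -kE k0 linear0.
have [c kc] := radical_unique hlight k0 
  (fun w => etrans (congr1 (fun X => gprod g (f x) X _) kE) (e1_orth iE w))
  (fun w => etrans (congr1 (fun X => gprod g (f x) X _) kE') (e1_orth iE' w)).
by exists c; rewrite -kE' -kE kc linearZ.
Qed.

(** The two vectors e_1 are proportional by a factor c, and umbilicity, tested on
e_a, shows that lambda is multiplied by the same c. *)
Lemma pole_invariant W E l W' E' l' x :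
  umbilical_frame_field g D f W E l -> umbilical_frame_field g D f W' E' l' ->
  W x -> W' x -> pole E' l' x = pole E l x.
Proof.
move=> uE uE' Wx W'x; have iE := field_frame uE Wx; have iE' := field_frame uE' W'x.
have l0 := field_l_neq0 uE Wx; have l0' := field_l_neq0 uE' W'x.
have [c ec] := e1_unique iE iE'; have [w wE] := ea_preimage iE a0.
have oWW : open (W `&` W') by apply: openI (field_open uE) (field_open uE').
have sub := smooth_field_sub hf.1 (field_open uE) oWW (@subIsetl _ _ _) (field_smooth uE _).
have sub' := smooth_field_sub hf.1 (field_open uE') oWW (@subIsetr _ _ _) (field_smooth uE' _).
have P0 z : (W `&` W') z -> gprod g (f z) (row (i1 m) (E' z)) (row (ia a0) (E z)) = 0.
  move=> [Wz W'z]; have [wz <-] := ea_preimage (field_frame uE Wz) a0.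
  exact: e1_orth (field_frame uE' W'z) wz.
have C := gprod_covd hD hf.1 w oWW (sub' _) (sub _) P0 (conj Wx W'x).
have P1 z : (W `&` W') z -> gprod g (f z) (row (i1 m) (E z)) (row (ia a0) (E z)) = 0.
  move=> [Wz _]; have [wz <-] := ea_preimage (field_frame uE Wz) a0.
  exact: e1_orth (field_frame uE Wz) wz.
have C1 := gprod_covd hD hf.1 w oWW (sub _) (sub _) P1 (conj Wx W'x).
have U := umbilical_eq hD hf.1 uE w w Wx; have U' := umbilical_eq hD hf.1 uE' w w W'x.
move: C C1; rewrite -wE U U' wE ec.
rewrite [gprod g (f x) (c *: _) _]gprod_bil bilZl -gprod_bil.
set s := gprod _ _ (row (i1 m) _) _.
have := ea_pos iE a0; set t := gprod _ _ _ _ => t0 H H1.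
have lc : l' x = c * l x.
  apply: (mulIf (lt0r_neq0 t0)); apply/eqP; rewrite -subr_eq0; apply/eqP.
  move: H1 H; rewrite addrC => /eqP; rewrite addr_eq0 => /eqP ->.
  by rewrite mulrN => /eqP; rewrite subr_eq0 => /eqP ->; ring.
have c0 : c != 0 by apply: contraNneq l0'; rewrite lc => ->; rewrite mul0r.
by rewrite /pole ec scalerA lc; congr (_ *: _); field; rewrite c0 l0.
Qed.

Lemma dF_invariant W E l W' E' l' x v :
  umbilical_frame_field g D f W E l -> umbilical_frame_field g D f W' E' l' ->
  W x -> W' x -> dF D f E' l' x v = dF D f E l x v.
Proof.
move=> uE uE' Wx W'x; rewrite /dF; congr (_ + _).
have oWW : open (W `&` W') by apply: openI (field_open uE) (field_open uE').
have s := smooth_field_sub hf.1 (field_open uE) oWW (@subIsetl _ _ _) (pole_smooth a0 hD hf.1 uE).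
apply: (covd_near D hf.1 v oWW s (conj Wx W'x)) => z [Wz W'z].
exact/esym/(pole_invariant uE uE').
Qed.

Hypothesis humb : totally_umbilical g D f.

Lemma umbilical_field_exists x : exists W E l,
  umbilical_frame_field g D f W E l /\ W x.
Proof.
have [W [E [fE Wx]]] := frame_field_exists hf hlight x.
have [l lP] : {l : V -> R & forall y, W y -> umbilical_at g D f E y (l y)}.
  apply: (@choice _ _ (fun y r => W y -> umbilical_at g D f E y r)) => y.
  have [Wy|nWy] := pselect (W y); last by exists 0.
  by have [r rP] := humb fE Wy; exists r.
by exists W, E, l.
Qed.

End Invariance.

(** * Kernels of 1-forms *)

Section FormCalculus.
Variable R : realType.

Lemma diff_pairing k d (w : 'rV[R]_k -> 'rV[R]_d) (chi : 'rV[R]_k -> 'cV[R]_d) u v :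
  smooth_at u w -> smooth_at u chi ->
  'd (fun z => (w z *m chi z) 0 0 : R) u v =
  (w u *m 'd chi u v) 0 0 + ('d w u v *m chi u) 0 0.
Proof.
move=> sw sc; pose T (z : 'rV[R]_k) (a : 'rV[R]_d) : R := (a *m chi z) 0 0.
have lT y : linear (T y).
  by move=> a b c; rewrite /T mulmxDl -scalemxAl mxDZ.
have dT b : differentiable (fun y => T y b) u.
  by apply: smooth_at_differentiable; exact: smooth_at_mulmx_left.
apply: etrans (diff_lin_family v lT dT (smooth_at_differentiable sw)) _.
by congr (_ + _); exact: diff_mulmx_left.
Qed.

Lemma ext_cst0 d u (a b : 'rV[R]_d) : ext (fun _ => 0) u a b = 0.
Proof.
have H v : 'd (fun _ : 'rV[R]_d => 0 : 'cV[R]_d) u v = 0.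
  have := diff_cst (0 : 'cV[R]_d) u => /(congr1 (fun F => F v)); exact.
by apply: etrans (congr2 (fun X Y => (b *m X) 0 0 - (a *m Y) 0 0) (H a) (H b)) _;
  rewrite !mulmx0 subrr.
Qed.

Lemma ext_linear d (psi : 'rV[R]_d -> 'cV[R]_d) u c a a' b :
  ext psi u (c *: a + a') b = c * ext psi u a b + ext psi u a' b.
Proof.
have L : 'd psi u (c *: a + a') = c *: 'd psi u a + 'd psi u a' by exact: linearP.
have alg (X Y Z : 'cV[R]_d) : (b *m (c *: X + Y)) 0 0 - ((c *: a + a') *m Z) 0 0 =
   c * ((b *m X) 0 0 - (a *m Z) 0 0) + ((b *m Y) 0 0 - (a' *m Z) 0 0).
  by rewrite mulmxDr mulmxDl -scalemxAr -scalemxAl !mxDZ; ring.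
apply: etrans (alg _ _ _).
exact: (congr1 (fun X => (b *m X) 0 0 - ((c *: a + a') *m 'd psi u b) 0 0) L).
Qed.

Lemma extC d (psi : 'rV[R]_d -> 'cV[R]_d) u a b : ext psi u a b = - ext psi u b a.
Proof. by rewrite /ext opprB. Qed.

Lemma ext_span0 d (psi : 'rV[R]_d -> 'cV[R]_d) u X :
  (forall a b, a \in X -> b \in X -> ext psi u a b = 0) ->
  forall a b, a \in <<X>>%VS -> b \in <<X>>%VS -> ext psi u a b = 0.
Proof.
have z b : ext psi u 0 b = 0.
  by have := ext_linear psi u (-1) 0 0 b; rewrite scaler0 addr0 mulN1r addNr.
move=> H a b aX bX; move: aX.
apply: (span_ind (P := fun a => ext psi u a b = 0)); first exact: z.
  by move=> c s t; rewrite ext_linear => -> ->; rewrite mulr0 addr0.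
move=> s sX; rewrite extC; apply/eqP; rewrite oppr_eq0; apply/eqP; move: bX.
apply: (span_ind (P := fun b => ext psi u b s = 0)); first exact: z.
  by move=> c t t'; rewrite ext_linear => -> ->; rewrite mulr0 addr0.
by move=> t tX; exact: H.
Qed.

(** The second derivatives of G cancel by symmetry. *)
Lemma ext_pullback k d (G : 'rV[R]_k -> 'rV[R]_d) (psi : 'rV[R]_d -> 'cV[R]_d)
    (pull : 'rV[R]_k -> 'cV[R]_k) u a b :
  smooth_at u G -> smooth_at (G u) psi -> smooth_at u pull ->
  (\forall z \near u, forall b, (b *m pull z) 0 0 = ('d G z b *m psi (G z)) 0 0) ->
  ext pull u a b = ext psi (G u) ('d G u a) ('d G u b).
Proof.
move=> sG sp spull e.
have sc : smooth_at u (psi \o G) by exact: smooth_at_comp.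
have P a' b' : (b' *m 'd pull u a') 0 0 =
    ('d G u b' *m 'd psi (G u) ('d G u a')) 0 0 +
    ('d (fun z => 'd G z b') u a' *m psi (G u)) 0 0.
  have sb := smooth_at_diff b' sG.
  have N : \forall z \near u, ('d G z b' *m psi (G z)) 0 0 = (b' *m pull z) 0 0.
    by apply: filterS e => z /(_ b').
  have dd : differentiable (fun z => ('d G z b' *m psi (G z)) 0 0 : R) u.
    have : smooth_at u (fun z => 'd G z b' *m (psi \o G) z) by exact: smooth_at_mulmx.
    by move/smooth_at_mxP/(_ 0 0)/smooth_at_differentiable.
  apply: etrans (esym (diff_mulmx_left a' b' spull)) _.
  apply: etrans (near_eq_diff a' dd N) _.
  apply: etrans (diff_pairing a' sb sc) _; congr ((_ *m _) 0 0 + _).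
  have D := diff_comp (smooth_at_differentiable sG) (smooth_at_differentiable sp).
  exact: (congr1 (fun F => F a') D).
have S := schwarz a b sG.
have alg (x y z w : R) : z = w -> x + z - (y + w) = x - y by move=> ->; ring.
apply: etrans (congr2 (fun s t => s - t) (P a b) (P b a)) _.
by apply: alg; congr ((_ *m _) 0 0); exact: esym.
Qed.

End FormCalculus.

Section ExtInCharts.
Variables (R : realType) (n : nat) (V : manifold R n).
Implicit Types (W : set V) (phi : V -> 'cV[R]_n) (p y : V).

(** Exterior derivatives computed in the chart p and in the chart at y agree, as the
two expressions of the form are pullbacks of each other. *)
Lemma ext_form_rep W phi p y a b : open W -> smooth_form W phi -> W y -> dom p y ->
  ext (form_rep phi p) (coord p y) a b =
  ext (form_rep phi y) (coord y y) (tback p y a) (tback p y b).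
Proof.
move=> oW sphi Wy py; have yy := dom_self y.
have E : transition p y (coord p y) = coord y y by exact: transition_coord.
rewrite -E; apply: ext_pullback.
- exact: transition_smooth.
- by rewrite E; exact: form_rep_smooth Wy yy.
- exact: form_rep_smooth Wy py.
apply: filterS (near_dom py yy) => u [pu yu uE] c.
have := form_rep_coord phi c pu; rewrite uE => ->.
have -> : transition p y u = coord y (point p u) by [].
rewrite form_rep_coord //; congr ((_ *m _) 0 0).
apply: etrans (esym (diff_transition c pu yu (dom_self (point p u)))) _.
exact: (congr1 (fun z => tback y (point p u) ('d (transition p y) z c)) uE).
Qed.

End ExtInCharts.

Section KernelOfForm.
Variables (R : realType) (n : nat) (K : 'M[R]_n.+1) (psi : 'cV[R]_n.+1).
Hypothesis Ku : K \in unitmx.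
Hypothesis k0 : (row ord0 K *m psi) 0 0 != 0.

Definition kernel_coef : 'cV[R]_n :=
  ((row ord0 K *m psi) 0 0)^-1 *: (row' ord0 K *m psi).

(** The other rows of K, projected into the kernel of psi along the first one. *)
Definition kernel_rows : 'M[R]_(n, n.+1) := row' ord0 K - kernel_coef *m row ord0 K.

Lemma kernel_rows_mul : kernel_rows *m psi = 0.
Proof.
rewrite /kernel_rows mulmxBl -mulmxA [row ord0 K *m psi]mx11_scalar mul_mx_scalar.
by rewrite /kernel_coef scalerA mulfV // scale1r subrr.
Qed.

Lemma kernel_rowsP (v : 'rV[R]_n.+1) :
  (v *m psi) 0 0 = 0 <-> exists p : 'rV[R]_n, v = p *m kernel_rows.
Proof.
split=> [v0|[p ->]]; last by rewrite -mulmxA kernel_rows_mul mulmx0 mxE.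
have := mulmxKV Ku v; rewrite mulmx_top; move: (v *m invmx K) => c.
set p := \row_a _ => vE; exists p.
pose s := c 0 ord0 + (p *m kernel_coef) 0 0.
have vE' : v = s *: row ord0 K + p *m kernel_rows.
  rewrite -vE /kernel_rows mulmxBr mulmxA [p *m kernel_coef]mx11_scalar mul_scalar_mx.
  by rewrite /s scalerDl addrACA subrr addr0.
have /eqP : s * (row ord0 K *m psi) 0 0 = 0.
  by rewrite -[RHS]v0 vE' mulmxDl -mulmxA kernel_rows_mul mulmx0 addr0 -scalemxAl [RHS]mxE.
by rewrite mulf_eq0 (negPf k0) orbF vE' => /eqP ->; rewrite scale0r add0r.
Qed.

Lemma kernel_basis : exists K' : 'M[R]_n.+1,
  [/\ K' \in unitmx, row ord0 K' = row ord0 K & row' ord0 K' = kernel_rows].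
Proof.
pose K' : 'M[R]_n.+1 :=
  \matrix_(i, j) if unlift ord0 i is Some a then kernel_rows a j else K ord0 j.
have r0 : row ord0 K' = row ord0 K by apply/rowP => j; rewrite !mxE unlift_none.
have r' : row' ord0 K' = kernel_rows by apply/matrixP => i j; rewrite 2!mxE liftK.
exists K'; split => //; rewrite -row_free_unit; apply: inj_row_free => c.
rewrite mulmx_top r0 r'; set p := \row_a _ => cE.
have /eqP : c 0 ord0 * (row ord0 K *m psi) 0 0 = 0.
  have := congr1 (fun X => (X *m psi) 0 0) cE.
  by rewrite mulmxDl -mulmxA kernel_rows_mul mulmx0 addr0 -scalemxAl mul0mx [LHS]mxE [RHS]mxE.
rewrite mulf_eq0 (negPf k0) orbF => /eqP c0.
move: cE; rewrite c0 scale0r add0r /kernel_rows mulmxBr mulmxA.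
rewrite [p *m kernel_coef]mx11_scalar mul_scalar_mx => /eqP.
rewrite subr_eq0 => /eqP /(row'_indep Ku) p0.
apply/rowP => i; rewrite mxE; case: (unliftP ord0 i) => [a ->|->] //.
by have /rowP/(_ a) := p0; rewrite !mxE.
Qed.

End KernelOfForm.

Lemma diff_mulmx_right (R : realType) (A : normedModType R) p q k (chi : A -> 'M[R]_(p, q))
    (B : 'M[R]_(q, k)) u v : differentiable chi u ->
  'd (fun z => chi z *m B) u v = 'd chi u v *m B.
Proof.
move=> dc; pose h : {linear 'M[R]_(p, q) -> 'M[R]_(p, k)} := mulmxr B.
have [dh hE] := diff_mx_linear h (chi u).
have D : 'd (h \o chi) u = 'd h (chi u) \o 'd chi u :> (_ -> _) by exact: diff_comp dc dh.
apply: etrans (congr1 (fun F => F v) D) _ => /=.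
exact: (congr1 (fun F => F ('d chi u v)) hE).
Qed.

Section KernelRowsDerivative.
Variables (R : realType) (n : nat) (K : 'M[R]_n.+1) (psi : 'rV[R]_n.+1 -> 'cV[R]_n.+1).
Variables (u : 'rV[R]_n.+1).
Hypothesis sp : smooth_at u psi.
Hypothesis k0 : (row ord0 K *m psi u) 0 0 != 0.

Local Notation N := (fun z => kernel_coef K (psi z)).
Local Notation L := (fun z => kernel_rows K (psi z)).

Lemma smooth_kernel_coef : smooth_at u N.
Proof.
apply: smooth_atZ; first by apply: smooth_atV => //; exact: smooth_at_mulmx_left.
by apply: smooth_at_mulmx => //; exact: smooth_at_cst.
Qed.

Lemma smooth_kernel_rows : smooth_at u L.
Proof.
apply: smooth_atB; first exact: smooth_at_cst.
by apply: smooth_at_mulmx; [exact: smooth_kernel_coef|exact: smooth_at_cst].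
Qed.

Lemma diff_kernel_rows v : 'd L u v = - ('d N u v *m row ord0 K).
Proof.
have dN := smooth_at_differentiable smooth_kernel_coef.
have dR : differentiable (fun z => N z *m row ord0 K) u.
  apply: smooth_at_differentiable; apply: smooth_at_mulmx; first exact: smooth_kernel_coef.
  exact: smooth_at_cst.
have dT : differentiable (fun _ : 'rV[R]_n.+1 => row' ord0 K) u by exact: differentiable_cst.
have C : 'd (fun _ : 'rV[R]_n.+1 => row' ord0 K) u v = 0.
  have := diff_cst (row' ord0 K) u => /(congr1 (fun F => F v)); exact.
apply: etrans (diffBf v dT dR) _.
apply: etrans (congr2 (fun X Y => X - Y) C (diff_mulmx_right (row ord0 K) v dN)) _.
by rewrite sub0r.
Qed.

(** Differentiation of kap N = T psi, where kap is the value of psi on the first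
row of K, T the other rows, and N the coefficients. *)
Lemma diff_kernel_coef v : (row ord0 K *m psi u) 0 0 *: 'd N u v = L u *m 'd psi u v.
Proof.
pose kap z : R := (row ord0 K *m psi z) 0 0.
have sk : smooth_at u kap by exact: smooth_at_mulmx_left.
have dk := smooth_at_differentiable sk.
have dN := smooth_at_differentiable smooth_kernel_coef.
have dp := smooth_at_differentiable sp.
have nk : \forall z \near u, kap z != 0 := smooth_at_neq0 sk k0.
have e : \forall z \near u, kap z *: N z = row' ord0 K *m psi z.
  by apply: filterS nk => z kz; rewrite /kernel_coef scalerA mulfV // scale1r.
have dkN : differentiable (fun z => kap z *: N z) u.
  by apply: smooth_at_differentiable; apply: smooth_atZ => //; exact: smooth_kernel_coef.
have D1 := near_eq_diff v dkN e.
have D2 := diffZf v dk dN.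
have D3 : 'd (fun z => row' ord0 K *m psi z) u v = row' ord0 K *m 'd psi u v.
  pose h : {linear 'cV[R]_n.+1 -> 'cV[R]_n} := mulmx (row' ord0 K).
  have [dh hE] := diff_mx_linear h (psi u).
  have D : 'd (h \o psi) u = 'd h (psi u) \o 'd psi u :> (_ -> _) by exact: diff_comp dp dh.
  apply: etrans (congr1 (fun F => F v) D) _ => /=.
  exact: (congr1 (fun F => F ('d psi u v)) hE).
have D4 : 'd kap u v = (row ord0 K *m 'd psi u v) 0 0 by exact: diff_mulmx_left.
have H : kap u *: 'd N u v + (row ord0 K *m 'd psi u v) 0 0 *: N u = row' ord0 K *m 'd psi u v.
  apply: etrans (etrans (esym D1) D3); rewrite -[in LHS]D4; exact: esym D2.
have alg (X Y : 'cV[R]_n) (Z : 'cV[R]_n.+1) (c : R) :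
    c *: X + (row ord0 K *m Z) 0 0 *: Y = row' ord0 K *m Z ->
    c *: X = (row' ord0 K - Y *m row ord0 K) *m Z.
  rewrite mulmxBl -mulmxA; move: (row ord0 K *m Z) => s <-.
  by rewrite [in RHS](mx11_scalar s) mul_mx_scalar mxE eqxx mulr1n addrK.
exact: alg H.
Qed.

End KernelRowsDerivative.

(** * Integrability of the kernel of a 1-form *)

Section KernelDistribution.
Variables (R : realType) (n : nat) (V : manifold R n.+1).
Implicit Types (W : set V) (phi : V -> 'cV[R]_n.+1) (x y p : V).

Variable S : V -> {vspace 'rV[R]_n.+1}.

Definition kernel_on W phi := [/\ open W, smooth_form W phi &
  forall y, W y -> phi y != 0 /\ forall v, v \in S y <-> (v *m phi y) 0 0 = 0].

Lemma kernel_complement W phi x v : kernel_on W phi -> W x ->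
  (v *m phi x) 0 0 != 0 -> (S x :&: <[v]>)%VS = 0%VS.
Proof.
move=> [_ _ H] Wx v0; have [_ SP] := H x Wx.
apply/eqP; rewrite -subv0; apply/subvP => w; rewrite memv_cap => /andP[/SP w0 /vlineP[c wE]].
move: w0; rewrite wE -scalemxAl [LHS]mxE => /eqP.
by rewrite mulf_eq0 (negPf v0) orbF => /eqP ->; rewrite scale0r mem0v.
Qed.

Lemma form_nonzero_value (psi : 'cV[R]_n.+1) : psi != 0 ->
  exists j, ((delta_mx 0 j : 'rV[R]_n.+1) *m psi) 0 0 != 0.
Proof.
move=> psi0; have [j pj] : exists j, psi j 0 != 0.
  apply/existsP; apply: contraNT psi0; rewrite negb_exists => /forallP H.
  apply/eqP/colP => j; rewrite [RHS]mxE; apply/eqP; move: (H j); rewrite negbK.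
  by move/eqP ->.
by exists j; rewrite -rowE mxE.
Qed.

(** A constant vector on which phi does not vanish at x is still transverse to
the kernel nearby; the basis K completes it, and kernel_rows projects the rest
of the basis into the kernel. *)
Lemma kernel_frame W phi x : kernel_on W phi -> W x -> exists W1 K,
  [/\ open W1, W1 x, K \in unitmx &
    forall y, W1 y -> [/\ W y, dom x y &
      (row ord0 K *m form_rep phi x (coord x y)) 0 0 != 0]].
Proof.
move=> [oW sphi H] Wx; have [/form_nonzero_value[j j0] _] := H x Wx.
have d0 : (delta_mx 0 j : 'rV[R]_n.+1) != 0.
  by apply: contraNneq j0 => ->; rewrite mul0mx mxE.
have [K Ku [c c0 rK]] := complete_row d0.
pose kap u : R := (row ord0 K *m form_rep phi x u) 0 0.
have kx : kap (coord x x) != 0.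
  rewrite /kap rK -scalemxAl [_ (c *: _) _ _]mxE.
  by rewrite form_rep_coord ?tback_self ?mulf_neq0 //; exact: dom_self.
have sk : smooth_at (coord x x) kap.
  by apply: smooth_at_mulmx_left; exact: form_rep_smooth oW sphi Wx (dom_self x).
have N := smooth_at_neq0 sk kx.
have A : nbhs x [set y | [/\ W y, dom x y & kap (coord x y) != 0]].
  apply: filterS3 (open_nbhs_nbhs (conj oW Wx))
    (open_nbhs_nbhs (conj (dom_open x) (dom_self x))) (near_coord (dom_self x) N).
  by move=> y; split.
move: A; rewrite nbhsE => -[W1 [oW1 W1x] sub].
by exists W1, K.
Qed.

Section Frame.
Variables (W : set V) (phi : V -> 'cV[R]_n.+1) (x : V) (W1 : set V) (K : 'M[R]_n.+1).
Hypothesis kW : kernel_on W phi.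
Hypothesis Ku : K \in unitmx.
Hypothesis W1P : forall y, W1 y -> [/\ W y, dom x y &
      (row ord0 K *m form_rep phi x (coord x y)) 0 0 != 0].

Definition frame_rows (u : 'rV[R]_n.+1) : 'M[R]_(n, n.+1) :=
  kernel_rows K (form_rep phi x u).

Lemma frame_rowsP y v : W1 y -> v \in S y <->
  exists p : 'rV[R]_n, v = tback x y (p *m frame_rows (coord x y)).
Proof.
move=> /W1P[Wy xy k0]; have [_ _ /(_ y Wy)[_ SP]] := kW; rewrite SP.
rewrite -(form_rep_tcoord phi v xy); split.
  by move/(kernel_rowsP Ku k0) => [p pE]; exists p; rewrite -pE tcoordK.
by move=> [p ->]; rewrite tbackK //; apply/(kernel_rowsP Ku k0); exists p.
Qed.

Lemma frame_rows_smooth y : W1 y -> smooth_at (coord x y) frame_rows.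
Proof.
move=> W1y; have [Wy xy k0] := W1P W1y; have [oW sphi _] := kW.
exact: smooth_kernel_rows (form_rep_smooth oW sphi Wy xy) k0.
Qed.

Lemma kernel_span y : W1 y ->
  S y = <<[seq tback x y (row i (frame_rows (coord x y))) | i <- enum 'I_n]>>%VS.
Proof.
move=> W1y; apply/eqP; rewrite eqEsubv; apply/andP; split; apply/subvP => v.
  move/(frame_rowsP _ W1y) => [p ->].
  rewrite tback_jacobian -mulmxA mulmx_sum_row; apply: memv_suml => i _.
  apply/memvZ/memv_span/mapP; exists i; first exact: mem_enum.
  by rewrite tback_jacobian row_mul.
apply: (span_ind (P := fun w => w \in S y)).
- exact: mem0v.
- by move=> a u w Su Sw; apply: memvD => //; exact: memvZ.
move=> _ /mapP[i _ ->]; apply/(frame_rowsP _ W1y); exists (delta_mx 0 i).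
by rewrite rowE.
Qed.

End Frame.

Hypothesis local_kernel : forall x, exists W phi, kernel_on W phi /\ W x.

Lemma smooth_map_id : smooth_map (idfun : V -> V).
Proof. by split=> [x|p q]; [exact: cvg_id|exact: chart_compat]. Qed.

Lemma kernel_dim x : \dim (S x) = n.
Proof.
have [W [phi [[_ _ H] Wx]]] := local_kernel x; have [phi0 SP] := H x Wx.
pose h := linfun (mulmxr (phi x) : 'rV[R]_n.+1 -> 'M[R]_1).
have SE : S x = lker h.
  apply/vspaceP => v; apply/idP/idP => [/SP v0|].
    by rewrite memv_ker lfunE /=; apply/eqP; rewrite [v *m _]mx11_scalar v0 raddf0.
  by rewrite memv_ker lfunE /= => /eqP v0; apply/SP; rewrite v0 mxE.
have [j j0] := form_nonzero_value phi0.
have L : limg h = fullv.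
  apply/eqP; rewrite eqEsubv subvf /=; apply/subvP => w _.
  apply/memv_imgP; exists ((w 0 0 / ((delta_mx 0 j : 'rV[R]_n.+1) *m phi x) 0 0) *: delta_mx 0 j).
    exact: memvf.
  rewrite lfunE /= -scalemxAl [w]mx11_scalar [X in _ *: X]mx11_scalar.
  by rewrite scale_scalar_mx mulfVK // [LHS]mx11_scalar !mxE eqxx.
have := limg_ker_dim h fullv; rewrite L capfv -SE !dimvf /dim /= muln1 mul1n.
by rewrite addn1 => -[].
Qed.

End KernelDistribution.

Section Parametrizations.
Variables (R : realType) (k n : nat) (V : manifold R n) (U : set 'rV[R]_k).
Variable h : 'rV[R]_k -> V.
Hypothesis oU : open U.
Hypothesis ch : forall u, U u -> {for u, continuous h}.

Lemma near_param u (A : set V) : U u -> open A -> A (h u) -> \forall z \near u, A (h z).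
Proof. by move=> Uu oA Au; apply: (ch Uu); exact: open_nbhs_nbhs (conj oA Au). Qed.

Lemma open_param (A : set V) : open A -> open (U `&` h @^-1` A).
Proof.
move=> oA; rewrite openE => u [Uu Au]; rewrite /interior.
exact: filterI (open_nbhs_nbhs (conj oU Uu)) (near_param Uu oA Au).
Qed.

Lemma diff_param x u w : U u -> dom x (h u) -> smooth_at u (coord x \o h) ->
  'd (coord (h u) \o h) u w = tback x (h u) ('d (coord x \o h) u w).
Proof.
move=> Uu xu sG.
have e : \forall z \near u, (transition x (h u) \o (coord x \o h)) z = (coord (h u) \o h) z.
  apply: filterS (near_param Uu (dom_open x) xu) => z xz.
  exact: transition_coord.
have dG := smooth_at_differentiable sG.
have dt := smooth_at_differentiable (transition_smooth xu (dom_self (h u))).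
have dc : differentiable (transition x (h u) \o (coord x \o h)) u.
  exact: differentiable_comp dG dt.
apply: etrans (near_eq_diff w dc e) _.
have D : 'd (transition x (h u) \o (coord x \o h)) u =
   'd (transition x (h u)) (coord x (h u)) \o 'd (coord x \o h) u :> (_ -> _).
  exact: diff_comp dG dt.
exact: (congr1 (fun F => F w) D).
Qed.

End Parametrizations.

Section Integrability.
Variables (R : realType) (n : nat) (V : manifold R n.+1).
Variable S : V -> {vspace 'rV[R]_n.+1}.
Hypothesis local_kernel : forall x, exists W phi, kernel_on S W phi /\ W x.

Lemma kernel_smooth : smooth_distribution S.
Proof.
move=> x; have [W [phi [kW Wx]]] := local_kernel x.
have [W1 [K [oW1 W1x Ku W1P]]] := kernel_frame kW Wx.
exists W1, (fun i y => tback x y (row i (frame_rows phi x K (coord x y)))); split => //.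
  move=> i.
  apply: (@smooth_field_tback _ _ _ _ _ _ (@smooth_map_id _ _ V) x x
    (fun u => row i (frame_rows phi x K u)) W1 oW1).
    by move=> y /W1P[].
  by move=> y W1y; apply: smooth_at_row; exact: (frame_rows_smooth kW W1P W1y).
by move=> y W1y; exact: (kernel_span kW Ku W1P W1y).
Qed.

(** A 1-form pulls back to zero on its integral manifolds, hence so does its
exterior derivative. *)
Lemma closed_of_integrable W phi x a b : integrable_distribution S ->
  kernel_on S W phi -> W x -> a \in S x -> b \in S x ->
  ext (form_rep phi x) (coord x x) a b = 0.
Proof.
move=> int kW Wx Sa Sb; have [U [h [oU U0 h0 [ch sh] im]]] := int x.
have [oW sphi H] := kW; have xx := dom_self x.
pose G := coord x \o h; have hx : dom x (h 0) by rewrite h0.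
have oO := open_param oU ch (dom_open x).
have sG u : U u -> dom x (h u) -> smooth_at u G.
  by move=> Uu xu; apply: ((smooth_onP _ oO).1 (sh x)).
have G0 : G 0 = coord x x by rewrite /G /= h0.
have im0 c : c \in S x -> exists c', 'd G 0 c' = c.
  have := im 0 U0; rewrite h0 => <- /memv_imgP[c' _ ->].
  by exists c'; rewrite lfunE.
have [a' <-] := im0 a Sa; have [b' <-] := im0 b Sb.
have sp : smooth_at (G 0) (form_rep phi x) by rewrite G0; exact: form_rep_smooth oW sphi Wx xx.
rewrite -G0 -(@ext_pullback _ _ _ G (form_rep phi x) (fun _ => 0)) ?ext_cst0 //.
- exact: sG.
- exact: smooth_at_cst.
have W0 : W (h 0) by rewrite h0.
apply: filterS3 (open_nbhs_nbhs (conj oU U0)) (near_param ch U0 (dom_open x) hx)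
  (near_param ch U0 oW W0) => z Uz xz Wz c.
rewrite mulmx0 mxE; apply/esym.
have [_ /(_ (tback x (h z) ('d G z c)))[+ _]] := H _ Wz.
have -> : G z = coord x (h z) by [].
rewrite form_rep_coord //; apply.
rewrite -(im z Uz); apply/memv_imgP; exists c; first exact: memvf.
by rewrite lfunE; apply/esym; exact: (diff_param ch c Uz xz (sG z Uz xz)).
Qed.

Definition closed_on W phi := forall y a b, W y -> a \in S y -> b \in S y ->
  ext (form_rep phi y) (coord y y) a b = 0.

(** Up to sign, h dL(sL) - s dL(hL) is dphi(sL, hL), divided by the value of phi on
the first row of K, times that row. *)
Lemma frame_rows_symmetric W phi x (W1 : set V) K y (s h : 'rV[R]_n) : kernel_on S W phi ->
  closed_on W phi -> K \in unitmx -> (forall y, W1 y -> [/\ W y, dom x y &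
      (row ord0 K *m form_rep phi x (coord x y)) 0 0 != 0]) -> W1 y ->
  let L := frame_rows phi x K in let u := coord x y in
  h *m 'd L u (s *m L u) = s *m 'd L u (h *m L u).
Proof.
move=> kW cW Ku W1P W1y L u; have [Wy xy k0] := W1P y W1y; have [oW sphi _] := kW.
pose psi := form_rep phi x; have sp : smooth_at u psi by exact: form_rep_smooth oW sphi Wy xy.
have inS c : tback x y (c *m L u) \in S y.
  by apply/(frame_rowsP kW Ku W1P _ W1y); exists c.
have E : ext psi u (s *m L u) (h *m L u) = 0.
  by rewrite (ext_form_rep _ _ oW sphi Wy xy); exact: cW Wy (inS s) (inS h).
pose N z := kernel_coef K (psi z); pose kap : R := (row ord0 K *m psi u) 0 0.
have DN (c c' : 'rV[R]_n) : kap * (c *m 'd N u (c' *m L u)) 0 0 = (c *m L u *m 'd psi u (c' *m L u)) 0 0.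
  have H := diff_kernel_coef sp k0 (c' *m L u).
  have alg (X : 'cV[R]_n) (Y : 'cV[R]_n.+1) (A : 'M[R]_(n, n.+1)) : kap *: X = A *m Y ->
      kap * (c *m X) 0 0 = (c *m A *m Y) 0 0.
    by move=> e; rewrite -mulmxA -e -scalemxAr [RHS]mxE.
  exact: alg H.
have sym : (h *m 'd N u (s *m L u)) 0 0 = (s *m 'd N u (h *m L u)) 0 0.
  apply: (mulfI k0); apply: etrans (DN h s) _; apply: etrans _ (esym (DN s h)).
  by apply/eqP; rewrite -subr_eq0; apply/eqP; exact: E.
have DL (c c' : 'rV[R]_n) : c *m 'd L u (c' *m L u) = - (c *m 'd N u (c' *m L u)) 0 0 *: row ord0 K.
  have H := diff_kernel_rows sp k0 (c' *m L u).
  have alg (X : 'cV[R]_n) (Y : 'M[R]_(n, n.+1)) (B : 'rV[R]_n.+1) : Y = - (X *m B) ->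
      c *m Y = - (c *m X) 0 0 *: B.
    by move=> ->; rewrite mulmxN mulmxA [c *m X]mx11_scalar mul_scalar_mx -scaleNr [in RHS]mxE eqxx.
  exact: alg H.
apply: etrans (DL h s) _; apply: etrans _ (esym (DL s h)).
by rewrite sym.
Qed.

(** The integral manifold through x is the image of a solution of dy = ds L(y),
where the rows of L span the distribution in the chart x: the image of the
differential is then the row space of L. *)
Lemma integrable_of_closed : (forall x, exists W phi,
    [/\ kernel_on S W phi, closed_on W phi & W x]) -> integrable_distribution S.
Proof.
move=> lc x; have [W [phi [kW cW Wx]]] := lc x.
have [W1 [K [oW1 W1x Ku W1P]]] := kernel_frame kW Wx.
pose L := frame_rows phi x K; have xx := dom_self x.
pose P := coord x @` (dom x `&` W1).
have oP : open P by exact: chart_image_open.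
have Px : P (coord x x) by exists x.
have nP : nbhs (coord x x) P by exact: open_nbhs_nbhs.
have sL : smooth_at (coord x x) L by exact: (frame_rows_smooth kW W1P W1x).
have SY : \forall y \near coord x x, forall s h : 'rV[R]_n,
    h *m 'd L y (s *m L y) = s *m 'd L y (h *m L y).
  apply: filterS nP => _ [y [xy W1y] <-] s h.
  exact: (frame_rows_symmetric s h kW cW Ku W1P W1y).
have [F [r [r0 F0 FP]]] := total_differential sL nP SY.
have U0r (s : 'rV[R]_n) : ball 0 r s -> `|s| < r.
  by rewrite -ball_normE /= sub0r normrN.
pose h := point x \o F; pose U : set 'rV[R]_n := ball 0 r.
have oU : open U by exact: ball_open.
have inP s : U s -> [/\ dom x (h s), W1 (h s) & coord x (h s) = F s].
  move=> /U0r/FP[[y [xy W1y] yE] _ _ _].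
  by rewrite /h /= -yE point_coord.
have ch s : U s -> {for s, continuous h}.
  move=> Us; have [_ _ dF _] := FP _ (U0r _ Us); have [xs _ cs] := inP _ Us.
  have cF : {for s, continuous F} by exact: differentiable_continuous.
  have cp : {for F s, continuous (point x)}.
    by apply: point_continuous; rewrite -cs; exists (h s).
  exact: continuous_comp cF cp.
have sF s : U s -> smooth_at s F.
  move=> Us; apply: ((smooth_onP _ oU).1 _ s Us).
  apply: (@smooth_of_total_differential _ _ _ L _ _ oU) => s' /U0r/FP[_ ? ? ?].
  by split.
have sh q s : U s -> dom q (h s) -> smooth_at s (coord q \o h).
  move=> Us qs; have [xs _ cs] := inP _ Us.
  have st : smooth_at (F s) (transition x q) by rewrite -cs; exact: transition_smooth.
  exact: (smooth_at_comp (sF s Us) st).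
exists U, h; split => //.
- by rewrite /U; exact: ballxx.
- by rewrite /h /= F0 point_coord.
- split=> // q; apply/(smooth_onP _ (open_param oU ch (dom_open q))) => s [Us qs].
  exact: sh.
move=> u Uu; have [xu W1u cu] := inP u Uu; have [_ _ dF DF] := FP u (U0r _ Uu).
have Dh w : 'd (coord (h u) \o h) u w = tback x (h u) (w *m L (coord x (h u))).
  apply: etrans (diff_param ch w Uu xu (sh x u Uu xu)) _.
  congr (tback x (h u) _); rewrite cu; apply: etrans _ (DF w).
  apply: (near_eq_diff w dF).
  apply: filterS (open_nbhs_nbhs (conj oU Uu)) => z /inP[_ _ cz]; exact: esym cz.
apply/vspaceP => v; apply/idP/idP.
  move=> /memv_imgP[w _ ->]; rewrite lfunE.
  apply/(frame_rowsP kW Ku W1P _ W1u); exists w; exact: Dh.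
move=> /(frame_rowsP kW Ku W1P _ W1u)[w ->].
apply/memv_imgP; exists w; first exact: memvf.
by rewrite lfunE; exact: esym (Dh w).
Qed.

End Integrability.

(** * The screen distribution *)

Section ScreenDistribution.
Variables (R : realType) (m : nat) (a0 : 'I_m).
Variables (M : manifold R m.+2) (g : lorentz_metric M).
Variables (D : connection M) (hD : levi_civita g D).
Variables (V : manifold R m.+1) (f : V -> M) (hf : immersion f).
Hypothesis hlight : lightlike g f.
Hypothesis humb : totally_umbilical g D f.
Hypothesis hK : isotropic_curvature_nonvanishing g D f.

Lemma dF_eq0 W E l x v : umbilical_frame_field g D f W E l -> W x ->
  dF D f E l x v = 0 <-> (v *m pole_form g D f E l x) 0 0 = 0.
Proof.
move=> uE Wx; rewrite (dF_pole_form a0 hD hf.1 uE v Wx); split=> [/eqP|->]; last first.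
  by rewrite scale0r.
by rewrite scaler_eq0 (negPf (e1_neq0 (field_frame uE Wx))) orbF => /eqP.
Qed.

(** The kernel may be computed from any frame field around the point, as F does
not depend on it. *)
Lemma fixes_F_exists : exists S, fixes_F g D f S.
Proof.
have ex x : exists d : set V * (V -> 'M[R]_m.+2) * (V -> R),
    umbilical_frame_field g D f d.1.1 d.1.2 d.2 /\ d.1.1 x.
  have [W [E [l H]]] := umbilical_field_exists hf hlight humb x.
  by exists (W, E, l).
have [d dP] := choice ex.
exists (fun x => lker (linfun (mulmxr (pole_form g D f (d x).1.2 (d x).2 x) :
  'rV[R]_m.+1 -> 'M[R]_1))) => W E l uE x Wx v.
have [ud dx] := dP x; rewrite memv_ker lfunE /=.
rewrite -(dF_invariant a0 hD hf hlight v uE ud Wx dx) (dF_eq0 v ud dx).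
split=> [/eqP -> | v0]; first by rewrite mxE.
by apply/eqP; rewrite [v *m _]mx11_scalar v0 raddf0.
Qed.

Lemma fixes_F_unique S S' : fixes_F g D f S -> fixes_F g D f S' ->
  forall x, S' x = S x.
Proof.
move=> FS FS' x; have [W [E [l [uE Wx]]]] := umbilical_field_exists hf hlight humb x.
apply/vspaceP => v; apply/idP/idP => Sv.
  by apply/(FS _ _ _ uE x Wx)/(FS' _ _ _ uE x Wx).
by apply/(FS' _ _ _ uE x Wx)/(FS _ _ _ uE x Wx).
Qed.

Variable S : V -> {vspace 'rV[R]_m.+1}.
Hypothesis FS : fixes_F g D f S.

Lemma fixes_F_kernel W E l : umbilical_frame_field g D f W E l ->
  kernel_on S W (pole_form g D f E l).
Proof.
move=> uE; split; first exact: field_open uE.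
  exact: (pole_form_smooth a0 hD hf.1 uE).
move=> x Wx; split; first exact: (pole_form_neq0 a0 hD hf.1 uE hK Wx).
by move=> v; rewrite (FS uE Wx v); exact: (dF_eq0 v uE Wx).
Qed.

Lemma fixes_F_local_kernel x : exists W phi, kernel_on S W phi /\ W x.
Proof.
have [W [E [l [uE Wx]]]] := umbilical_field_exists hf hlight humb x.
by exists W, (pole_form g D f E l); split => //; exact: fixes_F_kernel.
Qed.

Lemma fixes_F_screen : screen_distribution g f S.
Proof.
split; [exact: kernel_smooth fixes_F_local_kernel|exact: kernel_dim fixes_F_local_kernel|].
move=> x E' v iE' vE; have [W [E [l [uE Wx]]]] := umbilical_field_exists hf hlight humb x.
have iE := field_frame uE Wx; have [k kE] := e1_preimage iE.
have k0 := pole_form_isotropic_neq0 a0 hD hf.1 uE hK Wx kE.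
have [c ec] := e1_unique hlight iE' iE.
have kv : k = c *: v.
  by apply: (hf.2 x); rewrite kE ec -vE [RHS]linearZ.
have v0 : (v *m pole_form g D f E l x) 0 0 != 0.
  by apply: contraNneq k0 => v0; rewrite kv -scalemxAl [_ (c *: _) _ _]mxE v0 mulr0.
have C := kernel_complement (fixes_F_kernel uE) Wx v0; split => //.
apply/eqP; rewrite eqEdim subvf /=.
have := dimv_sum_cap (S x) <[v]>%VS; rewrite C dimv0 addn0 => ->.
rewrite (kernel_dim fixes_F_local_kernel) dim_vline dimvf /dim /= mul1n.
suff -> : v != 0 by rewrite addn1.
by apply: contraNneq v0 => ->; rewrite mul0mx mxE.
Qed.

(** On the kernel of phi the identity for R(v, w) xi reduces to dphi(v, w) e_1; the
component along e_1 is read off by pairing with e_n, and skew-symmetry of the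
curvature moves it from e_n back to xi, a multiple of e_1. *)
Lemma Rup_ext W E l x E' a b sa sb : umbilical_frame_field g D f W E l -> W x ->
  isotropic_frame g f x E' -> tmap f x sa = row (ia a) E' -> tmap f x sb = row (ia b) E' ->
  sa \in S x -> sb \in S x ->
  Rup D f x E' (i1 m) (i1 m) (ia a) (ia b) =
  - 2^-1 * l x * ext (form_rep (pole_form g D f E l) x) (coord x x) sa sb.
Proof.
move=> uE Wx iE' saE sbE Ssa Ssb; have iE := field_frame uE Wx.
have l0 := field_l_neq0 uE Wx; have [_ _ /(_ x Wx)[_ SP]] := fixes_F_kernel uE.
have [c ec] := e1_unique hlight iE iE'.
have c0 : c != 0 by apply: contraNneq (e1_neq0 iE'); rewrite ec => ->; rewrite scale0r.
have := riemann_pole a0 hD hf.1 uE sa sb Wx.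
rewrite ((SP sa).1 Ssa) ((SP sb).1 Ssb) !scale0r subrr addr0 saE sbE => RP.
have SK w := riemann_skew hD (f x) (row (ia a) E') (row (ia b) E') w (row (inn m) E').
have := SK (pole E l x); have := SK (row (i1 m) E'); rewrite RP /Rup.
rewrite (gprod_en iE').
set X := (_ *m invmx E') 0 (i1 m); set Z := riemann _ _ _ _ (row (inn m) _).
have := frame_e1_en iE'; rewrite ec /pole.
set e := row (i1 m) (E x); set en := row (inn m) E'; set d := ext _ _ _ _.
rewrite !gprod_bil !bilZl -!gprod_bil => cn H1 H2.
have en0 : gprod g (f x) e en = - c^-1 by rewrite -[LHS](mulKf c0) cn mulrN1.
move: H1 H2; rewrite en0; move: (gprod g (f x) e Z) => t H1 H2.
have XE : X = c * t by apply/eqP; rewrite -subr_eq0 -oppr_eq0 opprB addrC; apply/eqP.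
have tE : t = - (l x * d * c^-1).
  apply: (mulfI (x := - (l x)^-1)); first by rewrite oppr_eq0 invr_eq0.
  apply/eqP; rewrite -subr_eq0; apply/eqP; rewrite -[RHS]H2; field.
  by rewrite c0 l0.
by rewrite XE tE; field; rewrite c0.
Qed.

Lemma adapted_preimage x E a : adapted f S x E ->
  exists2 s, s \in S x & tmap f x s = row (ia a) E.
Proof.
move=> ad; have : row (ia a) E \in (linfun (tmap f x) @: S x)%VS.
  by rewrite ad; apply/memv_span/mapP; exists a; rewrite ?mem_enum.
by move=> /memv_imgP[s Ss ->]; exists s => //; rewrite lfunE.
Qed.

(** A basis of S_x together with the radical direction is a basis of T_xV, the
tangent part of an isotropic frame. *)
Lemma adapted_frame_exists x : exists (E : 'M[R]_m.+2) (T : 'I_m -> 'rV[R]_m.+1),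
  [/\ isotropic_frame g f x E, adapted f S x E,
      (forall a, tmap f x (T a) = row (ia a) E) &
      S x = <<[seq T a | a <- enum 'I_m]>>%VS].
Proof.
have [W [E0 [l [uE Wx]]]] := umbilical_field_exists hf hlight humb x.
have iE := field_frame uE Wx; have [k kE] := e1_preimage iE.
have kphi := pole_form_isotropic_neq0 a0 hD hf.1 uE hK Wx kE.
have k0 : k != 0 by apply: contraNneq kphi => ->; rewrite mul0mx mxE.
have [K Ku [c c0 rK]] := complete_row k0.
pose psi := pole_form g D f E0 l x.
have Kphi : (row ord0 K *m psi) 0 0 != 0.
  by rewrite rK -scalemxAl [_ (c *: _) _ _]mxE mulf_neq0.
have [K' [K'u rK' r'K']] := kernel_basis Ku Kphi.
have rad : radical g f x (row ord0 K').
  have tk : tmap f x (row ord0 K') = c *: row (i1 m) (E0 x).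
    by rewrite rK' rK -kE; exact: linearZ.
  move=> w; rewrite tk gprod_bil bilZl -gprod_bil.
  by rewrite (e1_orth iE) mulr0.
have [E [iE' rE]] := isotropic_frame_of_basis hf hlight K'u rad.
pose T a := row a (kernel_rows K psi).
have TE a : tmap f x (T a) = row (ia a) E.
  rewrite ia_lift rE /T -r'K'; congr (tmap f x _); by apply/rowP => j; rewrite !mxE.
have [_ _ /(_ x Wx)[_ SP]] := fixes_F_kernel uE.
have ST : S x = <<[seq T a | a <- enum 'I_m]>>%VS.
  apply/vspaceP => v; apply/idP/idP.
    move/SP/(kernel_rowsP Ku Kphi) => [p ->].
    rewrite mulmx_sum_row; apply: memv_suml => i _.
    by apply/memvZ/memv_span/mapP; exists i; rewrite ?mem_enum.
  apply: (span_ind (P := fun w => w \in S x)); first exact: mem0v.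
    by move=> a u w Su Sw; apply: memvD => //; exact: memvZ.
  move=> _ /mapP[i _ ->]; apply/SP/(kernel_rowsP Ku Kphi); exists (delta_mx 0 i).
  exact: rowE.
exists E, T; split => //.
rewrite /adapted ST limg_span -map_comp; congr <<_>>%VS.
apply: eq_map => a /=; rewrite lfunE; exact: TE.
Qed.

Lemma integrable_iff_Rup : integrable_distribution S <->
  forall (x : V) (E : 'M[R]_m.+2), isotropic_frame g f x E -> adapted f S x E ->
    forall a b : 'I_m, Rup D f x E (i1 m) (i1 m) (ia a) (ia b) = 0.
Proof.
have lk := fixes_F_local_kernel; split=> [int x E' iE' ad a b|H].
  have [W [E [l [uE Wx]]]] := umbilical_field_exists hf hlight humb x.
  have [sa Sa saE] := adapted_preimage a ad; have [sb Sb sbE] := adapted_preimage b ad.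
  rewrite (Rup_ext uE Wx iE' saE sbE Sa Sb).
  by rewrite (closed_of_integrable int (fixes_F_kernel uE) Wx Sa Sb) mulr0.
have closed_pole W E l x a b : umbilical_frame_field g D f W E l -> W x ->
    a \in S x -> b \in S x ->
    ext (form_rep (pole_form g D f E l) x) (coord x x) a b = 0.
  move=> uE Wx; have [E' [T [iE' ad TE ST]]] := adapted_frame_exists x.
  have TS i : T i \in S x by rewrite ST; apply/memv_span/mapP; exists i; rewrite ?mem_enum.
  rewrite ST; apply: ext_span0 => _ _ /mapP[i _ ->] /mapP[j _ ->].
  have := H x E' iE' ad i j; rewrite (Rup_ext uE Wx iE' (TE i) (TE j) (TS i) (TS j)).
  move/eqP; rewrite mulf_eq0 => /orP[|/eqP //].
  by rewrite mulf_eq0 oppr_eq0 invr_eq0 pnatr_eq0 (negPf (field_l_neq0 uE Wx)).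
apply: integrable_of_closed => x.
have [W [E [l [uE Wx]]]] := umbilical_field_exists hf hlight humb x.
exists W, (pole_form g D f E l); split => //; first exact: fixes_F_kernel.
by move=> y a b Wy; exact: (closed_pole W E l y a b uE Wy).
Qed.

End ScreenDistribution.

Theorem theorem11 (R : realType) (m : nat) (hn : (4 <= m.+2)%N)
    (M : manifold R m.+2) (g : lorentz_metric M)
    (D : connection M) (hD : levi_civita g D)
    (V : manifold R m.+1) (f : V -> M) (hf : immersion f)
    (hlight : lightlike g f) (humb : totally_umbilical g D f)
    (hK : isotropic_curvature_nonvanishing g D f) :
  (forall (W : set V) (E : V -> 'M[R]_m.+2) (l : V -> R),
     umbilical_frame_field g D f W E l ->
     (forall x s, W x -> singular_parameter m (l x) s <-> s = - (l x)^-1) /\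
     (exists phi : V -> 'cV[R]_m.+1,
        smooth_form W phi /\
        forall x, W x ->
          phi x != 0 /\
          forall v, dF D f E l x v = (v *m phi x) 0 0 *: row (i1 m) (E x)))
  /\
  (exists S : V -> {vspace 'rV[R]_m.+1},
     [/\ screen_distribution g f S,
         fixes_F g D f S,
         (forall S', fixes_F g D f S' -> forall x, S' x = S x)
       & integrable_distribution S <->
         (forall (x : V) (E : 'M[R]_m.+2),
            isotropic_frame g f x E -> adapted f S x E ->
            forall a b : 'I_m, Rup D f x E (i1 m) (i1 m) (ia a) (ia b) = 0)]).
Proof.
have m0 : (0 < m)%N by apply: leq_trans (_ : 2 <= m)%N.
have a0 : 'I_m := Ordinal m0.
split=> [W E l uE|].
  split=> [x s Wx|]; first exact: singular_parameterP m0 (field_l_neq0 uE Wx).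
  exists (pole_form g D f E l); split; first exact: (pole_form_smooth a0 hD hf.1 uE).
  move=> x Wx; split; first exact: (pole_form_neq0 a0 hD hf.1 uE hK Wx).
  by move=> v; exact: (dF_pole_form a0 hD hf.1 uE v Wx).
have [S FS] := fixes_F_exists a0 hD hf hlight humb; exists S; split => //.
- exact: (fixes_F_screen a0 hD hf hlight humb hK FS).
- by move=> S' FS'; exact: (fixes_F_unique hf hlight humb FS FS').
exact: (integrable_iff_Rup a0 hD hf hlight humb hK FS).
Qed.
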